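(* Let $\mathcal{J}$ be an order filter in the lattice of flats of $L$ and let $k$ be an integer. Then the following subspaces of $\operatorname{Sym}L^*$ coincide: $$C_{L,\mathcal{J},k}=H^0(W_L,\mathcal{O}_{W_L}(1,\dots,1)(k\alpha)(D_{\mathcal{J}})).$$
   Context: Let $L$ be a complex vector space of dimension $r$, and let $\ell_1,\dots,\ell_n \in L^*$ be linear forms (possibly zero, possibly proportional) with zero loci $H_1,\dots,H_n$ satisfying $H_1\cap\dots\cap H_n=0$. Set $E=\{1,\dots,n\}$. A flat is a subset $F\subseteq E$ such that if $\bigcap_{i\in F}H_i\subseteq H_j$ then $j\in F$; put $L_F=\bigcap_{i\in F}H_i$. A flat is proper if $F\ne E$. An order filter is a set $\mathcal{J}$ of flats such that $F\in\mathcal{J}$ and $G\supset F$ a flat imply $G\in\mathcal{J}$. The augmented wonderful variety $W_L$ is the smooth projective variety obtained from $\mathbb{P}(L\oplus\mathbb{C})$ by blowing up the strict transforms of the strata $\mathbb{P}(L_F)$ of the hyperplane at infinity $\mathbb{P}L$, for $F$ a proper flat, in increasing order of dimension. It contains $L$ as an open subset, and $W_L\setminus L$ is a simple normal crossings divisor with irreducible components $D_F$, $F$ a proper flat, where $D_F$ is the strict transform of the exceptional divisor over $\mathbb{P}(L_F)$ (the strict transform of $\mathbb{P}L$ if $L_F=L$). Put $D_{\mathcal{J}}=\sum_{F\in\mathcal{J}\setminus\{E\}}D_F$. $\alpha$ is the pullback to $W_L$ of the hyperplane class of $\mathbb{P}(L\oplus\mathbb{C})$, and $\mathcal{O}(1,\dots,1)$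 is the pullback of $\mathcal{O}(1)^{\boxtimes n}$ under the map $W_L\to(\mathbb{P}^1)^n$ extending $(\ell_1,\dots,\ell_n):L\to\mathbb{C}^n$. One identifies $\mathcal{O}(1,\dots,1)(k\alpha)=\mathcal{O}(\sum_F(n-|F|+k)D_F)$ (sum over proper flats). For a divisor $D$ supported on $W_L\setminus L$, $H^0(W_L,\mathcal{O}(D))$ is the space of rational functions $f$ with $\operatorname{div}(f)+D\ge0$ (together with $0$), viewed by restriction to $L$ as a subspace of $\operatorname{Sym}L^*$. For $v\in L$, $\rho(v)$ is the number of $i$ with $v\notin H_i$, and $\chi_{\mathcal{J}}(v)=1$ if $v\in L_F$ for some $F\in\mathcal{J}$, $\chi_{\mathcal{J}}(v)=0$ otherwise. The hierarchical zonotopal ideal is $$I_{L,\mathcal{J},k}=(v^{\rho(v)+k+\chi_{\mathcal{J}}(v)+1}:v\in L\setminus\{0\})\subseteq\operatorname{Sym}L,$$ interpreted as the unit ideal if some exponent is $\le0$. $\operatorname{Sym}L$ acts on $\operatorname{Sym}L^*$ with $v\in L$ acting by the directional derivative; write $f\odot g$. $C_{L,\mathcal{J},k}=\{g\in\operatorname{Sym}L^*:f\odot g=0\text{ for all }f\in I_{L,\mathcal{J},k}\}$ is the inverse system of $I_{L,\mathcal{J},k}$. *)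

(* Defs.v *)
From mathcomp Require Export all_boot all_order all_algebra.
From mathcomp Require Export fraction.
From mathcomp Require Export boolp classical_sets reals.
From mathcomp Require Export complex mpoly.
Set Implicit Arguments.
Unset Strict Implicit.
Unset Printing Implicit Defensive.
Export Order.TTheory GRing.Theory Num.Theory.
Local Open Scope ring_scope.

(** * Subrings and ideals *)

Section Rings.
Variable R : comNzRingType.
Implicit Types A I P S : set R.

Definition is_subring A : Prop :=
  [/\ A 1, forall x y, A x -> A y -> A (x - y)
    & forall x y, A x -> A y -> A (x * y)].

Definition is_ideal A I : Prop :=
  [/\ (I `<=` A)%classic, I 0, forall x y, I x -> I y -> I (x + y)
    & forall a x, A a -> I x -> I (a * x)].

Definition is_prime_ideal A P : Prop :=
  [/\ is_ideal A P, ~ P 1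
    & forall x y, A x -> A y -> P (x * y) -> P x \/ P y].

(* The ideal of R generated by S, and the subring A[S]. *)
Definition ideal_gen S : set R :=
  [set x | forall I, is_ideal [set: R]%classic I -> (S `<=` I)%classic -> I x]%classic.

Definition adjoin A S : set R :=
  [set x | forall B, is_subring B -> (A `<=` B)%classic -> (S `<=` B)%classic ->
             B x]%classic.

End Rings.

(** * Varieties as Zariski models

   A separated integral scheme X with function field K is determined by the set
   of its local rings, viewed as subrings of K, and is represented here by that
   set.  Separatedness makes x |-> O_{X,x} injective and gives:
   - x lies in the closure of y iff O_{X,x} is contained in O_{X,y};
   - a birational morphism sends x to the unique point whose local ring is
     dominated by the local ring of x. *)

Section Models.
Variable K : fieldType.
Implicit Types (A B P eta : set K) (X : set (set K)).

(* The maximal ideal of a local subring A of K. *)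
Definition max_ideal A : set K :=
  [set x | A x /\ (x = 0 \/ ~ A x^-1)]%classic.

Definition localization A P : set K :=
  [set z | exists x y, [/\ A x, A y, ~ P y & z = x / y]]%classic.

Definition dominates B A : Prop :=
  (A `<=` B)%classic /\ (max_ideal A `<=` max_ideal B)%classic.

(* The stalk at A of the ideal sheaf of the closure Y of the point eta:
   m_eta /\ A if A lies on Y, and A otherwise.  Applied to the same eta on a
   blow-up of X whose center does not contain eta, it gives the ideal sheaf of
   the strict transform of Y. *)
Definition ideal_stalk eta A : set K :=
  [set x | A x /\ ((A `<=` eta)%classic -> max_ideal eta x)]%classic.

(* The blow-up of X along the closure of eta.  Over A, with I the stalk of the
   ideal sheaf, it is Proj of the Rees algebra of I, covered by the affine charts
   Spec A[I/a] for 0 <> a in I; the points over A are the primes of A[I/a]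
   contracting to the maximal ideal of A. *)
Definition blowup X eta : set (set K) :=
  [set B | exists A a P,
     let I := ideal_stalk eta A in
     let R := adjoin A [set x / a | x in I]%classic in
     [/\ X A, I a /\ a != 0, is_prime_ideal R P,
         (P `&` A = max_ideal A)%classic & B = localization R P]]%classic.

(* pi generates the maximal ideal of the discrete valuation ring A. *)
Definition uniformizer A (pi : K) : Prop :=
  [/\ A pi, pi != 0, ~ A pi^-1
    & forall x, x != 0 ->
        exists u (z : int), [/\ A u, A u^-1, u != 0 & x = u * pi ^ z]].

Definition is_ord A (x : K) (z : int) : Prop :=
  exists pi u, [/\ uniformizer A pi, A u, A u^-1, u != 0 & x = u * pi ^ z].

(* A prime divisor is represented by its generic point; on a normal variety
   the points of codimension one are those whose local ring is a DVR. *)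
Definition prime_divisor X A : Prop := X A /\ exists pi, uniformizer A pi.

(* B is (the generic point of) a prime divisor of the blow-up of X along the
   closure Y of eta, and is contained in the inverse image of Y. *)
Definition exceptional_divisor X eta B : Prop :=
  prime_divisor (blowup X eta) B /\
  exists A, [/\ X A, (A `<=` eta)%classic & dominates B A].

End Models.

(** * The arrangement *)

Section Arrangement.
Variables (C : fieldType) (L : vectType C) (n : nat).
Variable l : 'I_n -> 'Hom(L, C^o).
Implicit Types (F : {set 'I_n}) (J : {set {set 'I_n}}).

Definition stratum F : {vspace L} := (\bigcap_(i in F) lker (l i))%VS.

Definition flat F : bool :=
  [forall j, (stratum F <= lker (l j))%VS ==> (j \in F)].

Definition proper_flat F : bool := flat F && (F != [set: 'I_n]).

Definition order_filter J : Prop :=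
  (forall F, F \in J -> flat F) /\
  (forall F G, F \in J -> flat G -> F \subset G -> G \in J).

Definition rho (v : L) : nat := #|[set i | v \notin lker (l i)]|.

Definition chi J (v : L) : bool := [exists F in J, v \in stratum F].

End Arrangement.

(** * Sym L, Sym L^* and the inverse system

   A basis b of L identifies Sym L with the polynomials in X_i = b_i, and
   Sym L^* with the polynomials in X_i = the i-th dual coordinate. *)

Section InverseSystem.
Variables (C : fieldType) (L : vectType C) (r n : nat) (b : r.-tuple L).
Variables (l : 'I_n -> 'Hom(L, C^o)) (J : {set {set 'I_n}}) (k : int).

Definition sym_vec (v : L) : {mpoly C[r]} := \sum_(i < r) coord b i v *: 'X_i.

Definition zonotopal_gen (v : L) : {mpoly C[r]} :=
  let e : int := (rho l v)%:Z + k + (chi l J v)%:Z + 1 in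
  if e <= 0 then 1 else sym_vec v ^+ `|e|%N.

Definition zonotopal_ideal : set {mpoly C[r]} :=
  ideal_gen [set zonotopal_gen v | v in [set v : L | v != 0]]%classic.

(* f (.) g, where X_i in Sym L acts as the partial derivative d/dX_i. *)
Definition apolar (f g : {mpoly C[r]}) : {mpoly C[r]} :=
  \sum_(m <- msupp f) f@_m *: mderivm m g.

Definition inverse_system : set {mpoly C[r]} :=
  [set g | forall f, zonotopal_ideal f -> apolar f g = 0]%classic.

End InverseSystem.

(** * The augmented wonderful variety

   The function field is K = Frac(Sym L^* ).  The homogeneous coordinate ring of
   P(L + C) is Sym((L + C)^* ) = C[X_0, ..., X_r], the last variable t = X_r being
   the coordinate of the summand C, so that t = 0 is the hyperplane P(L). *)

Section Wonderful.
Variables (C : fieldType) (L : vectType C) (r n : nat) (b : r.-tuple L).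
Variable l : 'I_n -> 'Hom(L, C^o).

Local Notation K := {fraction {mpoly C[r]}}.

(* Restriction to the affine chart L = {t = 1}. *)
Definition dehom (p : {mpoly C[r.+1]}) : {mpoly C[r]} :=
  p \mPo [tuple if unlift ord_max i is Some j then 'X_j else 1 | i < r.+1].

Definition homogeneous_ideal (P : set {mpoly C[r.+1]}) : Prop :=
  forall p d, P p -> P (pihomog mdeg d p).

(* The degree zero part of the localization at the homogeneous prime P. *)
Definition proj_stalk (P : set {mpoly C[r.+1]}) : set K :=
  [set z | exists d p q, [/\ p \is d.-homog, q \is d.-homog, ~ P q
                           & z = tofrac (dehom p) / tofrac (dehom q)]]%classic.

Definition proj_space : set (set K) :=
  [set A | exists P, [/\ is_prime_ideal [set: {mpoly C[r.+1]}]%classic P,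
                         homogeneous_ideal P, exists i, ~ P 'X_i
                       & A = proj_stalk P]]%classic.

(* The homogeneous coordinates of the vector (v, 0) of L + C. *)
Definition point_at_infinity (v : L) (i : 'I_r.+1) : C :=
  if unlift ord_max i is Some j then coord b j v else 0.

(* The generic point of P(L_F), a linear subspace of the hyperplane at infinity. *)
Definition stratum_point (F : {set 'I_n}) : set K :=
  proj_stalk [set p | forall v, v \in stratum l F ->
                        p.@[point_at_infinity v] = 0]%classic.

(* The proper flats, by increasing dimension of P(L_F). *)
Definition centers : seq {set 'I_n} :=
  sort (fun F G => \dim (stratum l F) <= \dim (stratum l G))%N
    (enum [pred F | proper_flat l F]).

Definition iterated_blowup (s : seq {set 'I_n}) : set (set K) :=
  foldl (fun X F => blowup X (stratum_point F)) proj_space s.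

Definition wonderful : set (set K) := iterated_blowup centers.

(* B is the generic point of D_F, the exceptional divisor created at the step
   centered at F.  Taking strict transforms under the later steps does not change
   the local ring at the generic point. *)
Definition boundary_divisor (F : {set 'I_n}) (B : set K) : Prop :=
  exceptional_divisor (iterated_blowup (take (index F centers) centers))
    (stratum_point F) B.

(* The multiplicity of B in the divisor \sum_F c_F D_F. *)
Definition mult (c : {set 'I_n} -> int) (B : set K) : int :=
  \sum_(F | proper_flat l F) c F * `[< boundary_divisor F B >]%:Z.

(* H^0(W_L, O(\sum_F c_F D_F)) *)
Definition global_sections (c : {set 'I_n} -> int) : set K :=
  [set f | f = 0 \/ forall B z, prime_divisor wonderful B -> is_ord B f z ->
                      0 <= z + mult c B]%classic.

(* O(1, ..., 1)(k alpha)(D_J) = O(\sum_F (n - |F| + k + [F \in J]) D_F) *)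
Definition zonotopal_divisor (J : {set {set 'I_n}}) (k : int)
    (F : {set 'I_n}) : int :=
  n%:Z - #|F|%:Z + k + (F \in J)%:Z.

End Wonderful.

(* Main.v *)
From HB Require Import structures.
Require Import Defs.
From mathcomp Require Import generic_quotient ssrcomplements.
From mathcomp Require Import ring zify.
Set Implicit Arguments.
Unset Strict Implicit.
Unset Printing Implicit Defensive.
Local Open Scope ring_scope.

(** Both sides are the space of polynomials g whose degree along L_F is at most
    c_F = n - |F| + k + [F \in J] for every proper flat F.  For the inverse system
    this is Taylor's formula: v^e kills g iff s |-> g(x + s v) has degree < e, and
    the bound required of v is c_F for the flat F of the forms vanishing at v.

    For the sections, f must be a polynomial, because the points of codimension one
    of L are the localizations of a factorial ring at prime elements, and it remains
    to see that ord_{D_F} is minus the degree along L_F.  Write v_F for this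
    valuation.  A point A of an iterated blow-up lying on the strict transform of
    P(L_F) is generated, up to inverting units, by ratios of affine forms x / e_G
    for the centers G already blown up at A.  Choosing a complement of L_F grades
    these generators by weights 0 and 1; those of weight 1 generate the ideal of the
    strict transform, and v_F is trivial on the field of elements of weight 0.
    Hence every point B over A in the blow-up of the strict transform is contained
    in the valuation ring of v_F, and the inclusion forces ord_B = v_F when B is a
    discrete valuation ring. *)

(** * Local rings and blow-ups *)

(** A point is only a subring of [K], so nothing in the definitions prevents one [B] from being
    counted by [mult] for several flats, or a D_F from having no point and imposing no condition.
    Inclusion in the valuation ring settles the first matter: distinct flats have distinct
    valuations, so at most one coefficient contributes at [B], and none if [B] contains all
    polynomials. For the second, the valuation ring of v_F is itself shown to be a point of the
    blow-up at L_F that survives the later ones; this is where the degree bound along L_F is tested.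

    The order of the blow-ups enters through intersections of centers. A point on two strict
    transforms also lies on that of the intersection, which is either one of the two centers or a
    stratum of smaller dimension, blown up earlier and no longer met. So the centers that matter at
    a point form a chain, and one complement of L_F grades all the generators of its local ring at
    once. *)

Section LocalRings.
Variable K : fieldType.
Implicit Types (A B D O P Q I S T eta : set K) (X : set (set K)) (x y z : K).

Section Subring.
Variable (A : set K) (sA : is_subring A).
Lemma subring1 : A 1. Proof. by case: sA. Qed.
Lemma subringB x y : A x -> A y -> A (x - y). Proof. by case: sA => _ + _; apply. Qed.
Lemma subringM x y : A x -> A y -> A (x * y). Proof. by case: sA => _ _; apply. Qed.
Lemma subring0 : A 0.
Proof. by rewrite -(subrr 1); apply: subringB; apply: subring1. Qed.
Lemma subringN x : A x -> A (- x).
Proof. by rewrite -sub0r; apply: subringB; apply: subring0. Qed.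
Lemma subringD x y : A x -> A y -> A (x + y).
Proof. by move=> Ax Ay; rewrite -[y]opprK; apply/subringB/subringN. Qed.
Lemma subringX x n : A x -> A (x ^+ n).
Proof.
move=> Ax; elim: n => [|n IH]; first exact: subring1.
by rewrite exprS; apply: subringM.
Qed.
Lemma subring_sum (J : Type) (r : seq J) (p : pred J) (F : J -> K) :
  (forall i, p i -> A (F i)) -> A (\sum_(i <- r | p i) F i).
Proof. by move=> AF; apply: big_ind => //; [exact: subring0|exact: subringD]. Qed.
End Subring.

(** Only sums of nonunits are required: absorption of products holds in any subring, by
    [max_idealM]. *)
Definition is_local A :=
  is_subring A /\ forall x y, max_ideal A x -> max_ideal A y -> max_ideal A (x + y).

Lemma max_idealM A x y : is_subring A -> A x -> max_ideal A y -> max_ideal A (x * y).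
Proof.
move=> sA Ax [Ay nu]; split; first exact: subringM.
have [->|y0] := eqVneq y 0; first by rewrite mulr0; left.
have [->|x0] := eqVneq x 0; first by rewrite mul0r; left.
right=> Au; case: nu => [/eqP|]; first by rewrite (negbTE y0).
have -> : y^-1 = x * (x * y)^-1 by field; rewrite ?x0 ?y0.
by apply; apply: subringM.
Qed.

Lemma max_ideal1 A : is_subring A -> ~ max_ideal A 1.
Proof.
move=> sA [_ [/eqP|]]; first by rewrite oner_eq0.
by rewrite invr1 => /(_ (subring1 sA)).
Qed.

Lemma max_ideal0 A : is_subring A -> max_ideal A 0.
Proof. by move=> sA; split; [exact: subring0|left]. Qed.

Lemma nmax_ideal A x : A x -> ~ max_ideal A x -> x != 0 /\ A x^-1.
Proof.
move=> Ax nm; split; first by apply/eqP=> x0; apply: nm; split => //; left.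
by apply: contrapT => nA; apply: nm; split => //; right.
Qed.

Lemma max_ideal_unit A x : x != 0 -> A x^-1 -> ~ max_ideal A x.
Proof. by move=> x0 Ax [_ []] // /eqP; rewrite (negbTE x0). Qed.

Lemma max_ideal_ideal A : is_local A -> is_ideal A (max_ideal A).
Proof.
move=> [sA lA]; split => //; [by move=> x []|exact: max_ideal0|].
by move=> a x; apply: max_idealM.
Qed.

Lemma max_idealN A x : is_local A -> max_ideal A x -> max_ideal A (- x).
Proof.
move=> [sA lA] mx; rewrite -mulN1r; apply: max_idealM => //.
by apply/(subringN sA)/(subring1 sA).
Qed.

Lemma unit_add_max A x y : is_local A -> x != 0 -> A x -> A x^-1 -> max_ideal A y ->
  x + y != 0 /\ A (x + y)^-1.
Proof.
move=> lA x0 Ax AVx my; apply: nmax_ideal; first by case: lA => sA _; apply: subringD my.1.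
move=> mxy; apply: (max_ideal_unit x0 AVx).
by rewrite -[x](addrK y); apply: lA.2 => //; apply: max_idealN.
Qed.

Lemma is_prime_max A : is_local A -> is_prime_ideal A (max_ideal A).
Proof.
move=> lA; have sA := lA.1; split; [exact: max_ideal_ideal|exact: max_ideal1|].
move=> x y Ax Ay mxy; apply: contrapT => /not_orP [/(nmax_ideal Ax) [x0 Vx] /(nmax_ideal Ay) [y0 Vy]].
by apply: (max_ideal_unit _ _ mxy); [exact: mulf_neq0|rewrite invfM; apply: subringM].
Qed.

Lemma adjoin_subring A S : is_subring (adjoin A S).
Proof.
split; first by move=> B sB _ _; exact: subring1.
- by move=> x y Hx Hy B sB AB SB; apply: subringB => //; [apply: Hx|apply: Hy].
- by move=> x y Hx Hy B sB AB SB; apply: subringM => //; [apply: Hx|apply: Hy].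
Qed.

Lemma adjoin_base A S x : A x -> adjoin A S x.
Proof. by move=> Ax B _ AB _; apply: AB. Qed.

Lemma adjoin_gen A S x : S x -> adjoin A S x.
Proof. by move=> Sx B _ _; apply. Qed.

Definition gen_ideal A S : set K :=
  [set x | forall I, is_ideal A I -> (S `<=` I)%classic -> I x]%classic.

Lemma gen_ideal_ideal A S : is_subring A -> (S `<=` A)%classic -> is_ideal A (gen_ideal A S).
Proof.
move=> sA SA; split.
- move=> x; apply=> //; split=> //; [exact: subring0|exact: subringD|exact: subringM].
- by move=> I [_ I0 _ _] _.
- by move=> x y Hx Hy I iI SI; case: (iI) => _ _ ID _; apply: ID; [apply: Hx|apply: Hy].
- by move=> a x Aa Hx I iI SI; case: (iI) => _ _ _ IM; apply: IM => //; apply: Hx.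
Qed.

Lemma sub_gen_ideal A S : (S `<=` gen_ideal A S)%classic.
Proof. by move=> x Sx I _; apply. Qed.

Section Localization.
Variables (R P : set K) (sR : is_subring R) (pP : is_prime_ideal R P).

Lemma prime_nzero x : ~ P x -> x != 0.
Proof. by case: pP => -[_ P0 _ _] _ _ nP; apply/eqP => x0; apply: nP; rewrite x0. Qed.

Lemma loc_sub x : R x -> localization R P x.
Proof.
by move=> Rx; exists x, 1; split; rewrite ?divr1 //; [exact: subring1|case: pP].
Qed.

Lemma prime_nM x y : R x -> R y -> ~ P x -> ~ P y -> ~ P (x * y).
Proof. by case: pP => _ _ H Rx Ry nx ny /(H _ _ Rx Ry) []. Qed.

Lemma loc_subring : is_subring (localization R P).
Proof.
split; first exact: (loc_sub (subring1 sR)).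
- move=> _ _ [x [y [Rx Ry Py ->]]] [z [t [Rz Rt Pt ->]]].
  exists (x * t - z * y), (y * t); split.
  + by apply: subringB => //; apply: subringM.
  + exact: subringM.
  + exact: prime_nM.
  by field; rewrite !prime_nzero.
- move=> _ _ [x [y [Rx Ry Py ->]]] [z [t [Rz Rt Pt ->]]].
  exists (x * z), (y * t); split; [exact: subringM|exact: subringM|exact: prime_nM|].
  by field; rewrite !prime_nzero.
Qed.

Lemma loc_inv x : R x -> ~ P x -> localization R P x^-1.
Proof. by move=> Rx Px; exists 1, x; split; rewrite ?div1r //; exact: subring1. Qed.

Lemma loc_maxP x : max_ideal (localization R P) x <->
  exists p s, [/\ P p, R s, ~ P s & x = p / s].
Proof.
have PR p : P p -> R p by case: pP => -[PR _ _ _] _ _; apply: PR.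
split.
- move=> [[p [s [Rp Rs Ps ->]]] H]; exists p, s; split=> //.
  apply: contrapT => nP; case: H => [/eqP|[]].
    by rewrite mulf_eq0 invr_eq0 (negbTE (prime_nzero nP)) (negbTE (prime_nzero Ps)).
  by rewrite invf_div; exists s, p.
- move=> [p [s [Pp Rs Ps ->]]]; split; first by exists p, s; split=> //; exact: PR.
  case: (eqVneq p 0) => [->|p0]; first by left; rewrite mul0r.
  right => -[q [t [Rq Rt Pt /eqP]]].
  rewrite invf_div eqr_div // ?(prime_nzero Pt) // => /eqP E.
  apply: (prime_nM Rs Rt Ps Pt); rewrite E.
  by case: pP => -[_ _ _ H] _ _; apply: H.
Qed.

Lemma loc_local : is_local (localization R P).
Proof.
split; first exact: loc_subring.
move=> _ _ /loc_maxP [p [s [Pp Rs Ps ->]]] /loc_maxP [q [t [Pq Rt Pt ->]]].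
have [[PR _ PD PM] _ _] := pP.
apply/loc_maxP; exists (t * p + s * q), (s * t); split.
- by apply: PD; apply: PM.
- exact: subringM.
- exact: prime_nM.
by field; rewrite !prime_nzero.
Qed.

Lemma loc_max x : R x -> max_ideal (localization R P) x <-> P x.
Proof.
move=> Rx; split=> [m|Px].
  apply: contrapT => nP; apply: max_ideal_unit m; first exact: prime_nzero.
  exact: loc_inv.
apply/loc_maxP; exists x, 1; split; rewrite ?divr1 //; first exact: subring1.
by case: pP.
Qed.

End Localization.

(** Local rings are not generated by [T] as rings: elements invertible in [A] must be inverted as
    well. The quantification over [D] is the induction principle used later, [D] being the set of
    elements with the desired property. *)
Definition generates T A :=
  forall D, is_subring D -> (T `<=` D)%classic ->
    (forall x, D x -> x != 0 -> A x^-1 -> D x^-1) -> (A `<=` D)%classic.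

(* Elements of A are split as a weight zero part plus an element of Q; inverting a
   unit preserves such a splitting because Q lies in the maximal ideal, so it is
   enough to split generators. *)
Section Split.
Variables (A O K0 Q T : set K).
Hypotheses (lA : is_local A) (lO : is_local O) (sK0 : is_subring K0)
  (K0V : forall x, K0 x -> K0 x^-1) (K0O : forall x, K0 x -> max_ideal O x -> x = 0)
  (iQ : is_ideal A Q) (QA : (Q `<=` max_ideal A)%classic)
  (gT : generates T A)
  (TO : forall g, T g -> [/\ A g, O g & exists x0, [/\ K0 x0, A x0, O x0, Q (g - x0) & max_ideal O (g - x0)]]).

Lemma split_local x : A x ->
  O x /\ exists x0, [/\ K0 x0, A x0, O x0, Q (x - x0) & max_ideal O (x - x0)].
Proof.
have [sA sO] := (lA.1, lO.1); have [_ Q0 QD QM] := iQ.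
have [_ mO0 mOD mOM] := max_ideal_ideal lO.
have mON z : max_ideal O z -> max_ideal O (- z) by apply: max_idealN.
have QN z : Q z -> Q (- z).
  by rewrite -mulN1r; apply: QM; apply/(subringN sA)/(subring1 sA).
pose D : set K := [set x | [/\ A x, O x & exists x0, [/\ K0 x0, A x0, O x0, Q (x - x0) & max_ideal O (x - x0)]]]%classic.
suff AD : (A `<=` D)%classic by move=> /AD [].
apply: gT.
- split.
  + split; [exact: subring1|exact: subring1|exists 1; split; try exact: subring1].
      by rewrite subrr.
    by rewrite subrr.
  + move=> y z [Ay Oy [y0 [? ? ? Qy My]]] [Az Oz [z0 [? ? ? Qz Mz]]].
    split; [exact: subringB|exact: subringB|exists (y0 - z0)].
    have -> : y - z - (y0 - z0) = (y - y0) + - (z - z0) by ring.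
    by split; [apply: subringB|apply: subringB|apply: subringB|apply: QD => //; apply: QN|apply: mOD => //; apply: mON].
  + move=> y z [Ay Oy [y0 [? ? ? Qy My]]] [Az Oz [z0 [? ? ? Qz Mz]]].
    split; [exact: subringM|exact: subringM|exists (y0 * z0)].
    have -> : y * z - (y0 * z0) = z * (y - y0) + y0 * (z - z0) by ring.
    by split; [apply: subringM|apply: subringM|apply: subringM|apply: QD; apply: QM|apply: mOD; apply: mOM].
- by move=> g /TO [].
(* Here [y0] differs from the unit [y] by an element of the maximal ideal of [A], so it is a unit of
   [A]. Being nonzero and in [K0] it is a unit of [O], hence so is [y]; and [1/y - 1/y0] is a
   multiple of [y - y0]. *)
- move=> y [Ay Oy [y0 [Ky0 Ay0 Oy0 Qy My]]] ynz AVy.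
  have [] := unit_add_max lA ynz Ay AVy (QA (QN _ Qy)).
  rewrite opprB addrC subrK => y0nz AVy0.
  have OVy0 : O y0^-1 by case: (nmax_ideal Oy0) => // /(K0O Ky0) /eqP; rewrite (negbTE y0nz).
  have [_] := unit_add_max lO y0nz Oy0 OVy0 My; rewrite addrC subrK => OVy.
  split=> //; exists y0^-1.
  have -> : y^-1 - y0^-1 = (- (y^-1 * y0^-1)) * (y - y0) by field; rewrite ?ynz ?y0nz.
  split => //; first exact: K0V.
    by apply: QM => //; apply: (subringN sA); apply: (subringM sA).
  by apply: mOM => //; apply: (subringN sO); apply: (subringM sO).
Qed.

End Split.

(** Off the center the ideal stalk is all of [A], so [a = 1] gives the chart [A] itself with its
    maximal ideal. *)
Lemma blowup_pass X eta A : X A -> is_local A -> ~ (A `<=` eta)%classic -> blowup X eta A.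
Proof.
move=> XA lA nAe; have sA := lA.1.
exists A, 1, (max_ideal A) => /=.
have adjE : adjoin A [set x / 1 | x in ideal_stalk eta A]%classic = A.
  apply/seteqP; split => [x Hx|x Ax]; last exact: adjoin_base.
  by apply: Hx => // _ [y [Ay _] <-]; rewrite divr1.
rewrite adjE; split => //.
- by split; [split=> [|/nAe //]; exact: subring1|exact: oner_neq0].
- exact: is_prime_max.
- by apply/seteqP; split=> x; [case|move=> mx; split=> //; case: mx].
apply/seteqP; split=> [x Ax|]; first exact: (loc_sub sA (is_prime_max lA)).
move=> _ [x [y [Ax Ay /(nmax_ideal Ay) [y0 AVy] ->]]]; exact: subringM.
Qed.

(** Off the center [1] lies in the ideal, so the chart contains [1/a]; since [P] contracts to the
    maximal ideal, [a] must be a unit of [A], and the chart is [A] again. *)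
Lemma blowupP X eta B : (forall A, X A -> is_local A) -> blowup X eta B ->
  (X B /\ ~ (B `<=` eta)%classic) \/
  exists A a P, let R := adjoin A [set x / a | x in ideal_stalk eta A]%classic in
   [/\ X A /\ (A `<=` eta)%classic, ideal_stalk eta A a /\ a != 0,
       is_prime_ideal R P, (P `&` A = max_ideal A)%classic & B = localization R P].
Proof.
move=> lX [A [a [P /= [XA [Ia a0] pP PA ->]]]].
have [Ae|nAe] := pselect (A `<=` eta)%classic; last left; first by right; exists A, a, P.
have lA := lX A XA; have sA := lA.1; have Aa : A a by case: Ia.
set R := adjoin A _ in pP *.
have RVa : R a^-1.
  by apply: adjoin_gen; exists 1; rewrite ?div1r //; split=> // ; exact: subring1.
have AVa : A a^-1.
  apply: (proj2 (nmax_ideal Aa _)); rewrite -PA => -[Pa _].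
  have [[_ _ _ H] nP1 _] := pP; apply: nP1.
  by rewrite -(mulVf a0); apply: H.
have RE : R = A.
  apply/seteqP; split => [x Hx|x Ax]; last exact: adjoin_base.
  apply: Hx => // _ [y [Ay _] <-]; exact: subringM.
have PE : P = max_ideal A.
  rewrite -PA; apply/seteqP; split=> [x Px|x []//]; split=> //.
  by rewrite -RE; case: pP => -[PR _ _ _] _ _; apply: PR.
suff -> : localization R P = A by [].
rewrite RE PE; apply/seteqP; split=> [|x Ax]; last exact: (loc_sub sA (is_prime_max lA)).
move=> _ [x [y [Ax Ay /(nmax_ideal Ay) [y0 AVy] ->]]]; exact: subringM.
Qed.

Lemma blowup_local X eta B : blowup X eta B -> is_local B.
Proof.
move=> [A [a [P /= [XA [Ia a0] pP PA ->]]]]; apply: loc_local => //; exact: adjoin_subring.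
Qed.

End LocalRings.

(** * Polynomials along a parametrized line *)

Section Substitution.
Variables (C : numFieldType) (r m : nat).

Lemma mpoly_ring_ind (P : {mpoly C[r]} -> Prop) :
  (forall c, P c%:MP) -> (forall j, P 'X_j) ->
  (forall p q, P p -> P q -> P (p + q)) -> (forall p q, P p -> P q -> P (p * q)) ->
  forall p, P p.
Proof.
move=> PC PX PD PM; apply: mpolyind => [|c m' p _ _ Pp]; first by rewrite -mpolyC0.
apply: PD Pp; rewrite -mul_mpolyC; apply: (PM _ _ (PC c)).
rewrite mpolyXE_id; apply: big_ind => [||j _]; [by rewrite -mpolyC1|exact: (PM)|].
by elim: (m' j) => [|k IH]; rewrite ?expr0 -?mpolyC1 // exprS; apply: (PM).
Qed.

Variables (a b : 'I_r -> {mpoly C[m]}).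

(** [uni], [dilate], [homogen] and [shift] are all instances; the variable of the outer polynomial
    ring counts the factors taken from [b]. *)
Definition subst : {mpoly C[r]} -> {poly {mpoly C[m]}} :=
  locked (mmap (polyC \o @mpolyC m C) (fun j => (a j)%:P + (b j)%:P * 'X)).

Fact subst_zmod : zmod_morphism subst.
Proof. by rewrite /subst; unlock; exact: raddfB. Qed.
Fact subst_monoid : monoid_morphism subst.
Proof. by rewrite /subst; unlock; split; [exact: rmorph1|exact: rmorphM]. Qed.
HB.instance Definition _ := GRing.isZmodMorphism.Build _ _ subst subst_zmod.
HB.instance Definition _ := GRing.isMonoidMorphism.Build _ _ subst subst_monoid.

Lemma substD p q : subst (p + q) = subst p + subst q. Proof. exact: rmorphD. Qed.
Lemma substM p q : subst (p * q) = subst p * subst q. Proof. exact: rmorphM. Qed.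
Lemma substC c : subst c%:MP = c%:MP%:P.
Proof. by rewrite /subst -lock mmapC. Qed.

Lemma substX j : subst 'X_j = (a j)%:P + (b j)%:P * 'X.
Proof. by rewrite /subst -lock mmapX mmap1U. Qed.

Lemma substZ c f : subst (c *: f) = c%:MP%:P * subst f.
Proof. by rewrite -mul_mpolyC substM substC. Qed.

(** The coefficient of degree [k] is a sum of products with exactly [k] factors from [b] and the
    others from [a], so a graded predicate propagates from [a] and [b]. *)
Lemma subst_coef (Phi : nat -> {mpoly C[m]} -> Prop) :
  (forall c, Phi 0 c%:MP) -> (forall k, Phi k 0) ->
  (forall k p q, Phi k p -> Phi k q -> Phi k (p + q)) ->
  (forall i j p q, Phi i p -> Phi j q -> Phi (i + j)%N (p * q)) ->
  (forall j, Phi 0%N (a j)) -> (forall j, Phi 1%N (b j)) ->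
  forall f k, Phi k (subst f)`_k.
Proof.
move=> P0C P0 PD PM Pa Pb; elim/mpoly_ring_ind => [c|j|p q Hp Hq|p q Hp Hq] k.
- by rewrite substC coefC; case: eqP => [->|_].
- rewrite substX coefD coefC coefMX coefC; case: k => [|[|k]] /=.
  + by rewrite addr0.
  + by rewrite add0r.
  + by rewrite addr0.
- rewrite substD coefD; apply: PD; [exact: Hp|exact: Hq].
- rewrite substM coefM; apply: big_ind => [||i _]; [exact: P0|exact: PD|].
  rewrite -{1}(subnKC (leq_ord i)); apply: PM; [exact: Hp|exact: Hq].
Qed.

End Substitution.

(** * Nonvanishing over an infinite field, and splitting off the last variable *)

Section Infinite.
Variable C : numFieldType.

Lemma poly_nonroot (p : {poly C}) : p != 0 -> exists c, p.[c] != 0.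
Proof.
move=> p0; apply: contrapT => H; move/eqP: p0; apply.
apply: (@roots_geq_poly_eq0 _ p [seq i%:R | i <- iota 0 (size p)]).
- apply/allP => c _; apply: contrapT => /negP nr; apply: H; exists c; exact: nr.
- by rewrite map_inj_uniq ?iota_uniq // => i j /eqP; rewrite eqr_nat => /eqP.
- by rewrite size_map size_iota.
Qed.

Section Uni.
Variable r : nat.

(** The last variable becomes the variable of a univariate polynomial; with the inverse [multi] this
    allows induction on the number of variables. *)
Definition uni : {mpoly C[r.+1]} -> {poly {mpoly C[r]}} :=
  subst (fun i => if unlift ord_max i is Some j then 'X_j else 0)
        (fun i => if unlift ord_max i is Some j then 0 else 1).

HB.instance Definition _ := GRing.RMorphism.on uni.

Lemma uniD p q : uni (p + q) = uni p + uni q. Proof. exact: substD. Qed.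
Lemma uniM p q : uni (p * q) = uni p * uni q. Proof. exact: substM. Qed.

Definition embed : {mpoly C[r]} -> {mpoly C[r.+1]} :=
  locked (mmap (@mpolyC r.+1 C) (fun j => 'X_(lift ord_max j))).

Fact embed_zmod : zmod_morphism embed.
Proof. by rewrite /embed; unlock; exact: raddfB. Qed.
Fact embed_monoid : monoid_morphism embed.
Proof. by rewrite /embed; unlock; split; [exact: rmorph1|exact: rmorphM]. Qed.
HB.instance Definition _ := GRing.isZmodMorphism.Build _ _ embed embed_zmod.
HB.instance Definition _ := GRing.isMonoidMorphism.Build _ _ embed embed_monoid.

Definition multi : {poly {mpoly C[r]}} -> {mpoly C[r.+1]} :=
  locked (fun p => (map_poly embed p).['X_ord_max]).

Fact multi_zmod : zmod_morphism multi.
Proof. by rewrite /multi; unlock=> p q; rewrite rmorphB hornerD hornerN. Qed.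
Fact multi_monoid : monoid_morphism multi.
Proof.
by rewrite /multi; unlock; split=> [|p q]; rewrite ?rmorph1 ?hornerC // rmorphM hornerM.
Qed.
HB.instance Definition _ := GRing.isZmodMorphism.Build _ _ multi multi_zmod.
HB.instance Definition _ := GRing.isMonoidMorphism.Build _ _ multi multi_monoid.

Lemma embedD p q : embed (p + q) = embed p + embed q. Proof. exact: rmorphD. Qed.
Lemma embedM p q : embed (p * q) = embed p * embed q. Proof. exact: rmorphM. Qed.
Lemma embedC c : embed c%:MP = c%:MP. Proof. by rewrite /embed -lock mmapC. Qed.
Lemma embedX j : embed 'X_j = 'X_(lift ord_max j).
Proof. by rewrite /embed -lock mmapX mmap1U. Qed.

Lemma multiD p q : multi (p + q) = multi p + multi q. Proof. exact: rmorphD. Qed.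
Lemma multiM p q : multi (p * q) = multi p * multi q. Proof. exact: rmorphM. Qed.
Lemma multiC p : multi p%:P = embed p.
Proof. by rewrite /multi -lock map_polyC hornerC. Qed.
Lemma multiX : multi 'X = 'X_ord_max.
Proof. by rewrite /multi -lock map_polyX hornerX. Qed.
Lemma multi0 : multi 0 = 0. Proof. exact: rmorph0. Qed.
Lemma uni0 : uni 0 = 0. Proof. exact: rmorph0. Qed.

Lemma uniX i : uni 'X_i = if unlift ord_max i is Some j then ('X_j)%:P else 'X.
Proof.
rewrite /uni substX; case: unlift => [j|]; first by rewrite mul0r addr0.
by rewrite add0r mul1r.
Qed.
Lemma uniC c : uni c%:MP = c%:MP%:P. Proof. exact: substC. Qed.

Lemma uniK : cancel uni multi.
Proof.
elim/mpoly_ring_ind => [c|i|p q Hp Hq|p q Hp Hq].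
- by rewrite uniC multiC embedC.
- by rewrite uniX; case: unliftP => [j ->|->]; rewrite ?multiX // multiC embedX.
- by rewrite uniD multiD Hp Hq.
- by rewrite uniM multiM Hp Hq.
Qed.

Lemma uni_embed p : uni (embed p) = p%:P.
Proof.
elim/mpoly_ring_ind: p => [c|i|p q Hp Hq|p q Hp Hq].
- by rewrite embedC /uni substC.
- by rewrite embedX uniX liftK.
- by rewrite embedD uniD Hp Hq polyCD.
- by rewrite embedM uniM Hp Hq polyCM.
Qed.

Lemma multiK : cancel multi uni.
Proof.
elim/poly_ind => [|p c IH]; first by rewrite multi0 uni0.
rewrite multiD multiM uniD uniM IH multiC uni_embed multiX.
by rewrite uniX unlift_none.
Qed.

End Uni.

Lemma uni_eval r (p : {mpoly C[r.+1]}) y c : (map_poly (meval y) (uni p)).[c] =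
  p.@[fun i => if unlift ord_max i is Some j then y j else c].
Proof.
elim/mpoly_ring_ind: p => [d|i|p q Hp Hq|p q Hp Hq].
- by rewrite uniC map_polyC hornerC /= !mevalC.
- rewrite uniX mevalXU; case: unlift => [j|]; last by rewrite map_polyX hornerX.
  by rewrite map_polyC hornerC /= mevalXU.
- by rewrite uniD rmorphD hornerD Hp Hq mevalD.
- by rewrite uniM rmorphM hornerM Hp Hq mevalM.
Qed.

Lemma mpoly_nonroot r (p : {mpoly C[r]}) : p != 0 -> exists x, p.@[x] != 0.
Proof.
elim: r p => [|r IH] p p0.
  exists (fun _ => 0); move: p0; rewrite [p]nvar0_mpolyC mevalC.
  by apply: contraNneq => ->; rewrite mpolyC0.
have up0 : uni p != 0 by rewrite -(inj_eq (can_inj (@uniK r))) uni0 in p0.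
have /IH [y] : lead_coef (uni p) != 0 by rewrite lead_coef_eq0.
rewrite lead_coefE => y0.
have /poly_nonroot [c pc] : map_poly (meval y) (uni p) != 0.
  by apply: contraNneq y0 => /polyP /(_ (size (uni p)).-1); rewrite coef_map coef0 /= => ->.
exists (fun i => if unlift ord_max i is Some j then y j else c).
by rewrite -uni_eval.
Qed.

End Infinite.

(** * The degree of a polynomial along a linear subspace *)

Section Projection.
Variables (C : numFieldType) (L : vectType C) (r : nat) (b : r.-tuple L).
Hypothesis bL : basis_of fullv b.
Local Notation coords v := (fun j => coord b j v).

(** Only the values on the basis are used, so a bare function is accepted and compositions can be
    written pointwise; it is linear in every use. *)
Definition lform (phi : L -> C) : {mpoly C[r]} := \sum_(j < r) phi b`_j *: 'X_j.

Lemma lformD phi psi : lform (fun v => phi v + psi v) = lform phi + lform psi.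
Proof. by rewrite /lform -big_split; apply: eq_bigr => j _; rewrite scalerDl. Qed.

Lemma eq_lform phi psi : phi =1 psi -> lform phi = lform psi.
Proof. by move=> E; apply: eq_bigr => j _; rewrite E. Qed.

Lemma coords_vec v : v = \sum_(j < r) coord b j v *: b`_j.
Proof. exact: (coord_basis bL (memvf v)). Qed.

Lemma lform_eval (phi : 'Hom(L, C^o)) v : (lform phi).@[coords v] = phi v.
Proof.
rewrite {2}(coords_vec v) linear_sum /lform raddf_sum /=; apply: eq_bigr => j _.
by rewrite mevalZ mevalXU linearZ /= mulrC.
Qed.

Lemma coords_free (c : 'I_r -> C) : exists v, forall j, coord b j v = c j.
Proof.
exists (\sum_(j < r) c j *: b`_j) => j; apply: coord_sum_free.
exact: basis_free bL.
Qed.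

Lemma nonroot_vec (p : {mpoly C[r]}) : p != 0 -> exists v, p.@[coords v] != 0.
Proof.
move=> /mpoly_nonroot [x px]; have [v vx] := coords_free x.
by exists v; rewrite (meval_eq p vx).
Qed.

Lemma lform_dual j : lform (coord b j) = 'X_j.
Proof.
rewrite /lform (bigD1 j) //= coord_free ?(basis_free bL) // eqxx scale1r.
by rewrite big1 ?addr0 // => i ij; rewrite coord_free ?(basis_free bL) // (negbTE ij) scale0r.
Qed.

Section Theta.
Variable pi : 'End(L).

(* Composition with the linear endomorphism (1 - pi) + s pi of L. *)
Definition dilate : {mpoly C[r]} -> {poly {mpoly C[r]}} :=
  subst (fun j => lform (fun v => coord b j (v - pi v)))
        (fun j => lform (fun v => coord b j (pi v))).
HB.instance Definition _ := GRing.RMorphism.on dilate.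
Local Notation theta := dilate.

Lemma thetaD p q : theta (p + q) = theta p + theta q. Proof. exact: rmorphD. Qed.
Lemma thetaM p q : theta (p * q) = theta p * theta q. Proof. exact: rmorphM. Qed.
Lemma thetaC c : theta c%:MP = c%:MP%:P. Proof. exact: substC. Qed.

Lemma comp_lform (phi : 'Hom(L, C^o)) (f : L -> L) :
  \sum_(i < r) phi b`_i *: lform (fun v => coord b i (f v)) = lform (phi \o f).
Proof.
rewrite /lform (eq_bigr (fun i : 'I_r => \sum_(j < r) (phi b`_i * coord b i (f b`_j)) *: 'X_j)); last first.
  by move=> i _; rewrite scaler_sumr; apply: eq_bigr => j _; rewrite scalerA.
rewrite exchange_big /=; apply: eq_bigr => j _; rewrite -scaler_suml; congr (_ *: _).
rewrite [in RHS](coords_vec (f b`_j)) linear_sum; apply: eq_bigr => i _.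
by rewrite linearZ /= mulrC.
Qed.

Lemma theta_lform (phi : 'Hom(L, C^o)) :
  theta (lform phi) = (lform (fun v => phi (v - pi v)))%:P + (lform (fun v => phi (pi v)))%:P * 'X.
Proof.
rewrite /dilate {1}/lform rmorph_sum /=.
rewrite -[X in X%:P + _](comp_lform phi (fun v => v - pi v)) -(comp_lform phi pi).
rewrite !rmorph_sum /= mulr_suml -big_split /=; apply: eq_bigr => i _.
by rewrite substZ substX -!mul_mpolyC !polyCM mulrDr mulrA.
Qed.

(** At [s = 1] the map [(1 - pi) + s pi] is the identity. Hence [dilate] is injective and a
    polynomial is the sum of its components along [pi]. *)
Lemma theta_horner1 f : (theta f).[1] = f.
Proof.
elim/mpoly_ring_ind: f => [c|j|p q Hp Hq|p q Hp Hq].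
- by rewrite thetaC hornerC.
- rewrite /dilate substX !hornerE -lformD -[RHS]lform_dual; apply: eq_lform => v.
  by rewrite linearB subrK.
- by rewrite thetaD hornerD Hp Hq.
- by rewrite thetaM hornerM Hp Hq.
Qed.

Lemma theta_sum f d : (size (theta f) <= d)%N -> f = \sum_(k < d) (theta f)`_k.
Proof.
move=> H; rewrite -{1}[f]theta_horner1 (horner_coef_wide _ H).
by apply: eq_bigr => k _; rewrite expr1n mulr1.
Qed.

Lemma theta_eq0 f : (theta f == 0) = (f == 0).
Proof.
apply/eqP/eqP => [H|->]; last by rewrite rmorph0.
by rewrite -[f]theta_horner1 H horner0.
Qed.

(** For [pi = projv W] this is the degree along W, for the identity the total degree; the zero
    polynomial gets degree 0. *)
Definition dir_deg f : nat := (size (theta f)).-1.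
Local Notation dg := dir_deg.

Lemma size_theta f d : (size (theta f) <= d.+1)%N = (dg f <= d)%N.
Proof. by rewrite /dir_deg; case: (size _). Qed.

Lemma dgC c : dg c%:MP = 0%N.
Proof. by rewrite /dir_deg thetaC size_polyC; case: eqP. Qed.

Lemma dgM f g : f != 0 -> g != 0 -> dg (f * g) = (dg f + dg g)%N.
Proof.
move=> f0 g0; rewrite /dir_deg thetaM size_mul ?theta_eq0 //.
rewrite -theta_eq0 -size_poly_gt0 in f0; rewrite -theta_eq0 -size_poly_gt0 in g0.
by move: f0 g0; case: (size _) => // a _; case: (size _) => // c _; rewrite addnS.
Qed.

Lemma dgD f g d : (dg f <= d)%N -> (dg g <= d)%N -> (dg (f + g) <= d)%N.
Proof.
rewrite -!size_theta thetaD => Hf Hg.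
by apply: leq_trans (size_polyD _ _) _; rewrite geq_max Hf.
Qed.

Lemma dgN f : dg (- f) = dg f. Proof. by rewrite /dir_deg rmorphN size_polyN. Qed.

Lemma dg_coef0 f d : (dg f < d)%N -> (theta f)`_d = 0.
Proof. by move=> H; apply: nth_default; apply: leq_trans H; exact: leqSpred. Qed.

Lemma dg_lform_le (phi : 'Hom(L, C^o)) : (dg (lform phi) <= 1)%N.
Proof.
rewrite -size_theta theta_lform; apply: leq_trans (size_polyD _ _) _.
rewrite geq_max (leq_trans (size_polyC_leq1 _)) //=.
apply: leq_trans (size_polyMleq _ _) _; rewrite size_polyX addn2 /=.
by rewrite ltnS size_polyC_leq1.
Qed.

End Theta.
End Projection.

(** * The valuation given by the degree along a subspace *)

Section Frac.
Variable D : idomainType.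
Local Open Scope quotient_scope.

Lemma frac_numden (x : {fraction D}) :
  x = tofrac (frac (repr x)).1 / tofrac (frac (repr x)).2.
Proof.
have d0 := denom_ratioP (repr x).
apply: (canRL (mulfK _)); first by rewrite tofrac_eq0.
rewrite -{1}[x]reprK; unlock FracField.tofrac; rewrite -[LHS]FracField.pi_mul.
apply/eqmodP; rewrite /= FracField.equivfE /FracField.mulf.
by rewrite !numden_Ratio ?mulr1 ?oner_neq0 // mulrC.
Qed.

End Frac.

(** * The valuation on a field of fractions [K], given by an embedding [iota] *)

Section Valuation.
Variables (C : numFieldType) (L : vectType C) (r : nat) (b : r.-tuple L).
Hypothesis bL : basis_of fullv b.
Variable pi : 'End(L).
Variables (K : fieldType) (iota : {rmorphism {mpoly C[r]} -> K}).
Hypothesis iota_inj : injective iota.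
Hypothesis fracP : forall x, exists p q : {mpoly C[r]}, q != 0 /\ x = iota p / iota q.
Local Notation theta := (dilate b pi).
Local Notation dg := (dir_deg b pi).
Local Notation "p %:F" := (iota p) (at level 1).
Implicit Types (x y z : K) (p q f g : {mpoly C[r]}).

Let num x := projT1 (cid (fracP x)).
Let den x := projT1 (cid (projT2 (cid (fracP x)))).

(* Minus the degree along the image of pi; [dir_val 0] is the junk value 0. *)
Definition dir_val x : int := if x == 0 then 0 else (dg (den x))%:Z - (dg (num x))%:Z.
Local Notation val := dir_val.

Lemma numden x : den x != 0 /\ x = (num x)%:F / (den x)%:F.
Proof. exact: projT2 (cid (projT2 (cid (fracP x)))). Qed.

Lemma iota_eq p q : (p%:F == q%:F) = (p == q).
Proof. exact: inj_eq. Qed.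

Lemma iota_eq0 p : (p%:F == 0) = (p == 0).
Proof. by rewrite -(rmorph0 iota) iota_eq. Qed.

Lemma frac_eq p q p' q' : q != 0 -> q' != 0 ->
  (p%:F / q%:F == p'%:F / q'%:F) = (p * q' == p' * q).
Proof. by move=> q0 q0'; rewrite eqr_div ?iota_eq0 // -!(rmorphM iota) iota_eq. Qed.

Lemma frac_neq0 p q : q != 0 -> (p%:F / q%:F != 0) = (p != 0).
Proof. by move=> q0; rewrite mulf_eq0 invr_eq0 !iota_eq0 (negbTE q0) orbF. Qed.

Lemma val_frac p q : p != 0 -> q != 0 -> val (p%:F / q%:F) = (dg q)%:Z - (dg p)%:Z.
Proof.
move=> p0 q0; rewrite /dir_val (negbTE (_ : _ != 0)) ?frac_neq0 //; set x := p%:F / q%:F.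
have [d0 /eqP] := numden x; move: (num x) (den x) d0 => n d d0.
rewrite {}/x frac_eq // => /eqP E.
have n0 : n != 0.
  apply: contra_eq_neq E => ->; rewrite mul0r; exact: mulf_neq0.
by have := congr1 dg E; rewrite !dgM //; lia.
Qed.

Lemma val_poly p : p != 0 -> val p%:F = - (dg p)%:Z.
Proof.
move=> p0; rewrite -[p%:F]divr1 -(rmorph1 iota) val_frac ?oner_neq0 //.
by rewrite -mpolyC1 dgC // sub0r.
Qed.

Lemma val1 : val 1 = 0.
Proof. by rewrite -(rmorph1 iota) val_poly ?oner_neq0 // -mpolyC1 dgC. Qed.

Lemma valM x y : x != 0 -> y != 0 -> val (x * y) = val x + val y.
Proof.
have [p [q [q0 ->]]] := fracP x; have [p' [q' [q'0 ->]]] := fracP y.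
rewrite (frac_neq0 p q0) (frac_neq0 p' q'0) => p0 p'0.
rewrite mulf_div -!(rmorphM iota) !val_frac ?mulf_neq0 // !dgM //; lia.
Qed.

Lemma valV x : val x^-1 = - val x.
Proof.
have [->|x0] := eqVneq x 0.
  by rewrite invr0 /dir_val eqxx.
have := val1; rewrite -(divff x0) valM ?invr_eq0 //; lia.
Qed.

(** The disjunction treats 0 as having infinite valuation, which the junk value does not. *)
Definition dir_val_ge (d : int) x := (x == 0) || (d <= val x).
Local Notation vge := dir_val_ge.

Lemma vgeN d x : vge d (- x) = vge d x.
Proof.
rewrite /dir_val_ge oppr_eq0; case: eqVneq => //= x0.
rewrite -mulN1r valM ?oppr_eq0 ?oner_eq0 //.
suff -> : val (-1) = 0 by rewrite add0r.
by rewrite -(rmorph1 iota) -(rmorphN iota) val_poly ?oppr_eq0 ?oner_eq0 // dgN -mpolyC1 dgC.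
Qed.

Lemma vgeD d x y : vge d x -> vge d y -> vge d (x + y).
Proof.
rewrite /dir_val_ge; have [->|x0 /= dx] := eqVneq x 0; first by rewrite add0r.
have [->|y0 /= dy] := eqVneq y 0; first by rewrite addr0 (negbTE x0) dx.
case: (eqVneq (x + y) 0) => //=; move: x0 y0 dx dy.
have [p [q [q0 ->]]] := fracP x; have [p' [q' [q'0 ->]]] := fracP y.
rewrite addf_div ?iota_eq0 // -!(rmorphM iota) -(rmorphD iota) !frac_neq0 ?mulf_neq0 //.
move=> p0 p'0 + + s0; rewrite !val_frac ?mulf_neq0 // dgM // => d1 d2.
have := @dgD _ _ _ b pi (p * q') (p' * q) (maxn (dg p + dg q') (dg p' + dg q))%N.
rewrite !dgM // leq_maxl leq_maxr => /(_ isT isT); move: d1 d2.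
move: (dg p) (dg q) (dg p') (dg q') (dg (_ + _)) => i j i' j' k; lia.
Qed.

Lemma vgeB d x y : vge d x -> vge d y -> vge d (x - y).
Proof. by move=> vx vy; apply: vgeD; rewrite ?vgeN. Qed.

Lemma vgeM d e x y : vge d x -> vge e y -> vge (d + e) (x * y).
Proof.
rewrite /dir_val_ge mulf_eq0; case: eqVneq => //= x0 dx; case: eqVneq => //= y0 dy.
by rewrite valM // lerD.
Qed.

Definition dir_val_ring : set K := [set x | vge 0 x]%classic.
Local Notation val_ring := dir_val_ring.

Lemma val_subring : is_subring val_ring.
Proof.
split; rewrite /dir_val_ring /=; first by rewrite /dir_val_ge val1 orbT.
- exact: vgeB.
- by move=> x y vx vy; rewrite -[0]addr0; apply: vgeM.
Qed.

Lemma val_max x : max_ideal val_ring x <-> vge 1 x.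
Proof.
rewrite /max_ideal /dir_val_ring /= /dir_val_ge invr_eq0 valV.
case: eqVneq => [->|x0 /=]; first by split => // _; split => //; left.
split=> [[H [/eqP|]]|H]; [by rewrite (negbTE x0)|lia|split; [lia|right; lia]].
Qed.

Lemma val_local : is_local val_ring.
Proof.
by split=> [|x y]; [exact: val_subring|rewrite !val_max; exact: vgeD].
Qed.

Lemma valXz x (z : int) : x != 0 -> val (x ^ z) = val x * z.
Proof.
move=> x0; case: z => n; rewrite ?NegzE -?exprnN ?valV -?exprnP.
  elim: n => [|n IH]; first by rewrite expr0 val1 mulr0.
  by rewrite exprS valM ?expf_neq0 // IH; lia.
rewrite -[RHS]opprK; congr (- _); rewrite mulrN opprK.
elim: n => [|n IH]; first by rewrite expr1 mulr1.
by rewrite exprS valM ?expf_neq0 // IH; lia.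
Qed.

Lemma val_uniformizer x : val x = 1 -> uniformizer val_ring x.
Proof.
move=> vx; have x0 : x != 0 by apply: contra_eq_neq vx => ->; rewrite /dir_val eqxx.
split => //; rewrite /dir_val_ring /= /dir_val_ge ?vx ?orbT ?invr_eq0 ?valV ?vx ?(negbTE x0) //.
move=> y y0; exists (y * x ^ (- val y)), (val y).
have yu : y * x ^ (- val y) != 0 by rewrite mulf_neq0 ?expfz_neq0.
have vu : val (y * x ^ (- val y)) = 0.
  by rewrite valM ?expfz_neq0 // valXz // vx mul1r subrr.
have Bu w : val w = 0 -> val_ring w.
  by move=> vw; rewrite /dir_val_ring /= /dir_val_ge vw lexx orbT.
split; [exact: Bu|by apply: Bu; rewrite valV vu oppr0|exact: yu|].
by rewrite -mulrA -expfzDr // addNr expr0z mulr1.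
Qed.

(** Units of [B] have valuation 0, so [dir_val] is the order of [B] times [val p]. Writing
    [t = w * p ^ e] gives [val p * e = 1] with both factors nonnegative, hence [val p = 1]. *)
Lemma is_ord_val (B : set K) t x (z : int) : is_subring B -> (B `<=` val_ring)%classic ->
  B t -> val t = 1 -> is_ord B x z -> z = val x.
Proof.
move=> sB BO Bt vt [p [u [[Bp p0 nVp H] Bu BVu u0 ->]]].
have vunit w : B w -> B w^-1 -> w != 0 -> val w = 0.
  move=> /BO + /BO; rewrite /dir_val_ring /= /dir_val_ge invr_eq0 valV => + + w0.
  by rewrite (negbTE w0) /=; lia.
have t0 : t != 0 by apply: contra_eq_neq vt => ->; rewrite /dir_val eqxx.
have [w [e [Bw BVw w0 E]]] := H t t0.
have vp : 0 <= val p by move/BO: Bp; rewrite /dir_val_ring /= /dir_val_ge (negbTE p0).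
have : val p * e = 1 by rewrite -vt E valM ?expfz_neq0 // valXz // (vunit w) // add0r.
(* A negative exponent would put [p^-1] into [B], against [p] being a uniformizer. *)
have e0 : 0 <= e.
  rewrite leNgt; apply/negP; case: e E => [//|n] E _.
  apply: nVp; rewrite -[p^-1]mulr1.
  have -> : p^-1 * 1 = p ^+ n * (t * w^-1).
    rewrite E NegzE -exprnN exprSr invfM; field.
    by rewrite ?w0 ?p0 ?expf_neq0.
  by apply: (subringM sB); [exact: subringX|exact: subringM].
move=> pe; rewrite valM ?expfz_neq0 // (vunit u) // valXz //.
suff -> : val p = 1 by rewrite add0r mul1r.
move: vp pe e0; case: (val p) => // m _; case: {E} e => // n + _.
by rewrite -PoszM => -[/eqP]; rewrite muln_eq1 => /andP [/eqP ->].
Qed.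

(* The fractions fixed by all the maps (1 - pi) + c pi. *)
Definition weight0 : set K :=
  [set x | exists f g, [/\ g != 0, x = f%:F / g%:F & theta f * g%:P = f%:P * theta g]]%classic.

Lemma weight0_subring : is_subring weight0.
Proof.
split.
- exists 1, 1; split; rewrite ?oner_neq0 ?(rmorph1 iota) ?divr1 //.
  by rewrite rmorph1 mulrC.
- move=> _ _ [f [g [g0 -> E]]] [f' [g' [g'0 -> E']]].
  exists (f * g' - f' * g), (g * g'); split; first exact: mulf_neq0.
    rewrite -mulNr addf_div ?iota_eq0 // -(rmorphN iota) -!(rmorphM iota) -(rmorphD iota).
    by rewrite mulNr.
  rewrite rmorphB !thetaM polyCB !polyCM.
  transitivity ((theta f * g%:P) * theta g' * g'%:P - (theta f' * g'%:P) * theta g * g%:P); first by ring.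
  by rewrite E E'; ring.
- move=> _ _ [f [g [g0 -> E]]] [f' [g' [g'0 -> E']]].
  exists (f * f'), (g * g'); split; [exact: mulf_neq0|by rewrite mulf_div -!(rmorphM iota)|].
  rewrite !thetaM !polyCM.
  transitivity ((theta f * g%:P) * (theta f' * g'%:P)); first by ring.
  by rewrite E E'; ring.
Qed.

Lemma weight0V x : weight0 x -> weight0 x^-1.
Proof.
move=> [f [g [g0 -> E]]]; have [->|f0] := eqVneq f 0.
  by rewrite (rmorph0 iota) mul0r invr0; exact: subring0 weight0_subring.
by exists g, f; split; rewrite ?invf_div // mulrC -E mulrC.
Qed.

Lemma weight0_val x : weight0 x -> val x = 0.
Proof.
move=> [f [g [g0 -> E]]]; have [->|f0] := eqVneq f 0.
  by rewrite (rmorph0 iota) mul0r /dir_val eqxx.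
rewrite val_frac //.
have : size (theta f * g%:P) = size (f%:P * theta g) by rewrite E.
rewrite mulrC !mul_polyC !size_scale // => Es.
by rewrite /dir_deg Es subrr.
Qed.

End Valuation.

(** * Homogeneous polynomials and points of projective space *)

Section TopCoefficient.
Variable C : numFieldType.

Lemma coef_top_mul (F G : {poly C}) d e : (size F <= d.+1)%N -> (size G <= e.+1)%N ->
  (size (F * G)%R <= (d + e).+1)%N /\ (F * G)`_(d + e) = F`_d * G`_e.
Proof.
move=> sF sG; split; first by apply: leq_trans (size_polyMleq _ _) _; lia.
rewrite coefM (bigD1 (inord d)) //= inordK ?ltnS ?leq_addr // addKn.
rewrite big1 ?addr0 // => i /eqP id.
have [lt|le] := ltnP d i; first by rewrite (nth_default _ (leq_trans sF lt)) mul0r.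
rewrite [G`__]nth_default ?mulr0 //; apply: leq_trans sG _.
have : (i : nat) != d by apply/eqP => E; apply: id; apply/val_inj; rewrite /= inordK ?ltnS ?leq_addr.
by move=> ?; lia.
Qed.

Definition line N (u w : 'I_N -> C) : {mpoly C[N]} -> {poly C} :=
  locked (mmap (@polyC C) (fun i => (u i)%:P + (w i)%:P * 'X)).

Fact line_zmod N (u w : 'I_N -> C) : zmod_morphism (line u w).
Proof. by rewrite /line; unlock; exact: raddfB. Qed.
Fact line_monoid N (u w : 'I_N -> C) : monoid_morphism (line u w).
Proof. by rewrite /line; unlock; split; [exact: rmorph1|exact: rmorphM]. Qed.
HB.instance Definition _ N (u w : 'I_N -> C) :=
  GRing.isZmodMorphism.Build _ _ (line u w) (line_zmod u w).
HB.instance Definition _ N (u w : 'I_N -> C) :=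
  GRing.isMonoidMorphism.Build _ _ (line u w) (line_monoid u w).

Section Line.
Variables (N : nat) (u w : 'I_N -> C).
Lemma lineD p q : line u w (p + q) = line u w p + line u w q. Proof. exact: rmorphD. Qed.
Lemma lineM p q : line u w (p * q) = line u w p * line u w q. Proof. exact: rmorphM. Qed.
Lemma lineC c : line u w c%:MP = c%:P. Proof. by rewrite /line -lock mmapC. Qed.
Lemma lineX i : line u w 'X_i = (u i)%:P + (w i)%:P * 'X.
Proof. by rewrite /line -lock mmapX mmap1U. Qed.

(** In a monomial of degree [d] the power [s^d] arises only by taking the direction [w] in every
    variable; the base point [u] affects lower terms only. *)
Lemma line_homog p d : p \is d.-homog for mdeg ->
  (size (line u w p) <= d.+1)%N /\ (line u w p)`_d = p.@[w].
Proof.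
move=> /dhomogP hp; rewrite {1 2}[p]mpolyE mevalE rmorph_sum /= coef_sum.
have mono m : (size (line u w 'X_[m]) <= (mdeg m).+1)%N /\
    (line u w 'X_[m])`_(mdeg m) = \prod_i w i ^+ m i.
  rewrite mpolyXE_id rmorph_prod /= mdegE.
  elim/big_ind3: _ => [|F d1 c1 G d2 c2 [sF <-] [sG <-]|i _].
  - by rewrite size_poly1 coef1.
  - by have [? ->] := coef_top_mul sF sG.
  rewrite rmorphXn /= lineX; elim: (m i) => [|k [sk IH]]; first by rewrite !expr0 size_poly1 coef1.
  have s1 : (size ((u i)%:P + (w i)%:P * 'X)%R <= 2)%N.
    apply: leq_trans (size_polyD _ _) _; rewrite geq_max (leq_trans (size_polyC_leq1 _)) //=.
    apply: leq_trans (size_polyMleq _ _) _; rewrite size_polyX addn2 /=.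
    by rewrite ltnS size_polyC_leq1.
  have [sk1 ck1] := coef_top_mul s1 sk.
  rewrite !exprS -add1n ck1 IH; split=> //; congr (_ * _).
  by rewrite coefD coefC coefMX coefC /= add0r.
split.
  apply: leq_trans (size_sum _ _ _) _; rewrite big_seq; apply/bigmax_leqP_seq => m mp _.
  by rewrite -mul_mpolyC lineM lineC mul_polyC (leq_trans (size_scale_leq _ _)) // -(hp m mp); case: (mono m).
rewrite big_seq [RHS]big_seq; apply: eq_bigr => m mp.
by rewrite -mul_mpolyC lineM lineC mul_polyC coefZ -{1}(hp m mp); case: (mono m) => _ ->.
Qed.

End Line.

Lemma meval_homog N (p : {mpoly C[N]}) d c (x : 'I_N -> C) : p \is d.-homog for mdeg ->
  p.@[fun i => c * x i] = c ^+ d * p.@[x].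
Proof.
move=> /dhomogP hp; rewrite !mevalE mulr_sumr big_seq [RHS]big_seq; apply: eq_bigr => m mp.
have -> : d = (\sum_i m i)%N by rewrite -(hp m mp) /= mdegE.
rewrite mulrCA; congr (_ * _).
under eq_bigr do rewrite exprMn.
by rewrite big_split /= -expr_sum.
Qed.

End TopCoefficient.

Section Dehomogenization.
Variables (C : numFieldType) (L : vectType C) (r : nat) (b : r.-tuple L).
Hypothesis bL : basis_of fullv b.
Local Notation coords v := (fun j => coord b j v).
Local Notation theta := (dilate b).
Local Notation dg := (dir_deg b).
Local Notation hmg d p := (p \is d.-homog for mdeg).

Definition ext (y : 'I_r -> C) (t : C) (i : 'I_r.+1) : C :=
  if unlift ord_max i is Some j then y j else t.

Lemma dehomX (i : 'I_r.+1) :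
  dehom ('X_i : {mpoly C[r.+1]}) = if unlift ord_max i is Some j then 'X_j else 1.
Proof. by rewrite /dehom comp_mpolyXU -tnth_nth tnth_mktuple. Qed.
Lemma dehomC c : dehom (c%:MP : {mpoly C[r.+1]}) = c%:MP.
Proof. exact: comp_mpolyC. Qed.
Lemma dehomD (p q : {mpoly C[r.+1]}) : dehom (p + q) = dehom p + dehom q.
Proof. exact: comp_mpolyD. Qed.
Lemma dehomB (p q : {mpoly C[r.+1]}) : dehom (p - q) = dehom p - dehom q.
Proof. exact: comp_mpolyB. Qed.
Lemma dehomM (p q : {mpoly C[r.+1]}) : dehom (p * q) = dehom p * dehom q.
Proof. exact: rmorphM. Qed.
Lemma dehom1 : dehom (1 : {mpoly C[r.+1]}) = 1. Proof. exact: rmorph1. Qed.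
Lemma dehom0 : dehom (0 : {mpoly C[r.+1]}) = 0. Proof. exact: rmorph0. Qed.

(** An affine line lifts to a line whose direction [(w, 0)] is a point at infinity. Top coefficients
    along affine lines thus become values on the hyperplane at infinity. *)
Lemma dehom_line (p : {mpoly C[r.+1]}) (u w : 'I_r -> C) :
  line u w (dehom p) = line (ext u 1) (ext w 0) p.
Proof.
elim/mpoly_ring_ind: p => [c|i|p q Hp Hq|p q Hp Hq].
- by rewrite dehomC !lineC.
- rewrite dehomX lineX /ext; case: unlift => [j|]; first by rewrite lineX.
  by rewrite -mpolyC1 lineC mul0r addr0.
- by rewrite dehomD !lineD Hp Hq.
- by rewrite dehomM !lineM Hp Hq.
Qed.

Lemma dehom_eval (p : {mpoly C[r.+1]}) y : (dehom p).@[y] = p.@[ext y 1].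
Proof.
rewrite /dehom comp_mpoly_meval; apply: meval_eq => i.
by rewrite tnth_mktuple /ext; case: unlift => [j|]; rewrite ?mevalXU ?meval1.
Qed.

Lemma dehom_inj (p q : {mpoly C[r.+1]}) d : hmg d p -> hmg d q -> dehom p = dehom q -> p = q.
Proof.
move=> hp hq E; apply/eqP; rewrite -subr_eq0; apply: contrapT => /negP.
(* The extra factor forces the chosen point off the hyperplane at infinity, so that it can be scaled
   into the chart where the last coordinate is 1. *)
have hX : ('X_ord_max : {mpoly C[r.+1]}) != 0.
  by apply/negP => /eqP/(congr1 (meval (fun=> 1))); rewrite mevalXU meval0 => /eqP; rewrite oner_eq0.
move=> pq0; have /mpoly_nonroot [x] := mulf_neq0 pq0 hX.
rewrite mevalM mevalXU mulf_eq0 => /norP [pqx x0]; move: pqx.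
have /meval_homog H : hmg d (p - q) by apply: rpredB.
suff -> : (p - q).@[x] = 0 by rewrite eqxx.
set y := fun j : 'I_r => (x ord_max)^-1 * x (lift ord_max j).
rewrite -(@meval_eq _ _ (fun i => x ord_max * ext y 1 i) x).
  by rewrite H -dehom_eval dehomB E subrr meval0 mulr0.
move=> i; rewrite /ext; case: unliftP => [j ->|->]; last by rewrite mulr1.
by rewrite /y mulVKf.
Qed.

Lemma dehom_eq0 (p : {mpoly C[r.+1]}) d : hmg d p -> (dehom p == 0) = (p == 0).
Proof.
move=> hp; apply/eqP/eqP => [E|->]; last exact: dehom0.
by apply: dehom_inj hp _ _; rewrite ?dehom0 // rpred0.
Qed.

Lemma theta_eval (pi : 'End(L)) x f :
  map_poly (meval (coords x)) (theta pi f) = line (coords (x - pi x)) (coords (pi x)) f.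
Proof.
have ev (g : 'End(L)) j : (lform b (fun v => coord b j (g v))).@[coords x] = coord b j (g x).
  have := lform_eval bL (linfun (coord b j : L -> C^o) \o g)%VF x.
  by rewrite comp_lfunE lfunE /= => <-; congr (_.@[_]); apply: eq_lform => v; rewrite comp_lfunE lfunE.
elim/mpoly_ring_ind: f => [c|j|p q Hp Hq|p q Hp Hq].
- by rewrite thetaC map_polyC /= lineC mevalC.
- rewrite /dilate substX lineX rmorphD rmorphM /= map_polyX !map_polyC /= ev.
  have := ev (\1 - pi)%VF j; rewrite add_lfunE opp_lfunE id_lfunE => <-.
  congr (_%:P + _); congr (_.@[_]); apply: eq_lform => v.
  by rewrite add_lfunE opp_lfunE id_lfunE.
- by rewrite thetaD rmorphD /= lineD Hp Hq.
- by rewrite thetaM rmorphM /= lineM Hp Hq.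
Qed.

(** The link between forms and degrees: for [pi = projv W], a form of degree [d] vanishes on P(W)
    exactly when its dehomogenization has zero component of degree [d] along W. *)
Lemma theta_homog (pi : 'End(L)) (p : {mpoly C[r.+1]}) d x : hmg d p ->
  ((theta pi (dehom p))`_d).@[coords x] = p.@[ext (coords (pi x)) 0].
Proof.
move=> hp; rewrite -coef_map /= theta_eval dehom_line.
by have [_ ->] := line_homog (ext (coords (x - pi x)) 1) (ext (coords (pi x)) 0) hp.
Qed.

Lemma dg_dehom (pi : 'End(L)) (p : {mpoly C[r.+1]}) d : hmg d p -> (dg pi (dehom p) <= d)%N.
Proof.
move=> hp; rewrite -size_theta; apply/leq_sizeP => j dj; apply/eqP; apply: contrapT => /negP.
move=> /(nonroot_vec bL) [x]; rewrite -coef_map /= theta_eval dehom_line => /eqP; apply.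
have [sz _] := line_homog (ext (coords (x - pi x)) 1) (ext (coords (pi x)) 0) hp.
by rewrite nth_default // (leq_trans sz).
Qed.

(** The component of degree [k] lifts to a form of degree [k]; multiplying by the power [d - k] of
    the last variable, which dehomogenizes to 1, makes all degrees equal. *)
Lemma homogenize f d : (dg \1%VF f <= d)%N -> exists p, hmg d p /\ dehom p = f.
Proof.
rewrite -size_theta => szf.
pose Phi k f := exists p : {mpoly C[r.+1]}, hmg k p /\ dehom p = f.
have PhiD k p q : Phi k p -> Phi k q -> Phi k (p + q).
  move=> [p' [hp <-]] [q' [hq <-]]; exists (p' + q'); split; last exact: dehomD.
  exact: rpredD.
have Phi0 k : Phi k 0 by exists 0; rewrite dehom0 rpred0.
have PhiM i j p q : Phi i p -> Phi j q -> Phi (i + j)%N (p * q).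
  move=> [p' [hp <-]] [q' [hq <-]]; exists (p' * q'); split; last exact: dehomM.
  exact: dhomogM.
have hX i : hmg 1 ('X_i : {mpoly C[r.+1]}) by rewrite dhomogX /= mdeg1.
have Phi_coef k : Phi k (theta \1%VF f)`_k.
  apply: subst_coef => // [c|j|j].
  - by exists c%:MP; rewrite dehomC -[c%:MP]mulr1 mul_mpolyC; split=> //; apply: rpredZ; exact: dhomog1.
  - suff -> : lform b (fun v => coord b j (v - \1%VF v)) = 0 by [].
    by rewrite /lform big1 // => i _; rewrite id_lfunE subrr linear0 scale0r.
  - exists 'X_(lift ord_max j); split; first exact: hX.
    rewrite dehomX liftK -[LHS](lform_dual bL); apply: eq_lform => v; by rewrite id_lfunE.
have Phit k : Phi k 1.
  exists ('X_ord_max ^+ k); split; first by have := dhomogMn k (hX ord_max); rewrite mul1n.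
  elim: k => [|k IH]; first by rewrite expr0 dehom1.
  by rewrite exprS dehomM IH mulr1 dehomX unlift_none.
have Phid : Phi d f.
  rewrite [f](theta_sum bL szf); apply: big_ind => [||k _] //; first exact: PhiD.
  rewrite -[X in Phi X](subnKC (leq_ord k)) -[X in Phi _ X]mulr1; exact: PhiM.
exact: Phid.
Qed.

End Dehomogenization.

(** * Local rings of projective space, and the generic points of linear subspaces at infinity *)

Section Stalks.
Variables (C : numFieldType) (L : vectType C) (r : nat) (b : r.-tuple L).
Hypothesis bL : basis_of fullv b.
Variables (K : fieldType) (iota : {rmorphism {mpoly C[r]} -> K}).
Hypothesis iota_inj : injective iota.
Hypothesis fracP : forall x, exists p q : {mpoly C[r]}, q != 0 /\ x = iota p / iota q.
Local Notation coords v := (fun j => coord b j v).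
Local Notation theta := (dilate b).
Local Notation dg := (dir_deg b).
Local Notation hmg d p := (p \is d.-homog for mdeg).
Local Notation "p %:F" := (iota p) (at level 1).
Local Notation val W := (dir_val b (projv W) fracP).
Local Notation vge W := (dir_val_ge b (projv W) fracP).
Implicit Types (W : {vspace L}) (P : set {mpoly C[r.+1]}).

(** [proj_stalk] with [tofrac] replaced by an arbitrary embedding [iota]. *)
Definition stalk P : set K :=
  [set z | exists d p q, [/\ hmg d p, hmg d q, ~ P q
                           & z = (dehom p)%:F / (dehom q)%:F]]%classic.

Lemma prime_notin0 P q : is_prime_ideal [set: {mpoly C[r.+1]}]%classic P -> ~ P q -> q != 0.
Proof. by move=> [[_ P0 _ _] _ _] nP; apply/eqP => q0; apply: nP; rewrite q0. Qed.

Lemma homog_dehom_neq0 P d q : is_prime_ideal [set: {mpoly C[r.+1]}]%classic P -> hmg d q ->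
  ~ P q -> (dehom q)%:F != 0.
Proof.
move=> pP hq nq; rewrite -(rmorph0 iota) (inj_eq iota_inj).
by rewrite (dehom_eq0 hq) (prime_notin0 pP nq).
Qed.

Section Local.
Variables (P : set {mpoly C[r.+1]}) (pP : is_prime_ideal [set: {mpoly C[r.+1]}]%classic P).

Lemma prime_notinM p q : ~ P p -> ~ P q -> ~ P (p * q).
Proof. by case: pP => _ _ H np nq /(H _ _ I I) []. Qed.

Lemma stalk_const c : stalk P (c%:MP)%:F.
Proof.
exists 0%N, c%:MP, 1; split.
- by rewrite -[c%:MP]mulr1 mul_mpolyC; apply: rpredZ; exact: dhomog1.
- exact: dhomog1.
- by case: pP.
by rewrite dehomC dehom1 rmorph1 divr1.
Qed.

Lemma stalk_subring : is_subring (stalk P).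
Proof.
split; first by have := stalk_const 1; rewrite mpolyC1 rmorph1.
- move=> _ _ [d [p [q [hp hq nq ->]]]] [e [p' [q' [hp' hq' nq' ->]]]].
  exists (d + e)%N, (p * q' - p' * q), (q * q'); split.
  + apply: rpredB; first exact: dhomogM.
    by rewrite addnC; apply: dhomogM.
  + exact: dhomogM.
  + exact: prime_notinM.
  rewrite dehomB !dehomM rmorphB !rmorphM.
  by field; rewrite (homog_dehom_neq0 pP hq nq) (homog_dehom_neq0 pP hq' nq').
- move=> _ _ [d [p [q [hp hq nq ->]]]] [e [p' [q' [hp' hq' nq' ->]]]].
  exists (d + e)%N, (p * p'), (q * q'); split; [exact: dhomogM|exact: dhomogM|exact: prime_notinM|].
  by rewrite !dehomM !rmorphM mulf_div.
Qed.

Lemma stalk_max d p q : hmg d p -> hmg d q -> ~ P q ->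
  max_ideal (stalk P) ((dehom p)%:F / (dehom q)%:F) <-> P p.
Proof.
move=> hp hq nq; have q0 := homog_dehom_neq0 pP hq nq.
split=> [[_ H]|Pp].
  apply: contrapT => np; have p0 := homog_dehom_neq0 pP hp np.
  case: H => [/eqP|[]]; first by rewrite mulf_eq0 invr_eq0 (negbTE p0) (negbTE q0).
  by rewrite invf_div; exists d, q, p.
split; first by exists d, p, q.
have [->|p0] := eqVneq (dehom p)%:F 0; first by left; rewrite mul0r.
right=> -[e [p' [q' [hp' hq' nq' /eqP]]]].
rewrite invf_div eqr_div ?(homog_dehom_neq0 pP hq' nq') // -!(rmorphM iota) (inj_eq iota_inj) -!dehomM.
move=> /eqP E; apply: (prime_notinM nq nq').
have -> : q * q' = p' * p.
  apply: (dehom_inj (dhomogM hq hq') _ E).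
  by rewrite addnC; exact: dhomogM.
by case: pP => -[_ _ _ H] _ _; apply: H.
Qed.

Lemma stalk_local : is_local (stalk P).
Proof.
split; first exact: stalk_subring.
move=> _ _ [[d [p [q [hp hq nq ->]]]] mx] [[e [p' [q' [hp' hq' nq' ->]]]] my].
have Pp : P p by apply/(stalk_max hp hq nq); split; [exists d, p, q|].
have Pp' : P p' by apply/(stalk_max hp' hq' nq'); split; [exists e, p', q'|].
have -> : (dehom p)%:F / (dehom q)%:F + (dehom p')%:F / (dehom q')%:F =
    (dehom (p * q' + p' * q))%:F / (dehom (q * q'))%:F.
  rewrite dehomD !dehomM rmorphD !rmorphM; field.
  by rewrite (homog_dehom_neq0 pP hq nq) (homog_dehom_neq0 pP hq' nq').
have [[_ _ PD PM] _ _] := pP.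
apply/(@stalk_max (d + e)%N).
- by apply: rpredD; last rewrite addnC; apply: dhomogM.
- exact: dhomogM.
- exact: prime_notinM.
by apply: PD; rewrite mulrC; apply: PM.
Qed.

End Local.

Definition vanishing W : set {mpoly C[r.+1]} :=
  [set p | forall v, v \in W -> p.@[point_at_infinity b v] = 0]%classic.

Lemma theta_top W d (p : {mpoly C[r.+1]}) x : hmg d p ->
  ((theta (projv W) (dehom p))`_d).@[coords x] = p.@[point_at_infinity b (projv W x)].
Proof. exact: theta_homog. Qed.

(** For [v] in W the polynomial [c |-> p(c v)] has as coefficients the values at [v] of the
    homogeneous components of [p], and it vanishes on an infinite field. *)
Lemma vanishing_homog W : homogeneous_ideal (vanishing W).
Proof.
move=> p d Qp v vW; pose N := maxn (msize p) d.+1.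
have pE : p = \sum_(k < N) pihomog mdeg k p by apply: pihomog_partitionE; exact: leq_maxl.
pose F : {poly C} := \poly_(k < N) (pihomog mdeg k p).@[point_at_infinity b v].
suff F0 : F = 0.
  have := congr1 (fun F : {poly C} => F`_d) F0.
  by rewrite coef0 coef_poly leq_maxr.
apply/eqP; apply: contrapT => /negP /poly_nonroot [c /eqP]; apply.
rewrite /F horner_poly -[RHS](Qp (c *: v)) ?memvZ // [in RHS]pE raddf_sum /=.
apply: eq_bigr => k _; rewrite mulrC -(meval_homog _ _ (pihomogP _ _ _)).
apply: meval_eq => i; rewrite /point_at_infinity.
by case: unlift => [j|]; rewrite ?mulr0 // linearZ.
Qed.

(** Composition with the projection turns polynomials not vanishing identically on W into nonzero
    polynomials on L; their product is nonzero at some point, whose projection lies in W. *)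
Lemma vanishing_prime W : W != 0%VS -> is_prime_ideal [set: {mpoly C[r.+1]}]%classic (vanishing W).
Proof.
move=> W0; split.
- split=> //; first by move=> v _; rewrite meval0.
    by move=> p q Qp Qq v vW; rewrite mevalD Qp // Qq // addr0.
  by move=> a p _ Qp v vW; rewrite mevalM Qp // mulr0.
- move=> /(_ 0 (mem0v _)) /eqP; rewrite meval1; exact/negP/oner_neq0.
move=> p q _ _ Qpq; apply: contrapT => /not_orP [/existsNP [v /not_implyP [vW pv]]].
move=> /existsNP [w /not_implyP [wW qw]].
pose g := [tuple if unlift ord_max i is Some j then lform b (fun v => coord b j (projv W v)) else 0 | i < r.+1].
have ev f x : (f \mPo g).@[coords x] = f.@[point_at_infinity b (projv W x)].
  rewrite comp_mpoly_meval; apply: meval_eq => i; rewrite tnth_mktuple /point_at_infinity.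
  case: unlift => [j|]; last by rewrite meval0.
  have := lform_eval bL (linfun (coord b j : L -> C^o) \o projv W)%VF x.
  rewrite comp_lfunE lfunE /= => <-; congr (_.@[_]); apply: eq_lform => u.
  by rewrite comp_lfunE lfunE.
have nz f u : u \in W -> f.@[point_at_infinity b u] <> 0 -> f \mPo g != 0.
  move=> uW fu; apply/eqP => E; apply: fu.
  by rewrite -{1}(projv_id uW) -ev E meval0.
have [x] := nonroot_vec bL (mulf_neq0 (nz _ _ vW pv) (nz _ _ wW qw)).
rewrite -rmorphM /= ev Qpq ?memv_proj // eqxx //.
Qed.

Definition eta W := stalk (vanishing W).

Lemma eta_local W : W != 0%VS -> is_local (eta W).
Proof. by move=> W0; apply/stalk_local/vanishing_prime. Qed.

Lemma dg_le_total pi f : (dg pi f <= dg \1%VF f)%N.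
Proof.
have [p [hp pf]] := homogenize bL (leqnn (dg \1%VF f)).
by rewrite -{1}pf; apply: (dg_dehom bL).
Qed.

(** A denominator does not vanish identically on P(W) exactly when its dehomogenization attains the
    formal degree [d] along W. Membership thus becomes a comparison of degrees. *)
Lemma etaP W z : eta W z <-> exists f g d, [/\ g != 0, z = f%:F / g%:F,
   (dg \1%VF f <= d)%N, (dg \1%VF g <= d)%N & (d <= dg (projv W) g)%N].
Proof.
split=> [[d [p [q [hp hq nq ->]]]]|[f [g [d [g0 -> lf lg gd]]]]].
  have /existsNP [v /not_implyP [vW qv]] := nq.
  have cd : (theta (projv W) (dehom q))`_d != 0.
    apply/eqP => E; apply: qv; rewrite -[v in point_at_infinity b v](projv_id vW) -(theta_top _ _ hq).
    by rewrite E meval0.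
  exists (dehom p), (dehom q), d; split => //; try exact: dg_dehom.
    by apply: contraNneq cd => ->; rewrite rmorph0 coef0.
  by rewrite leqNgt; apply: contraNN cd => /dg_coef0 ->.
have [p [hp pf]] := homogenize bL lf; have [q [hq qg]] := homogenize bL lg.
exists d, p, q; rewrite pf qg; split=> // Qq.
have dE : dg (projv W) g = d.
  by apply/eqP; rewrite eqn_leq gd (leq_trans (dg_le_total _ _) lg).
have : lead_coef (theta (projv W) g) != 0 by rewrite lead_coef_eq0 theta_eq0.
rewrite lead_coefE -/(dg _ _) dE => /(nonroot_vec bL) [x /eqP]; apply.
by rewrite -qg (theta_top _ _ hq) Qq // memv_proj.
Qed.

End Stalks.

(** * Affine forms as equations of linear subspaces at infinity *)

Section AffineForms.
Variables (C : numFieldType) (L : vectType C) (r : nat) (b : r.-tuple L).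
Hypothesis bL : basis_of fullv b.
Variables (K : fieldType) (iota : {rmorphism {mpoly C[r]} -> K}).
Hypothesis iota_inj : injective iota.
Hypothesis fracP : forall x, exists p q : {mpoly C[r]}, q != 0 /\ x = iota p / iota q.
Local Notation coords v := (fun j => coord b j v).
Local Notation theta := (dilate b).
Local Notation dg := (dir_deg b).
Local Notation "p %:F" := (iota p) (at level 1).
Local Notation val W := (dir_val b (projv W) fracP).
Local Notation vge W := (dir_val_ge b (projv W) fracP).
Local Notation val_ring W := (dir_val_ring b (projv W) fracP).
Local Notation weight0 W := (weight0 b (projv W) iota).
Local Notation eta W := (eta b iota W).
Local Notation valM := (valM bL _ iota_inj fracP).
Local Notation valV := (valV bL _ iota_inj fracP).
Local Notation val_frac := (val_frac bL _ iota_inj fracP).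
Local Notation etaP := (etaP bL iota).
Implicit Types (W V : {vspace L}) (A B : set K).

Lemma projv_full : projv fullv = \1%VF :> 'End(L).
Proof. by apply/lfunP => v; rewrite projv_id ?memvf // id_lfunE. Qed.

Lemma frac0 (g : {mpoly C[r]}) : (0 : {mpoly C[r]})%:F / g%:F = 0.
Proof. by rewrite rmorph0 mul0r. Qed.

Lemma eta_sub_val W : (eta W `<=` val_ring W)%classic.
Proof.
move=> z /etaP [f [g [d [g0 -> lf lg gd]]]]; rewrite /dir_val_ring /= /dir_val_ge.
have [->|f0] := eqVneq f 0; first by rewrite frac0 eqxx.
apply/orP; right; rewrite val_frac // subr_ge0 lez_nat.
exact: leq_trans (dg_le_total bL _ _) (leq_trans lf gd).
Qed.

(** P(W) lies in the hyperplane at infinity, and [val fullv], minus the total degree, is the order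
    along that hyperplane. *)
Lemma eta_sub_total W : (eta W `<=` val_ring fullv)%classic.
Proof.
move=> z /etaP [f [g [d [g0 -> lf lg gd]]]]; rewrite /dir_val_ring /= /dir_val_ge.
have [->|f0] := eqVneq f 0; first by rewrite frac0 eqxx.
apply/orP; right; rewrite val_frac // subr_ge0 lez_nat projv_full.
exact: leq_trans lf (leq_trans gd (dg_le_total bL _ _)).
Qed.

Lemma eta_inv W z : eta W z -> z != 0 -> val W z = 0 -> eta W z^-1.
Proof.
move=> /etaP [f [g [d [g0 -> lf lg gd]]]].
have [->|f0] := eqVneq f 0; first by rewrite frac0 eqxx.
move=> _; rewrite val_frac // invf_div => /eqP; rewrite subr_eq0 eqz_nat => /eqP E.
by apply/etaP; exists g, f, d; split=> //; rewrite -E.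
Qed.

Lemma eta_max W x : max_ideal (eta W) x <-> eta W x /\ vge W 1 x.
Proof.
rewrite /max_ideal /dir_val_ge; split=> [[ex nx]|[ex vx]]; split => //.
  have [//|x0 /=] := eqVneq x 0.
  have /orP [|] := eta_sub_val ex; first by rewrite (negbTE x0).
  rewrite le_eqVlt => /orP [/eqP E|]; last by lia.
  by case: nx => [/eqP|[]]; [rewrite (negbTE x0)|apply: eta_inv].
move: vx; have [x0|x0 /= vx] := eqVneq x 0; first by left.
right => /eta_sub_val /orP []; first by rewrite invr_eq0 (negbTE x0).
rewrite valV; lia.
Qed.

(* In homogeneous coordinates 1 is the equation of the hyperplane at infinity, so
   these are the linear equations of P(W), dehomogenized. *)
Definition espan W : set K :=
  [set x | exists (phi : 'Hom(L, C^o)) c, (forall v, v \in W -> phi v = 0) /\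
             x = (lform b phi + c%:MP)%:F]%classic.

Lemma espan1 W : espan W 1.
Proof.
exists 0, 1; split=> [v _|]; first by rewrite zero_lfunE.
rewrite mpolyC1 /lform big1 ?add0r ?rmorph1 // => j _.
by rewrite zero_lfunE scale0r.
Qed.

Lemma espanD W x y : espan W x -> espan W y -> espan W (x + y).
Proof.
move=> [phi [c [H ->]]] [psi [d [H' ->]]]; exists (phi + psi), (c + d); split=> [v vW|].
  by rewrite add_lfunE H // H' // addr0.
rewrite -rmorphD mpolyCD addrACA -lformD; congr ((_ + _)%:F).
by apply: eq_lform => v; rewrite add_lfunE.
Qed.

Lemma espanZ W c x : espan W x -> espan W (c%:MP%:F * x).
Proof.
move=> [phi [d [H ->]]]; exists (c *: phi), (c * d); split=> [v vW|].
  by rewrite scale_lfunE H // scaler0.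
rewrite -rmorphM mpolyCM mulrDr; congr ((_ + _)%:F).
rewrite mul_mpolyC /lform scaler_sumr; apply: eq_bigr => j _.
by rewrite scale_lfunE scalerA.
Qed.

Lemma espanB W x y : espan W x -> espan W y -> espan W (x - y).
Proof.
move=> Ex /(espanZ (-1)); rewrite mpolyCN mpolyC1 rmorphN rmorph1 mulN1r; exact: espanD.
Qed.

Lemma espan0 W : espan W 0.
Proof. by rewrite -(subrr 1); apply: espanB; apply: espan1. Qed.

Lemma espanS W V x : (V <= W)%VS -> espan W x -> espan V x.
Proof.
move=> VW [phi [c [H ->]]]; exists phi, c; split=> // v vV; apply: H.
exact: (subvP VW).
Qed.

Lemma espan_bot V x : espan V x -> espan 0%VS x.
Proof. by apply: espanS; exact: sub0v. Qed.

Lemma espan_coord x : (exists j, x = ('X_j)%:F) -> espan 0%VS x.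
Proof.
move=> [j ->]; exists (linfun (coord b j : L -> C^o)), 0; split.
  by move=> v; rewrite memv0 => /eqP ->; rewrite linear0.
rewrite mpolyC0 addr0 -(lform_dual bL); congr (_%:F); apply: eq_lform => v.
by rewrite lfunE.
Qed.

Section Fixed.
Variable W : {vspace L}.

Lemma theta_affine (phi : 'Hom(L, C^o)) c : theta (projv W) (lform b phi + c%:MP) =
  (lform b (fun v => phi (v - projv W v)) + c%:MP)%:P + (lform b (fun v => phi (projv W v)))%:P * 'X.
Proof. by rewrite thetaD theta_lform // thetaC polyCD addrAC. Qed.

Lemma espan_theta x : espan W x -> exists f, x = f%:F /\ theta (projv W) f = f%:P.
Proof.
move=> [phi [c [H ->]]]; eexists; split; first by [].
rewrite theta_affine.
have -> : lform b (fun v => phi (projv W v)) = 0.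
  by rewrite /lform big1 // => j _; rewrite H ?memv_proj // scale0r.
rewrite mul0r addr0; congr (_ + _)%:P; apply: eq_lform => v.
by rewrite linearB /= (H _ (memv_proj W v)) subr0.
Qed.

Definition pure x := exists2 f, x = f%:F & theta (projv W) f = f%:P * 'X.

(** The linear part is the sum of its compositions with [1 - projv W] and [projv W]: the first,
    together with the constant, has weight 0, the second has weight 1. *)
Lemma espan_split V x : (V <= W)%VS -> espan V x ->
  exists h u, [/\ x = h + u, espan W h, espan V u & pure u].
Proof.
move=> VW [phi [c [H ->]]].
exists (lform b (phi \o (\1 - projv W))%VF + c%:MP)%:F, (lform b (phi \o projv W)%VF)%:F; split.
- rewrite -rmorphD addrAC -lformD; congr ((_ + _)%:F); apply: eq_lform => v.
  by rewrite !comp_lfunE add_lfunE opp_lfunE id_lfunE linearB /= subrK.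
- exists (phi \o (\1 - projv W))%VF, c; split=> // v vW.
  by rewrite comp_lfunE add_lfunE opp_lfunE id_lfunE projv_id // subrr linear0.
- exists (phi \o projv W)%VF, 0; split=> [v vV|]; last by rewrite mpolyC0 addr0.
  by rewrite comp_lfunE projv_id ?H // (subvP VW).
exists (lform b (phi \o projv W)%VF) => //; rewrite theta_lform //.
have -> : lform b (fun v => (phi \o projv W)%VF (v - projv W v)) = 0.
  rewrite /lform big1 // => j _.
  have E v : projv W (v - projv W v) = 0 by rewrite linearB /= projv_proj subrr.
  by rewrite comp_lfunE E linear0 scale0r.
rewrite add0r; congr (_%:P * _); apply: eq_lform => v.
by rewrite !comp_lfunE projv_id ?memv_proj.
Qed.

Lemma espan_val x : espan W x -> x != 0 -> val W x = 0.
Proof.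
move=> /espan_theta [f [-> tf]] f0; rewrite (val_poly bL _ iota_inj fracP).
  by rewrite /dir_deg tf size_polyC; case: eqP.
by apply: contraNneq f0 => ->; rewrite rmorph0.
Qed.

Lemma pure_val u : pure u -> u != 0 -> val W u = -1.
Proof.
move=> [f -> tf] f0; have nf : f != 0 by apply: contraNneq f0 => ->; rewrite rmorph0.
by rewrite (val_poly bL _ iota_inj fracP) // /dir_deg tf size_mulX ?polyC_eq0 // size_polyC nf.
Qed.

Lemma espan_valN x : espan 0%VS x -> ~ espan W x -> val W x = -1.
Proof.
move=> /(espan_split (sub0v _)) [h [u [-> Eh _ pu]]] nE.
have u0 : u != 0 by apply/eqP => u0; apply: nE; rewrite u0 addr0.
have hu : h + u != 0 by apply/eqP => E; apply: nE; rewrite E; exact: espan0.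
have vu := pure_val pu u0.
have [h0|h0] := eqVneq h 0; first by rewrite h0 add0r.
have vh := espan_val Eh h0.
have [H1 H2] : vge W (-1) (h + u) /\ ~~ vge W 0 (h + u); last first.
  by move: H1 H2; rewrite /dir_val_ge (negbTE hu) /=; lia.
split; first by apply: vgeD => //; rewrite /dir_val_ge ?vh ?vu ?orbT.
apply/negP => /(vgeB bL iota_inj) /(_ (_ : vge W 0 h)).
rewrite addrC addKr /dir_val_ge (negbTE u0) (negbTE h0) vh vu /=; by move=> /(_ isT).
Qed.

Lemma espan_weight0 x y : espan W x -> espan W y -> y != 0 -> weight0 W (x / y).
Proof.
move=> /espan_theta [f [-> tf]] /espan_theta [g [-> tg]] g0.
exists f, g; split=> //; first by apply: contraNneq g0 => ->; rewrite rmorph0.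
by rewrite tf tg.
Qed.

Lemma pure_weight0 x y : pure x -> pure y -> y != 0 -> weight0 W (x / y).
Proof.
move=> [f -> tf] [g -> tg] g0.
exists f, g; split=> //; first by apply: contraNneq g0 => ->; rewrite rmorph0.
by rewrite tf tg mulrAC mulrA.
Qed.

(** As linear forms on the sum of L and C, [x] and [u] have the same degree, and [u] does not vanish
    identically on P(W). *)
Lemma eta_ratio x u : espan 0%VS x -> espan 0%VS u -> ~ espan W u -> eta W (x / u).
Proof.
move=> [phi [c [_ ->]]] Eu nu; have vu := espan_valN Eu nu.
have u0 : u != 0 by apply/eqP => u0; apply: nu; rewrite u0; exact: espan0.
move: Eu vu u0 => [psi [d [_ ->]]]; set g := lform b psi + _ => vg g0F.
have g0 : g != 0 by apply: contraNneq g0F => ->; rewrite rmorph0.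
have aff (chi : 'Hom(L, C^o)) e : (dg \1%VF (lform b chi + e%:MP) <= 1)%N.
  by apply: dgD; [exact: dg_lform_le|rewrite dgC].
apply/etaP; exists (lform b phi + c%:MP), g, 1%N; split => //; try exact: aff.
by move: vg; rewrite (val_poly bL _ iota_inj fracP) //; case: (dir_deg _ _ _).
Qed.

(** It suffices to use the coordinates of [v - projv V v], which are equations of V. Evaluation at 0
    kills the constant, and evaluation at [w] in W then gives [w = projv V w]. *)
Lemma espan_le V : (forall x, espan V x -> espan W x) -> (W <= V)%VS.
Proof.
move=> H; apply/subvP => w wW.
suff : w - projv V w = 0 by move/eqP; rewrite subr_eq0 => /eqP ->; exact: memv_proj.
rewrite [LHS](coords_vec bL) big1 // => j _.
have [] := H (lform b (linfun (coord b j : L -> C^o) \o (\1 - projv V))%VF)%:F.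
  exists (linfun (coord b j : L -> C^o) \o (\1 - projv V))%VF, 0; split; last by rewrite mpolyC0 addr0.
  by move=> v vV; rewrite comp_lfunE add_lfunE opp_lfunE id_lfunE projv_id // subrr linear0.
move=> phi [c [phiW]] /iota_inj E.
have c0 : c = 0.
  have := congr1 (meval (coords 0)) E.
  by rewrite !mevalD !mevalC !(lform_eval bL) !linear0 !add0r.
have := congr1 (meval (coords w)) E.
rewrite !mevalD !mevalC !(lform_eval bL) (phiW _ wW) c0 !addr0 comp_lfunE lfunE /=.
by rewrite add_lfunE opp_lfunE id_lfunE => ->; rewrite scale0r.
Qed.

End Fixed.

(** [phi] after [addv_pi1 V W] vanishes on W, where [addv_pi2] is the identity; on V the rest of
    [phi] is [phi] after [addv_pi2], which maps V into the intersection. *)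
Lemma espan_cap W V x : espan (W :&: V)%VS x ->
  exists y z, [/\ espan W y, espan V z & x = y + z].
Proof.
move=> [phi [c [H ->]]].
exists (lform b (phi \o addv_pi1 V W)%VF)%:F, (lform b (phi - (phi \o addv_pi1 V W)%VF) + c%:MP)%:F.
split.
- exists (phi \o addv_pi1 V W)%VF, 0; split=> [v vW|]; last by rewrite mpolyC0 addr0.
  rewrite comp_lfunE; suff -> : addv_pi1 V W v = 0 by rewrite linear0.
  have vVW : v \in (V + W)%VS by rewrite (subvP (addvSr V W)).
  by have := addv_pi1_pi2 vVW; rewrite addv_pi2_id // => /(canRL (addrK _)); rewrite subrr.
- exists (phi - (phi \o addv_pi1 V W)%VF), c; split=> // v vV.
  have vVW : v \in (V + W)%VS by rewrite (subvP (addvSl V W)).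
  have E : addv_pi2 V W v = v - addv_pi1 V W v.
    by rewrite -{2}(addv_pi1_pi2 vVW) addrC addKr.
  rewrite add_lfunE opp_lfunE comp_lfunE; have := H (addv_pi2 V W v).
  by rewrite {2}E linearB; apply; rewrite memv_cap memv_pi2 E memvB ?memv_pi1.
rewrite -rmorphD addrA -lformD; congr ((_ + _)%:F); apply: eq_lform => v.
by rewrite add_lfunE opp_lfunE addrC subrK.
Qed.

End AffineForms.

(** * Charts of the iterated blow-ups *)

Section Charts.
Variables (C : numFieldType) (L : vectType C) (r : nat) (b : r.-tuple L).
Hypothesis bL : basis_of fullv b.
Variables (K : fieldType) (iota : {rmorphism {mpoly C[r]} -> K}).
Hypothesis iota_inj : injective iota.
Hypothesis fracP : forall x, exists p q : {mpoly C[r]}, q != 0 /\ x = iota p / iota q.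
Local Notation val W := (dir_val b (projv W) fracP).
Local Notation vge W := (dir_val_ge b (projv W) fracP).
Local Notation val_ring W := (dir_val_ring b (projv W) fracP).
Local Notation weight0 W := (weight0 b (projv W) iota).
Local Notation eta W := (eta b iota W).
Local Notation espan W := (espan b iota W).
Local Notation pure W := (pure b iota W).
Local Notation valM := (valM bL _ iota_inj fracP).
Local Notation valV := (valV bL _ iota_inj fracP).
Implicit Types (W V : {vspace L}) (A B : set K).

(* The local ring A of a point of an iterated blow-up is generated by the
   ratios [x / e], where [(V, e)] runs over the centers [P(V)] already blown up at
   that point (and [(0, e)], for the projective space itself) and [e] generates
   the pull-back of the ideal spanned by the affine forms constant along [V]. *)
Record chart A (S : set ({vspace L} * K)) V e : Prop := Chart {
  chart_local : is_local A;
  chart_last : S (V, e);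
  chart_mem : forall V' e', S (V', e') ->
    [/\ e' != 0, espan V' e', (V' <= V)%VS & forall x, espan V' x -> A (x / e')];
  chart_gen : generates
    [set g | exists V' e' x, [/\ S (V', e'), espan V' x & g = x / e']]%classic A }.

Section Center.
Variables (A : set K) (S : set ({vspace L} * K)) (V : {vspace L}) (e : K).
Hypothesis cA : chart A S V e.
Variable W : {vspace L}.
Hypothesis VW : (V <= W)%VS.

(** If [e] were an equation of P(W), regularity of all [y / e] along W would make every equation of
    P(V) one of P(W), hence W a subspace of V. So [e] has a pole along W, and a nonzero [x / e] has
    valuation 1, while [A] lies in the valuation ring. *)
Lemma chart_max : ~~ (W <= V)%VS -> (A `<=` eta W)%classic ->
  forall x, espan W x -> max_ideal A (x / e).
Proof.
move=> nWV Ae x Ex; have [e0 Ee _ AE] := chart_mem cA (chart_last cA).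
have ne : ~ espan W e.
  move=> We; move/negP: nWV; apply; apply: (espan_le bL iota_inj) => y Ey.
  apply: contrapT => nWy; have /Ae/(eta_sub_val bL iota_inj fracP) := AE y Ey.
  have y0 : y != 0 by apply/eqP => y0; apply: nWy; rewrite y0; exact: espan0.
  rewrite /dir_val_ring /= /dir_val_ge mulf_eq0 invr_eq0 (negbTE y0) (negbTE e0) /=.
  rewrite valM ?invr_eq0 // valV (espan_val bL iota_inj fracP We e0).
  by rewrite (espan_valN bL iota_inj fracP (espan_bot Ey) nWy).
have ve := espan_valN bL iota_inj fracP (espan_bot Ee) ne.
have Axe := AE x (espanS VW Ex).
split=> //; have [->|x0] := eqVneq x 0; first by left; rewrite mul0r.
right=> /Ae/(eta_sub_val bL iota_inj fracP).
rewrite /dir_val_ring /= /dir_val_ge invf_div mulf_eq0 invr_eq0 (negbTE x0) (negbTE e0) /=.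
by rewrite valM ?invr_eq0 // valV (espan_val bL iota_inj fracP Ex x0) ve.
Qed.

Hypothesis Wmax : forall x, espan W x -> max_ideal A (x / e).

(** With [x = h + u] and [e' = h1 + u1] split by weight, take [x0 = u / u1]. It lies in [A] because
    [u1 / e' = 1 - h1 / e'] is a unit, [h1 / e'] being a multiple of the nonunit [h1 / e]. *)
Lemma chart_term V' e' x : S (V', e') -> espan V' x ->
  exists x0 h h1, [/\ ~ espan W e', [/\ weight0 W x0, A x0 & eta W x0],
    espan W h /\ espan W h1, A (e / e') & x / e' = x0 + (h / e' - x0 * (h1 / e'))].
Proof.
move=> Se' Ex; have [e'0 Ee' V'V AE] := chart_mem cA Se'.
have [e0 Ee _ _] := chart_mem cA (chart_last cA).
have lA := chart_local cA; have sA := lA.1.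
have V'W : (V' <= W)%VS := subv_trans V'V VW.
have Aee' : A (e / e') by apply: AE; apply: espanS Ee.
have ne' : ~ espan W e'.
  move=> /Wmax; apply: max_ideal_unit; first by rewrite mulf_neq0 ?invr_eq0.
  by rewrite invf_div.
have [h1 [u1 [ee Eh1 Eu1 pu1]]] := espan_split bL V'W Ee'.
have [h [u [xe Eh Eu pu]]] := espan_split bL V'W Ex.
have u10 : u1 != 0 by apply/eqP => u10; apply: ne'; rewrite ee u10 addr0.
have nu1 : ~ espan W u1 by move=> H; apply: ne'; rewrite ee; apply: espanD.
have mh1 : max_ideal A (- (h1 / e')).
  apply: max_idealN => //.
  have -> : h1 / e' = (e / e') * (h1 / e) by field; rewrite ?e'0 ?e0.
  by apply: max_idealM => //; apply: Wmax.
have [||_] := unit_add_max lA (oner_neq0 _) _ _ mh1; rewrite ?invr1; try exact: (subring1 sA).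
have -> : 1 - h1 / e' = u1 / e' by rewrite ee; field; rewrite -?ee ?e'0.
rewrite invf_div => Aeu; exists (u / u1), h, h1; split => //.
  split; first exact: pure_weight0 pu pu1 u10.
    have -> : u / u1 = (u / e') * (e' / u1) by field; rewrite ?e'0 ?u10.
    by apply: subringM => //; apply: AE.
  exact: (eta_ratio bL iota_inj fracP (espan_bot Eu) (espan_bot Eu1) nu1).
by rewrite xe; move: e'0; rewrite ee => e'0; field; rewrite ?e'0 ?u10.
Qed.

(** The candidate for the ideal of the strict transform of P(W) at [A]; [chart_ideal] gives the
    nontrivial inclusion. *)
Definition center_ideal : set K := gen_ideal A [set x / e | x in espan W]%classic.

Lemma center_ideal_ideal : is_ideal A center_ideal.
Proof.
apply: gen_ideal_ideal; first by case: (chart_local cA).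
by move=> _ [x Ex <-]; case: (Wmax Ex).
Qed.

Hypothesis W0 : W != 0%VS.

Lemma max_eta_ratio e' x : espan 0%VS e' -> ~ espan W e' -> espan W x -> max_ideal (eta W) (x / e').
Proof.
move=> Ee' ne' Ex; apply/(eta_max bL iota_inj fracP); split.
  exact: (eta_ratio bL iota_inj fracP (espan_bot Ex) Ee' ne').
have e'0 : e' != 0 by apply/eqP => E; apply: ne'; rewrite E; exact: espan0.
rewrite /dir_val_ge mulf_eq0 invr_eq0 (negbTE e'0) orbF; case: eqVneq => //= x0.
by rewrite valM ?invr_eq0 // valV (espan_val bL iota_inj fracP Ex x0) (espan_valN bL iota_inj fracP Ee' ne').
Qed.

Lemma chart_split x : A x -> eta W x /\ exists x0,
  [/\ weight0 W x0, A x0, eta W x0, center_ideal (x - x0) & max_ideal (eta W) (x - x0)].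
Proof.
have lA := chart_local cA; have sA := lA.1; have lE := eta_local bL iota_inj W0.
have iQ := center_ideal_ideal; have [_ _ QD QM] := iQ.
have [_ _ mD mM] := max_ideal_ideal lE.
apply: (split_local lA lE) => //; [exact: (weight0_subring b _ iota_inj)|exact: (weight0V iota_inj)| | | exact: chart_gen cA|].
- move=> y wy /(eta_max bL iota_inj fracP) [_]; rewrite /dir_val_ge (weight0_val bL iota_inj fracP wy) orbF.
  by move/eqP.
- move=> y; apply; first exact: max_ideal_ideal.
  by move=> _ [z Ez <-]; apply: Wmax.
move=> _ [V' [e' [z [Se' Ez ->]]]].
have [e'0 Ee' _ AE] := chart_mem cA Se'.
have [x0 [h [h1 [ne' [wx0 Ax0 ex0] [Eh Eh1] Aee E]]]] := chart_term Se' Ez.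
have e0 : e != 0 by case: (chart_mem cA (chart_last cA)).
have Qh w : espan W w -> center_ideal (w / e').
  move=> Ew; have -> : w / e' = (e / e') * (w / e) by field; rewrite ?e'0 ?e0.
  by apply: QM => //; apply: sub_gen_ideal; exists w.
split; [exact: AE|exact: (eta_ratio bL iota_inj fracP (espan_bot Ez) (espan_bot Ee') ne')|].
exists x0; split=> //; rewrite E addrC addKr -mulNr.
- apply: QD; [exact: Qh|apply: QM; [exact: (subringN sA)|exact: Qh]].
- apply: mD; [|apply: mM; first exact: (subringN lE.1)].
  all: apply: max_eta_ratio => //; exact: espan_bot Ee'.
Qed.

(** A converse to [chart_max]: where all [x / e] are nonunits, the point lies on the strict
    transform of P(W). It is later applied to the intersection of two centers. *)
Lemma chart_eta : (A `<=` eta W)%classic.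
Proof. by move=> x /chart_split []. Qed.

(** Modulo the center ideal [x] has weight zero, and a nonzero element of weight zero has valuation
    0, so it cannot lie in the maximal ideal of [eta W]. *)
Lemma chart_ideal x : A x -> max_ideal (eta W) x -> center_ideal x.
Proof.
move=> /chart_split [_ [x0 [wx0 _ _ Qx mx]]] ex.
have lE := eta_local bL iota_inj W0; have [_ _ mD mM] := max_ideal_ideal lE.
have : max_ideal (eta W) x0.
  by rewrite -[x0](subKr x); apply: mD => //; apply: max_idealN.
move=> /(eta_max bL iota_inj fracP) [_]; rewrite /dir_val_ge (weight0_val bL iota_inj fracP wx0) orbF.
by move=> /eqP x00; rewrite x00 subr0 in Qx.
Qed.

End Center.
End Charts.

(** * One blow-up step in a chart *)

Section BlowupStep.
Variables (C : numFieldType) (L : vectType C) (r : nat) (b : r.-tuple L).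
Hypothesis bL : basis_of fullv b.
Variables (K : fieldType) (iota : {rmorphism {mpoly C[r]} -> K}).
Hypothesis iota_inj : injective iota.
Hypothesis fracP : forall x, exists p q : {mpoly C[r]}, q != 0 /\ x = iota p / iota q.
Local Notation val W := (dir_val b (projv W) fracP).
Local Notation vge W := (dir_val_ge b (projv W) fracP).
Local Notation val_ring W := (dir_val_ring b (projv W) fracP).
Local Notation weight0 W := (weight0 b (projv W) iota).
Local Notation eta W := (eta b iota W).
Local Notation espan W := (espan b iota W).
Local Notation chart := (chart b iota).
Local Notation valM := (valM bL _ iota_inj fracP).
Local Notation valV := (valV bL _ iota_inj fracP).
Implicit Types (W V : {vspace L}) (A B : set K).

Section Step.
Variables (A : set K) (S : set ({vspace L} * K)) (V : {vspace L}) (e : K).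
Hypothesis cA : chart A S V e.
Variable W : {vspace L}.
Hypotheses (VW : (V <= W)%VS) (nWV : ~~ (W <= V)%VS) (W0 : W != 0%VS)
  (Ae : (A `<=` eta W)%classic).
Variables (a : K) (P : set K).
Local Notation I := (ideal_stalk (eta W) A).
Local Notation R := (adjoin A [set x / a | x in I]%classic).
Hypotheses (Ia : I a) (a0 : a != 0) (pP : is_prime_ideal R P)
  (PA : (P `&` A = max_ideal A)%classic).
Local Notation B := (localization R P).

Let lA := chart_local cA.
Let sA : is_subring A := lA.1.
Let Wmax := chart_max bL iota_inj fracP cA VW nWV Ae.
Let lE := eta_local bL iota_inj W0.

Let sR : is_subring R. Proof. exact: adjoin_subring. Qed.

Lemma step_local : is_local B.
Proof. exact: loc_local. Qed.

Let sB : is_subring B := step_local.1.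

Lemma step_sub : (A `<=` B)%classic.
Proof. by move=> x Ax; apply: loc_sub => //; apply: adjoin_base. Qed.

Lemma step_dom x : max_ideal A x -> max_ideal B x.
Proof.
move=> mx; apply/loc_max => //; first by apply: adjoin_base; case: mx.
by move: mx; rewrite -PA => -[].
Qed.

Let ne : ~ espan W e.
Proof.
have [e0 Ee _ _] := chart_mem cA (chart_last cA).
by have [? [? [? []]]] := chart_term bL iota_inj fracP cA VW Wmax (chart_last cA) Ee.
Qed.

Lemma step_gen x : espan W x -> B (x / e / a).
Proof.
move=> Ex; apply: loc_sub => //; apply: adjoin_gen; exists (x / e) => //.
split; first by case: (Wmax Ex).
move=> _; have [_ Ee _ _] := chart_mem cA (chart_last cA).
exact: (max_eta_ratio bL iota_inj fracP (espan_bot Ee)).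
Qed.

Lemma step_ideal x : I x -> center_ideal b iota A e W x.
Proof.
by move=> [Ax /(_ Ae) mx]; apply: (chart_ideal bL iota_inj fracP cA VW Wmax W0 Ax mx).
Qed.

(** Otherwise all generators of the ideal, divided by [a], would lie in the maximal ideal of [B],
    and with them [a / a = 1]. The [z] found here makes [z / e] a local equation of the exceptional
    divisor. *)
Lemma step_choice : exists z, espan W z /\ ~ max_ideal B (z / e / a).
Proof.
apply: contrapT => H.
have {}H z : espan W z -> max_ideal B (z / e / a).
  by move=> Ez; apply: contrapT => nz; apply: H; exists z.
have := step_ideal Ia => /(_ [set x | A x /\ max_ideal B (x / a)]%classic) [].
- have [_ m0 mD mM] := max_ideal_ideal step_local.
  split; first by move=> x [].
  + by split; rewrite ?mul0r; [exact: subring0|].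
  + move=> x y [Ax mx] [Ay my]; split; first exact: subringD.
    by rewrite mulrDl; apply: mD.
  + move=> c x Ac [Ax mx]; split; first exact: subringM.
    by rewrite -mulrA; apply: mM => //; apply: step_sub.
- by move=> _ [z Ez <-]; split; [case: (Wmax Ez)|apply: H].
by move=> _; rewrite divff //; apply: max_ideal1.
Qed.

Section Chosen.
Variable z : K.
Hypotheses (Ez : espan W z) (nz : ~ max_ideal B (z / e / a)).

Let e0 : e != 0. Proof. by case: (chart_mem cA (chart_last cA)). Qed.

Lemma chosen_neq0 : z != 0.
Proof. by apply/eqP => z0; apply: nz; rewrite z0 !mul0r; apply: max_ideal0. Qed.

Let z0 := chosen_neq0.

Let Bu : B (z / e / a)^-1.
Proof. by case: (nmax_ideal (step_gen Ez) nz). Qed.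

Definition add_center : set ({vspace L} * K) := [set s | S s \/ s = (W, z)]%classic.

(** The new ratios [x / z] describe the ideal divided by [z / e], whereas the blow-up divides it by
    [a]; the two differ by the unit [z / e / a]. *)
Lemma step_chart : chart B add_center W z.
Proof.
have memz x : espan W x -> B (x / z).
  move=> Ex; have -> : x / z = (x / e / a) * (z / e / a)^-1.
    by field; rewrite ?z0 ?e0 ?a0.
  by apply: subringM => //; apply: step_gen.
split; [exact: step_local|by right| |].
- move=> V' e' [Se'|[-> ->]]; last by split=> //.
  have [e'0 Ee' V'V AE] := chart_mem cA Se'; split=> //; first exact: subv_trans V'V VW.
  by move=> x Ex; apply/step_sub/AE.
move=> D sD TD DV.
have AD : (A `<=` D)%classic.
  apply: (chart_gen cA) => // [g [V' [e' [x [Se' Ex ->]]]]|x Dx x0 AVx].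
    by apply: TD; exists V', e', x; split=> //; left.
  by apply: DV => //; apply: step_sub.
have ID x : I x -> D (x / (z / e)).
  move=> Ix; have /(_ [set x | A x /\ D (x / (z / e))]%classic) [] := step_ideal Ix => //.
  - split; first by move=> y [].
    + by split; rewrite ?mul0r; exact: subring0.
    + move=> y t [Ay Dy] [At Dt]; split; first exact: subringD.
      by rewrite mulrDl; apply: subringD.
    + move=> c y Ac [Ay Dy]; split; first exact: subringM.
      by rewrite -mulrA; apply: subringM => //; apply: AD.
  - move=> _ [y Ey <-]; split; first by case: (Wmax Ey).
    have -> : y / e / (z / e) = y / z by field; rewrite ?z0 ?e0.
    by apply: TD; exists W, z, y; split=> //; right.
(* Only the inverse [a / (z / e)] is visibly in [D]; it is a unit of [B], so [D] may invert it. *)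
have Du : D (z / e / a).
  rewrite -[_ / a]invrK invf_div; apply: DV.
  - exact: ID.
  - by rewrite ?(mulf_neq0, invr_neq0).
  - by rewrite invf_div; exact: step_gen.
have RD : (R `<=` D)%classic.
  move=> x; apply=> // _ [y Iy <-].
  have -> : y / a = (y / (z / e)) * (z / e / a) by field; rewrite ?z0 ?e0 ?a0.
  by apply: subringM => //; apply: ID.
move=> _ [x [y [Rx Ry nPy ->]]]; apply: (subringM sD); first exact: RD.
apply: DV; [exact: RD|exact: (prime_nzero pP nPy)|exact: loc_inv].
Qed.

(** Supplies the element of valuation 1 that [is_ord_val] asks for. *)
Lemma step_unif : max_ideal B (z / e) /\ val W (z / e) = 1.
Proof.
split; first exact/step_dom/Wmax.
have [_ Ee _ _] := chart_mem cA (chart_last cA).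
by rewrite valM ?invr_eq0 // valV (espan_val bL iota_inj fracP Ez z0)
  (espan_valN bL iota_inj fracP (espan_bot Ee) ne).
Qed.

(* B is generated by elements of weight zero and multiples of w = z / e, and a
   nonzero element of weight zero has valuation zero. *)
Lemma step_val : (B `<=` val_ring W)%classic.
Proof.
have [mw vw] := step_unif; set w := z / e in mw vw.
have lO := val_local bL (projv W) iota_inj fracP; have sO := lO.1.
have Bw : B w by case: mw.
have vmax := val_max bL (projv W) iota_inj fracP.
have w0O x : weight0 W x -> val_ring W x.
  by move=> /(weight0_val bL iota_inj fracP) vx; rewrite /dir_val_ring /= /dir_val_ge vx orbT.
suff : forall x, B x -> val_ring W x /\ exists x0,
    [/\ weight0 W x0, B x0, val_ring W x0, (exists2 c, B c & x - x0 = w * c) & max_ideal (val_ring W) (x - x0)].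
  by move=> H x /H [].
apply: (split_local step_local lO (weight0_subring b (projv W) iota_inj) (weight0V iota_inj) _
  (Q := [set x | exists2 c, B c & x = w * c]%classic) _ _ (chart_gen step_chart)).
- move=> x wx /vmax; rewrite /dir_val_ge (weight0_val bL iota_inj fracP wx) orbF.
  by move/eqP.
- split.
  + by move=> _ [c Bc ->]; apply: subringM.
  + by exists 0; rewrite ?mulr0 //; exact: subring0.
  + by move=> _ _ [c Bc ->] [d Bd ->]; exists (c + d); rewrite ?mulrDr //; apply: subringD.
  + by move=> c _ Bc [d Bd ->]; exists (c * d); [apply: subringM|rewrite mulrCA].
- by move=> _ [c Bc ->]; rewrite mulrC; apply: max_idealM.
move=> _ [V' [e' [x [[Se'|[-> ->]] Ex ->]]]]; last first.
  have wxz := espan_weight0 bL Ex Ez z0.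
  have [_ _ _ BE] := chart_mem step_chart (chart_last step_chart).
  split; [exact: BE|exact: w0O|exists (x / z); rewrite subrr; split=> //].
  - exact: BE.
  - exact: w0O.
  - by exists 0; rewrite ?mulr0 //; exact: subring0.
  - exact: max_ideal0.
have [e'0 Ee' _ AE] := chart_mem cA Se'.
have [x0 [h [h1 [ne' [wx0 Ax0 ex0] [Eh Eh1] Aee E]]]] := chart_term bL iota_inj fracP cA VW Wmax Se' Ex.
have Qh y : espan W y -> exists2 c, B c & y / e' = w * c.
  move=> Ey; exists ((y / z) * (e / e')); last by rewrite /w; field; rewrite ?z0 ?e0 ?e'0.
  apply: subringM => //; last exact: step_sub.
  by have [_ _ _ BE] := chart_mem step_chart (chart_last step_chart); apply: BE.
have mh y : espan W y -> max_ideal (val_ring W) (y / e').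
  move=> Ey; apply/vmax.
  by have /(eta_max bL iota_inj fracP) [] := max_eta_ratio bL iota_inj fracP (espan_bot Ee') ne' Ey.
split; [exact/step_sub/AE|exact/(eta_sub_val bL iota_inj fracP)/Ae/AE|].
exists x0; split => //; [exact: step_sub|exact: w0O| |].
- have [c Bc Ec] := Qh _ Eh; have [d Bd Ed] := Qh _ Eh1.
  exists (c - x0 * d); last by rewrite E Ec Ed; ring.
  by apply: subringB => //; apply: subringM => //; apply: step_sub.
- have [_ _ mD mM] := max_ideal_ideal lO.
  rewrite E addrC addKr -mulNr; apply: mD; first exact: mh.
  by apply: mM; [apply: (subringN sO); exact: w0O|exact: mh].
Qed.

End Chosen.

Lemma step_exists : exists S' z, chart B S' W z /\
  (forall s, S' s -> S s \/ s = (W, z)) /\ (B `<=` val_ring W)%classic /\ exists2 w, B w & val W w = 1.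
Proof.
have [z [Ez nz]] := step_choice.
exists (add_center z), z; split; first exact: step_chart.
split=> //; split; first exact: step_val nz.
by have [[Bw _] vw] := step_unif Ez nz; exists (z / e).
Qed.

End Step.
End BlowupStep.

(** * Separatedness in terms of domination *)

Section Separated.
Variable K : fieldType.
Implicit Types (A B O : set K) (X : set (set K)).

Lemma dominates_refl A : dominates A A. Proof. by split. Qed.

Lemma dominates_trans A B O : dominates O B -> dominates B A -> dominates O A.
Proof. by move=> [BO mBO] [AB mAB]; split=> x ?; [apply/BO/AB|apply/mBO/mAB]. Qed.

Lemma dominates_unit A O x : dominates O A -> A x -> x != 0 -> O x^-1 -> A x^-1.
Proof.
move=> [AO mAO] Ax x0 OVx; apply: contrapT => nA.
by apply: (max_ideal_unit x0 OVx); apply: mAO; split => //; right.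
Qed.

(** Uniqueness of centers as in the valuative criterion, but for all local subrings [O]. *)
Definition separated X := forall A B O, X A -> X B -> is_local O ->
  dominates O A -> dominates O B -> A = B.

Lemma blowup_dominates X eta A a P : is_local A ->
  let R := adjoin A [set x / a | x in ideal_stalk eta A]%classic in
  is_prime_ideal R P -> (P `&` A = max_ideal A)%classic -> dominates (localization R P) A.
Proof.
move=> lA R pP PA; have sR : is_subring R by exact: adjoin_subring.
split=> x; first by move=> Ax; apply: loc_sub => //; apply: adjoin_base.
move=> mx; apply/loc_max => //; first by apply: adjoin_base; case: mx.
by move: mx; rewrite -PA => -[].
Qed.

(** Both points lie over the same [A], so only the denominators [a1] and [a2] differ. Their
    quotients lie in [O], and domination makes them units of either local ring, so each chart is
    contained in the other local ring. *)
Lemma blowup_separated X eta : (forall A, X A -> is_local A) -> separated X ->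
  separated (blowup X eta).
Proof.
move=> lX sX.
have half A a1 P1 a2 P2 O : is_local A -> is_local O ->
    let I := ideal_stalk eta A in
    let R1 := adjoin A [set x / a1 | x in I]%classic in
    let R2 := adjoin A [set x / a2 | x in I]%classic in
    I a1 -> I a2 -> a1 != 0 -> a2 != 0 -> is_prime_ideal R1 P1 -> is_prime_ideal R2 P2 ->
    dominates O (localization R1 P1) -> dominates O (localization R2 P2) ->
    (localization R2 P2 `<=` localization R1 P1)%classic.
  move=> lA lO I R1 R2 I1 I2 a10 a20 pP1 pP2 d1 d2.
  have sR1 : is_subring R1 by exact: adjoin_subring.
  have sR2 : is_subring R2 by exact: adjoin_subring.
  have sB1 := loc_subring sR1 pP1.
  have B1a : localization R1 P1 (a2 / a1).
    by apply: loc_sub => //; apply: adjoin_gen; exists a2.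
  have B1V : localization R1 P1 (a1 / a2).
    rewrite -[a1 / a2]invf_div; apply: (dominates_unit d1 B1a); first by rewrite mulf_neq0 ?invr_neq0.
    by rewrite invf_div; apply: d2.1; apply: loc_sub => //; apply: adjoin_gen; exists a1.
  have R2B1 : (R2 `<=` localization R1 P1)%classic.
    move=> x; apply => // [y Ay|_ [y Iy <-]]; first by apply: loc_sub => //; apply: adjoin_base.
    have -> : y / a2 = (y / a1) * (a1 / a2) by field; rewrite ?a10 ?a20.
    by apply: subringM => //; apply: loc_sub => //; apply: adjoin_gen; exists y.
  move=> _ [x [y [R2x R2y nPy ->]]]; apply: (subringM sB1); first exact: R2B1.
  apply: (dominates_unit d1); [exact: R2B1|exact: (prime_nzero pP2)|].
  by apply: d2.1; apply: loc_inv.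
move=> B1 B2 O [A1 [a1 [P1 /= [X1 [I1 a10] pP1 PA1 E1]]]] [A2 [a2 [P2 /= [X2 [I2 a20] pP2 PA2 E2]]]] lO d1 d2.
have D1 := blowup_dominates X (lX _ X1) pP1 PA1; rewrite -E1 in D1.
have D2 := blowup_dominates X (lX _ X2) pP2 PA2; rewrite -E2 in D2.
have EA := sX _ _ _ X1 X2 lO (dominates_trans d1 D1) (dominates_trans d2 D2).
move: EA X2 I2 pP2 PA2 E2 {D2} => <- {A2} X2 I2 pP2 PA2 E2.
by rewrite E1 E2 in d1 d2 *; apply/seteqP; split; [apply: (half _ _ _ _ _ O)|apply: (half _ _ _ _ _ O)] => //; exact: lX.
Qed.

End Separated.

(** * Projective space and its successive blow-ups *)

Section BlowupsOfProjectiveSpace.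
Variables (C : numFieldType) (L : vectType C) (r : nat) (b : r.-tuple L).
Hypothesis bL : basis_of fullv b.
Variables (K : fieldType) (iota : {rmorphism {mpoly C[r]} -> K}).
Hypothesis iota_inj : injective iota.
Hypothesis fracP : forall x, exists p q : {mpoly C[r]}, q != 0 /\ x = iota p / iota q.
Local Notation "p %:F" := (iota p) (at level 1).
Local Notation val W := (dir_val b (projv W) fracP).
Local Notation vge W := (dir_val_ge b (projv W) fracP).
Local Notation val_ring W := (dir_val_ring b (projv W) fracP).
Local Notation eta W := (eta b iota W).
Local Notation espan W := (espan b iota W).
Local Notation chart := (chart b iota).
Local Notation valM := (valM bL _ iota_inj fracP).
Local Notation valV := (valV bL _ iota_inj fracP).
Local Notation stalk := (stalk iota).
Implicit Types (W V H : {vspace L}) (A B D : set K).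

(** The component of degree [k] divided by [w ^+ k] is a polynomial in the given elements, and
    [w^-1] supplies the missing [d - k] factors. Used with the identity on projective space and with
    the projection to a center in its blow-up. *)
Lemma div_pow_mem D w (pi : 'End(L)) f d : is_subring D -> w != 0 ->
  (forall c, D (c%:MP)%:F) -> D w^-1 ->
  (forall j, D (lform b (fun v => coord b j (v - pi v)))%:F) ->
  (forall j, D ((lform b (fun v => coord b j (pi v)))%:F / w)) ->
  (dir_deg b pi f <= d)%N -> D (f%:F / w ^+ d).
Proof.
move=> sD w0 DC Dw Da Db; rewrite -size_theta => szf.
have coefD k : D (((dilate b pi f)`_k)%:F / w ^+ k).
  apply: (@subst_coef _ _ _ _ _ (fun k g => D (g%:F / w ^+ k))) => [c|i|i p q Dp Dq|i j p q Dp Dq|j|j].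
  - by rewrite expr0 divr1.
  - by rewrite rmorph0 mul0r; exact: subring0.
  - by rewrite rmorphD mulrDl; apply: subringD.
  - by rewrite rmorphM exprD invfM mulrACA; apply: subringM.
  - by rewrite expr0 divr1.
  - by rewrite expr1.
rewrite {1}[f](theta_sum bL szf) rmorph_sum mulr_suml; apply: subring_sum => // k _.
rewrite -{2}(subnKC (leq_ord k)) exprD invfM mulrA; apply: subringM => //.
by rewrite -exprVn; apply: subringX.
Qed.

Definition proj_points : set (set K) :=
  [set A | exists P, [/\ is_prime_ideal [set: {mpoly C[r.+1]}]%classic P,
                         homogeneous_ideal P, exists i, ~ P 'X_i & A = stalk P]]%classic.

Lemma proj_points_local A : proj_points A -> is_local A.
Proof. by move=> [P [pP _ _ ->]]; apply: stalk_local. Qed.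

Lemma homogX (i : 'I_r.+1) : ('X_i : {mpoly C[r.+1]}) \is 1.-homog for mdeg.
Proof. by rewrite dhomogX /= mdeg1. Qed.

Lemma homogXn (i : 'I_r.+1) d : ('X_i ^+ d : {mpoly C[r.+1]}) \is d.-homog for mdeg.
Proof. by have := dhomogMn d (homogX i); rewrite mul1n. Qed.

Lemma prime_notinX P (i : 'I_r.+1) d :
  is_prime_ideal [set: {mpoly C[r.+1]}]%classic P -> ~ P 'X_i -> ~ P ('X_i ^+ d).
Proof.
move=> pP ni; elim: d => [|d IH]; first by rewrite expr0; case: pP.
by rewrite exprS; apply: prime_notinM.
Qed.

Lemma proj_points_separated : separated proj_points.
Proof.
suff half P Q i j O : is_prime_ideal [set: {mpoly C[r.+1]}]%classic P ->
    is_prime_ideal [set: {mpoly C[r.+1]}]%classic Q -> ~ P 'X_i -> ~ Q 'X_j ->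
    dominates O (stalk P) -> dominates O (stalk Q) -> (stalk Q `<=` stalk P)%classic.
  move=> _ _ O [P [pP _ [i Pi] ->]] [Q [pQ _ [j Qj] ->]] lO dP dQ.
  by apply/seteqP; split; [apply: (half Q P j i O)|apply: (half P Q i j O)].
move=> pP pQ Pi Qj dP dQ.
have nz R k : is_prime_ideal [set: {mpoly C[r.+1]}]%classic R -> ~ R 'X_k -> (dehom 'X_k)%:F != 0.
  by move=> pR; apply: (homog_dehom_neq0 iota_inj pR (homogX k)).
(* If ['X_j] vanished at the first point, [X_j / X_i] would be a nonunit of [O], while its inverse
   is regular at the second point. *)
have Pj : ~ P 'X_j.
  move=> Pj; have [_] := stalk_max iota_inj pP (homogX j) (homogX i) Pi.
  move=> /(_ Pj) /dP.2; apply: max_ideal_unit.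
    by rewrite mulf_neq0 ?invr_neq0 ?(nz P i) ?(nz Q j).
  by rewrite invf_div; apply: dQ.1; exists 1%N, 'X_i, 'X_j; split; rewrite ?homogX.
move=> _ [d [p [q [hp hq nq ->]]]].
have Pjd := prime_notinX (d := d) pP Pj; have Qjd := prime_notinX (d := d) pQ Qj.
have q0 := homog_dehom_neq0 iota_inj pQ hq nq.
have j0 := homog_dehom_neq0 iota_inj pQ (homogXn j d) Qjd.
have -> : (dehom p)%:F / (dehom q)%:F =
    ((dehom p)%:F / (dehom ('X_j ^+ d))%:F) * ((dehom q)%:F / (dehom ('X_j ^+ d))%:F)^-1.
  by field; rewrite ?q0 ?j0.
apply: (subringM (stalk_subring iota_inj pP)); first by exists d, p, ('X_j ^+ d); rewrite homogXn.
apply: (dominates_unit dP); first by exists d, q, ('X_j ^+ d); rewrite homogXn.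
  by rewrite mulf_neq0 ?invr_neq0.
by rewrite invf_div; apply: dQ.1; exists d, ('X_j ^+ d), q; rewrite homogXn.
Qed.

Definition blowups (ws : seq {vspace L}) : set (set K) :=
  foldl (fun X W => blowup X (eta W)) proj_points ws.

Lemma blowups_rcons ws W : blowups (rcons ws W) = blowup (blowups ws) (eta W).
Proof. by rewrite /blowups foldl_rcons. Qed.

Lemma blowups_local ws A : blowups ws A -> is_local A.
Proof.
elim/last_ind: ws => [|ws W _]; first exact: proj_points_local.
by rewrite blowups_rcons; apply: blowup_local.
Qed.

Lemma blowups_separated ws : separated (blowups ws).
Proof.
elim/last_ind: ws => [|ws W IH]; first exact: proj_points_separated.
by rewrite blowups_rcons; apply: blowup_separated => // A; apply: blowups_local.
Qed.

Lemma affine_sub P : is_prime_ideal [set: {mpoly C[r.+1]}]%classic P -> ~ P 'X_ord_max ->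
  forall f, stalk P f%:F.
Proof.
move=> pP Pt; have sP := stalk_subring iota_inj pP.
elim/mpoly_ring_ind => [c|j|p q Hp Hq|p q Hp Hq].
- exact: stalk_const.
- exists 1%N, 'X_(lift ord_max j), 'X_ord_max; split; rewrite ?homogX //.
  by rewrite !dehomX liftK unlift_none rmorph1 divr1.
- by rewrite rmorphD; apply: subringD.
- by rewrite rmorphM; apply: subringM.
Qed.

(** An affine form that is not constant along W is a polynomial with a pole along W, so no point of
    L lies on a strict transform. *)
Lemma affine_not_eta A W : W != 0%VS -> (forall f, A f%:F) -> ~ (A `<=` eta W)%classic.
Proof.
move=> W0 Af Ae; move/negP: W0; apply; rewrite -subv0; apply: (espan_le bL iota_inj).
move=> x Ex; apply: contrapT => nW; have vx := espan_valN bL iota_inj fracP Ex nW.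
have [phi [c [_ xE]]] := Ex.
have /orP [/eqP x0|] : vge W 0 x by rewrite xE; apply/(eta_sub_val bL iota_inj fracP)/Ae/Af.
  by apply: nW; rewrite x0; exact: espan0.
by rewrite vx.
Qed.

Lemma proj_chart A H : proj_points A -> H != 0%VS -> (A `<=` eta H)%classic ->
  exists S e, chart A S 0%VS e.
Proof.
move=> [P [pP _ [i Pi] ->]] H0 Ae.
(* If the last coordinate were invertible, the point would belong to L and could not lie on P(H); so
   a coordinate of L serves as denominator. *)
have [j iE] : exists j, i = lift ord_max j.
  case: (unliftP ord_max i) => [j ->|iE]; first by exists j.
  by move: Pi; rewrite iE => /(affine_sub pP) Af; case: (affine_not_eta H0 Af).
rewrite {}iE in Pi; set w := ('X_j)%:F.
have dX : dehom 'X_(lift ord_max j) = 'X_j :> {mpoly C[r]} by rewrite dehomX liftK.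
have w0 : w != 0 by rewrite /w -dX; apply: homog_dehom_neq0 Pi => //; exact: homogX.
have sP := stalk_subring iota_inj pP.
have Ew : espan 0%VS w by apply: (espan_coord bL); exists j.
exists [set s | s = (0%VS, w)]%classic, w; split => //; first exact: stalk_local.
  move=> _ _ [-> ->]; split=> // _ [phi [c [_ ->]]].
  have memX k : stalk P (('X_k)%:F / w).
    exists 1%N, 'X_(lift ord_max k), 'X_(lift ord_max j); rewrite !homogX; split=> //.
    by rewrite dX dehomX liftK.
  have mem1 : stalk P w^-1.
    exists 1%N, 'X_ord_max, 'X_(lift ord_max j); rewrite !homogX; split=> //.
    by rewrite dX dehomX unlift_none rmorph1 div1r.
  rewrite rmorphD mulrDl; apply: subringD => //; last by apply: subringM => //; exact: stalk_const.
  rewrite rmorph_sum mulr_suml; apply: subring_sum => // k _.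
  by rewrite -mul_mpolyC rmorphM -mulrA; apply: subringM => //; exact: stalk_const.
move=> D sD TD DV.
have DE x : espan 0%VS x -> D (x / w) by move=> Ex; apply: TD; exists 0%VS, w, x.
have Dp d p : p \is d.-homog for mdeg -> D ((dehom p)%:F / w ^+ d).
  move=> hp; apply: (@div_pow_mem D w \1%VF) => //.
  - by move=> c; rewrite -[_%:F](mulfK w0); apply/DE/espanZ.
  - by rewrite -div1r; apply/DE/espan1.
  - move=> k; rewrite /lform big1 ?rmorph0; first exact: subring0.
    by move=> m _; rewrite id_lfunE subrr linear0 scale0r.
  - move=> k; apply: DE; apply: (espan_coord bL); exists k.
    by rewrite -(lform_dual bL); congr (_%:F); apply: eq_lform => v; rewrite id_lfunE.
  - exact: dg_dehom hp.
move=> _ [d [p [q [hp hq nq ->]]]].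
have q0 := homog_dehom_neq0 iota_inj pP hq nq.
have -> : (dehom p)%:F / (dehom q)%:F = ((dehom p)%:F / w ^+ d) * ((dehom q)%:F / w ^+ d)^-1.
  by field; rewrite ?q0 ?expf_neq0.
apply: subringM => //; first exact: Dp.
apply: DV; [exact: Dp|by rewrite mulf_neq0 ?invr_neq0 ?expf_neq0|].
rewrite invf_div; exists d, ('X_(lift ord_max j) ^+ d), q; rewrite homogXn; split=> //.
by rewrite /w -dX -rmorphXn; congr (_%:F / _); rewrite /dehom rmorphXn.
Qed.

(** Once P(W) is blown up, one equation [z] divides all the others; this shows that no point over
    the center still lies on P(W). Some equation has total degree 1, so [z] cannot be constant; nor
    can it have degree 1, since [1 / z] would be a unit of [eta W] although [z] has a pole at
    infinity. *)
Lemma eta_not_all W z : W != fullv -> espan W z -> z != 0 ->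
  ~ forall x, espan W x -> eta W (x / z).
Proof.
move=> Wf Ez z0 H.
have [x [Ex nx]] : exists x, espan W x /\ ~ espan fullv x.
  apply: contrapT => nex; move/negP: Wf; apply; rewrite eqEsubv subvf /=; apply: (espan_le bL iota_inj).
  by move=> x Ex; apply: contrapT => nx; apply: nex; exists x.
have vx := espan_valN bL iota_inj fracP (espan_bot Ex) nx.
have x0 : x != 0 by apply/eqP => E; apply: nx; rewrite E; exact: espan0.
have tot y : eta W y -> y != 0 -> 0 <= val fullv y.
  by move=> /(eta_sub_total bL iota_inj fracP) + y0; rewrite /dir_val_ring /= /dir_val_ge (negbTE y0).
have [Efz|nfz] := pselect (espan fullv z).
  have := tot _ (H x Ex); rewrite mulf_neq0 ?invr_neq0 // => /(_ isT).
  by rewrite valM ?invr_neq0 // valV vx (espan_val bL iota_inj fracP Efz z0).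
have := eta_inv (fracP := fracP) bL iota_inj (H 1 (espan1 b iota W)).
rewrite div1r invr_neq0 // valV (espan_val bL iota_inj fracP Ez z0) oppr0 invrK => /(_ isT erefl).
by move=> /tot /(_ z0); rewrite (espan_valN bL iota_inj fracP (espan_bot Ez) nfz).
Qed.

End BlowupsOfProjectiveSpace.

(** * Exceptional divisors *)

Section BlowupSequence.
Variables (C : numFieldType) (L : vectType C) (r : nat) (b : r.-tuple L).
Hypothesis bL : basis_of fullv b.
Variables (K : fieldType) (iota : {rmorphism {mpoly C[r]} -> K}).
Hypothesis iota_inj : injective iota.
Hypothesis fracP : forall x, exists p q : {mpoly C[r]}, q != 0 /\ x = iota p / iota q.
Local Notation "p %:F" := (iota p) (at level 1).
Local Notation val W := (dir_val b (projv W) fracP).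
Local Notation vge W := (dir_val_ge b (projv W) fracP).
Local Notation val_ring W := (dir_val_ring b (projv W) fracP).
Local Notation eta W := (eta b iota W).
Local Notation espan W := (espan b iota W).
Local Notation chart := (chart b iota).
Local Notation blowups := (blowups b iota).
Local Notation valM := (valM bL _ iota_inj fracP).
Local Notation valV := (valV bL _ iota_inj fracP).
Local Notation espan_val := (espan_val bL iota_inj fracP).
Local Notation espan_valN := (espan_valN bL iota_inj fracP).
Implicit Types (W V H F G D : {vspace L}) (A B : set K).

Lemma espan_nonmem W : W != 0%VS -> exists x, espan 0%VS x /\ ~ espan W x.
Proof.
move=> W0; apply: contrapT => nex; move/negP: W0; apply; rewrite -subv0.
apply: (espan_le bL iota_inj) => x Ex; apply: contrapT => nx; apply: nex; exists x.
by split=> //; apply: espan_bot Ex.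
Qed.

Lemma espan_nonmem_neq0 W x : ~ espan W x -> x != 0.
Proof. by move=> nx; apply/eqP => x0; apply: nx; rewrite x0; exact: espan0. Qed.

Lemma espan_ge0 W x : espan 0%VS x -> val_ring W x -> espan W x.
Proof.
move=> Ex vx; apply: contrapT => nx; move: vx; rewrite /dir_val_ring /= /dir_val_ge.
by rewrite (negbTE (espan_nonmem_neq0 nx)) (espan_valN Ex nx).
Qed.

Lemma eta_le F G : G != 0%VS -> (eta F `<=` eta G)%classic -> (F <= G)%VS.
Proof.
move=> G0 FG; apply: (espan_le bL iota_inj) => x Ex; apply: contrapT => nx.
have [y [Ey ny]] := espan_nonmem G0.
have x0 := espan_nonmem_neq0 nx; have y0 := espan_nonmem_neq0 ny.
have := eta_ratio bL iota_inj fracP Ey (espan_bot Ex) nx.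
move=> /FG/(eta_sub_val bL iota_inj fracP); rewrite /dir_val_ring /= /dir_val_ge mulf_eq0 invr_eq0.
by rewrite (negbTE x0) (negbTE y0) /= valM ?invr_eq0 // valV (espan_val Ex) // (espan_valN Ey).
Qed.

(** Equations of P(F) are the affine forms of nonnegative valuation. If [x] were an equation of P(G)
    but not of P(F), then [y / x] would be regular along F for every affine form [y], making [y]
    regular along G. *)
Lemma val_ring_inj F G : G != 0%VS -> (val_ring F `<=` val_ring G)%classic -> F = G.
Proof.
move=> G0 FG; apply/eqP; rewrite eqEsubv; apply/andP; split; apply: (espan_le bL iota_inj) => x Ex.
  apply: contrapT => nx; have [y [Ey ny]] := espan_nonmem G0; apply: ny.
  have x0 := espan_nonmem_neq0 nx.
  apply: espan_ge0 => //; rewrite -[y](mulfVK x0) -[y / x * x]/((y / x) * x).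
  apply: (subringM (val_subring bL (projv G) iota_inj fracP)).
    apply: FG; rewrite /dir_val_ring /= /dir_val_ge; case: eqVneq => //= yx0.
    have y0 : y != 0 by apply: contraNneq yx0 => ->; rewrite mul0r.
    rewrite valM ?invr_eq0 // valV (espan_valN (espan_bot Ex) nx).
    have [Fy|nFy] := pselect (espan F y); first by rewrite (espan_val Fy y0).
    by rewrite (espan_valN Ey nFy).
  by rewrite /dir_val_ring /= /dir_val_ge (espan_val Ex) ?orbT.
apply: espan_ge0; first exact: espan_bot Ex.
apply: FG; rewrite /dir_val_ring /= /dir_val_ge; case: eqVneq => //= x0.
by rewrite (espan_val Ex).
Qed.

Variable ws : seq {vspace L}.
Hypotheses (ws_uniq : uniq ws) (ws_neq0 : forall W, W \in ws -> W != 0%VS)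
  (ws_sorted : sorted (fun U V => (\dim U <= \dim V)%N) ws)
  (ws_cap : forall U V : {vspace L}, U \in ws -> V \in ws -> (U :&: V)%VS != 0%VS -> (U :&: V)%VS \in ws)
  (ws_full : (0 < r)%N -> fullv \in ws).

Section Split.
Variables (s t : seq {vspace L}) (F : {vspace L}).
Hypothesis wsE : ws = s ++ F :: t.

Lemma split_mem W : (W \in ws) = [|| W \in s, W == F | W \in t].
Proof. by rewrite wsE mem_cat inE. Qed.

Lemma split_F : F \in ws. Proof. by rewrite split_mem eqxx orbT. Qed.

Lemma split_neq W : W \in s ++ t -> W != F.
Proof.
move=> Wst; apply/eqP => E; move: ws_uniq; rewrite wsE -cat_rcons -cats1 -catA uniq_catCA /=.
by rewrite -E Wst.
Qed.

Lemma split_dim_before W : W \in s -> (\dim W <= \dim F)%N.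
Proof.
have dt : transitive (fun U V => (\dim U <= \dim V)%N) by move=> ? ? ?; exact: leq_trans.
move: ws_sorted; rewrite wsE (sorted_pairwise dt) pairwise_cat => /andP [/allrelP H _] Ws.
by apply: H => //; rewrite mem_head.
Qed.

Lemma split_dim_after W : W \in t -> (\dim F <= \dim W)%N.
Proof.
have dt : transitive (fun U V => (\dim U <= \dim V)%N) by move=> ? ? ?; exact: leq_trans.
move: ws_sorted; rewrite wsE (sorted_pairwise dt) pairwise_cat /= => /and3P [_ _ /andP [/allP H _]].
exact: H.
Qed.

End Split.

Let bl_local s A : blowups s A -> is_local A.
Proof. exact: blowups_local. Qed.

(* If A lies on the strict transforms of P(F) and of P(H), then it lies on that of
   P(F :&: H), which must therefore not have been blown up yet; so F is contained
   in H by the choice of the order. *)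
Lemma blowups_invariant s t : ws = s ++ t -> forall A, blowups s A ->
  (forall D, D \in s -> D != fullv -> ~ (A `<=` eta D)%classic) /\
  (forall H0, H0 \in t -> (A `<=` eta H0)%classic -> exists S V e, chart A S V e /\
     forall H, H \in t -> (A `<=` eta H)%classic -> (V <= H)%VS && ~~ (H <= V)%VS).
Proof.
elim/last_ind: s t => [|s F IH] t wsE A.
  move=> pA; split=> // H0 H0t AH0.
  have H0ws : H0 \in ws by rewrite wsE.
  have [S [e cA]] := proj_chart bL iota_inj fracP pA (ws_neq0 H0ws) AH0.
  exists S, 0%VS, e; split=> // H Ht AH; rewrite sub0v subv0 ws_neq0 //.
  by rewrite wsE.
rewrite cat_rcons in wsE; have {}IH := IH _ wsE.
rewrite blowups_rcons => /(blowupP (@bl_local s)) [[sA nAF]|].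
  have [H1 H2] := IH _ sA; split=> [D|H0 H0t AH0].
    by rewrite mem_rcons inE => /orP [/eqP ->|/H1].
  have [|S [V [e [cA cH]]]] := H2 H0 _ AH0; first by rewrite inE H0t orbT.
  by exists S, V, e; split=> // H Ht; apply: cH; rewrite inE Ht orbT.
move=> [A0 [a [P [[sA0 A0F] [Ia a0] pP PA AE]]]].
have [H1 H2] := IH _ sA0; have [|S [V [e [cA cH]]]] := H2 F _ A0F; first exact: mem_head.
have Fws := split_F wsE; have F0 := ws_neq0 Fws.
have /andP [VF nFV] := cH F (mem_head _ _) A0F.
have A0A : (A0 `<=` A)%classic by rewrite AE; apply: step_sub pP.
have [S' [z [cA' _]]] := step_exists bL iota_inj fracP cA VF nFV F0 A0F Ia a0 pP PA.
rewrite -AE in cA'; split=> [D|H0 H0t AH0].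
  rewrite mem_rcons inE => /orP [/eqP -> Ff AF|Ds Df AD]; last first.
    by apply: (H1 D Ds Df) => x /A0A/AD.
  have [z0 Ez _ AEz] := chart_mem cA' (chart_last cA').
  by apply: (eta_not_all bL iota_inj fracP Ff Ez z0) => x /AEz/AF.
exists S', F, z; split=> // H Ht AH.
have A0H : (A0 `<=` eta H)%classic by move=> x /A0A/AH.
have Htl : H \in F :: t by rewrite inE Ht orbT.
have Hws : H \in ws by rewrite wsE mem_cat Htl orbT.
have /andP [VH nHV] := cH H Htl A0H.
set D := (F :&: H)%VS; have VD : (V <= D)%VS by rewrite subv_cap VF.
have HF : H != F by apply: (split_neq wsE); rewrite mem_cat Ht orbT.
have DF : (D <= F)%VS := capvSl _ _.
have lA := chart_local cA.
have Dmax x : espan D x -> max_ideal A0 (x / e).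
  move=> /espan_cap [y [w [Ey Ew ->]]]; rewrite mulrDl; apply: lA.2.
    exact: (chart_max bL iota_inj fracP cA VF nFV A0F Ey).
  exact: (chart_max bL iota_inj fracP cA VH nHV A0H Ew).
have [e0 Ee _ _] := chart_mem cA (chart_last cA).
(* Were the intersection zero, [e] itself would be one of its equations and [e / e = 1] a
   nonunit. *)
have D0 : D != 0%VS.
  apply/eqP => D0; apply: (max_ideal1 lA.1); rewrite -(divff e0); apply: Dmax.
  by rewrite D0; apply: espan_bot Ee.
have A0D : (A0 `<=` eta D)%classic := chart_eta bL iota_inj fracP cA VD Dmax D0.
have Dws : D \in ws by apply: ws_cap.
have [DE|DneF] := eqVneq D F.
  have FH : (F <= H)%VS by rewrite -DE capvSr.
  rewrite FH /=; apply: contraNN HF => HF; by rewrite eqEsubv HF.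
(* An earlier [D] is excluded by the first clause, whose exception [D = fullv] would force [D = F];
   a later [D] has at least the dimension of [F], yet is a proper subspace of it. *)
move: Dws; rewrite (split_mem wsE) (negbTE DneF) /= => /orP [Ds|Dt].
  case: (H1 D Ds _ A0D); apply: contraNneq DneF => Df.
  by rewrite Df eqEsubv -{1}Df DF subvf.
have := split_dim_after wsE Dt; have := dimv_leqif_eq DF; rewrite (negbTE DneF) => -[le ne].
by rewrite leq_eqVlt eq_sym ne ltnNge le.
Qed.

Lemma exceptional_val s F t B : ws = s ++ F :: t ->
  exceptional_divisor (blowups s) (eta F) B ->
  is_subring B /\ (B `<=` val_ring F)%classic /\ exists2 w, B w & val F w = 1.
Proof.
move=> wsE [[bB _] [A1 [sA1 A1F dB]]].
have lB := blowup_local bB; split; first by case: lB.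
(* If [B] were an unchanged point off the center, separatedness would identify it with the point
   [A1] of the center that it dominates. *)
move: bB => /(blowupP (@bl_local s)) [[sB nBF]|].
  case: nBF; suff -> : B = A1 by [].
  have sep : separated (blowups s) by apply: blowups_separated.
  exact: sep sB sA1 lB (dominates_refl B) dB.
move=> [A [a [P [[sA AF] [Ia a0] pP PA BE]]]].
have [_ H2] := blowups_invariant wsE sA.
have [S [V [e [cA cH]]]] := H2 F (mem_head _ _) AF.
have /andP [VF nFV] := cH F (mem_head _ _) AF.
have [S' [z [_ [_]]]] :=
  step_exists bL iota_inj fracP cA VF nFV (ws_neq0 (split_F wsE)) AF Ia a0 pP PA.
by rewrite -BE.
Qed.

Lemma exceptional_ord s F t B x (z : int) : ws = s ++ F :: t ->
  exceptional_divisor (blowups s) (eta F) B -> is_ord B x z -> z = val F x.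
Proof.
move=> wsE eB; have [sB [BF [w Bw vw]]] := exceptional_val wsE eB.
exact: (is_ord_val bL iota_inj sB BF Bw vw).
Qed.

(** Both [val F] and [val F'] compute the order of [B]. This leaves at most one term in [mult]. *)
Lemma exceptional_inj s F t s' F' t' B : ws = s ++ F :: t -> ws = s' ++ F' :: t' ->
  exceptional_divisor (blowups s) (eta F) B ->
  exceptional_divisor (blowups s') (eta F') B -> F = F'.
Proof.
move=> wsE wsE' eB eB'; apply: val_ring_inj; first exact: ws_neq0 (split_F wsE').
move=> x; rewrite /dir_val_ring /= /dir_val_ge; case: (eqVneq x 0) => /= [//|x0].
have [[_ [pi up]] _] := eB; have [_ _ _ /(_ x x0) [u [z [Bu BVu u0 xE]]]] := up.
have ox : is_ord B x z by exists pi, u.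
by rewrite -(exceptional_ord wsE eB ox) -(exceptional_ord wsE' eB' ox).
Qed.

Lemma exceptional_not_affine s F t B : ws = s ++ F :: t ->
  exceptional_divisor (blowups s) (eta F) B -> ~ forall f, B f%:F.
Proof.
move=> wsE eB Bf; have [_ [BF _]] := exceptional_val wsE eB.
have [x [Ex nx]] := espan_nonmem (ws_neq0 (split_F wsE)); apply: nx.
by apply: espan_ge0 => //; apply: BF; move: Ex => [phi [c [_ ->]]].
Qed.

Lemma blowups_cases s t B : ws = s ++ t -> blowups s B ->
  (proj_points iota B /\ forall F, F \in s -> ~ (B `<=` eta F)%classic) \/
  exists s' F t', [/\ ws = s' ++ F :: t', blowup (blowups s') (eta F) B &
    exists A, [/\ blowups s' A, (A `<=` eta F)%classic & dominates B A]].
Proof.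
elim/last_ind: s t => [|s F IH] t wsE; first by left.
rewrite cat_rcons in wsE; rewrite blowups_rcons => bB.
case: (blowupP (@bl_local s) bB) => [[sB nBF]|].
  have [[pB nB]|] := IH _ wsE sB; last by right.
  by left; split=> // G; rewrite mem_rcons inE => /orP [/eqP ->|/nB].
move=> [A [a [P [[sA AF] [Ia a0] pP PA BE]]]].
right; exists s, F, t; split=> //; exists A; split=> //.
by rewrite BE; apply: (blowup_dominates (blowups s)) => //; apply: blowups_local sA.
Qed.

(** A polynomial vanishing at infinity has zero constant term in the last variable, hence is
    divisible by it. *)
Lemma vanishing_full_mem P q : is_prime_ideal [set: {mpoly C[r.+1]}]%classic P ->
  P 'X_ord_max -> vanishing b fullv q -> P q.
Proof.
move=> pP Pt vq; have q0 : (uni q)`_0 = 0.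
  apply/eqP; apply: contrapT => /negP /(nonroot_vec bL) [v /eqP]; apply.
  rewrite -[RHS](vq v (memvf v)) -coef_map -horner_coef0.
  exact: uni_eval.
have [q' E] : exists q', uni q = q' * 'X.
  by have /factor_theorem [q' ->] : root (uni q) 0; [rewrite /root horner_coef0 q0|exists q'; rewrite subr0].
rewrite -[q]uniK E multiM multiX; have [[_ _ _ PM] _ _] := pP; exact: PM.
Qed.

(** A point touched by no blow-up avoids all centers, among them the hyperplane at infinity, so it
    belongs to L; for [r = 0] there is nothing at infinity. *)
Lemma blowups_affine B : blowups ws B -> (forall f, B f%:F) \/
  exists s F t, [/\ ws = s ++ F :: t, blowup (blowups s) (eta F) B &
    exists A, [/\ blowups s A, (A `<=` eta F)%classic & dominates B A]].
Proof.
move=> bB; have [|[pB nB]|] := @blowups_cases ws [::] B _ bB; [by rewrite cats0| |by right].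
left; move: pB nB => [P [pP _ [i Pi] ->]] nB.
apply: (affine_sub iota_inj pP) => Pt.
have r0 : (0 < r)%N.
  case: (unliftP ord_max i) => [j _|iE]; first exact: leq_trans (ltn_ord j).
  by case: Pi; rewrite iE.
apply: (nB fullv (ws_full r0)) => _ [d [p [q [hp hq nq ->]]]].
by exists d, p, q; split=> // /(vanishing_full_mem pP Pt).
Qed.

Lemma blowups_pass s t A : blowups s A -> (forall G, G \in t -> ~ (A `<=` eta G)%classic) ->
  blowups (s ++ t) A.
Proof.
elim/last_ind: t => [|t G IH] sA nA; first by rewrite cats0.
rewrite -rcons_cat blowups_rcons; have tA : blowups (s ++ t) A.
  by apply: IH => // H Ht; apply: nA; rewrite mem_rcons inE Ht orbT.
apply: blowup_pass => //; first exact: bl_local tA.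
by apply: nA; rewrite mem_rcons mem_head.
Qed.

Section Existence.
Variables (s t : seq {vspace L}) (F : {vspace L}).
Hypothesis wsE : ws = s ++ F :: t.

Let F0 : F != 0%VS := ws_neq0 (split_F wsE).

Lemma eta_proj_point : proj_points iota (eta F).
Proof.
exists (vanishing b F); split=> //; [exact: vanishing_prime|exact: vanishing_homog|].
have [v [vF v0]] : exists v, v \in F /\ v != 0.
  by exists (vpick F); rewrite memv_pick vpick0.
have [j vj] : exists j, coord b j v != 0.
  apply: contrapT => nj; move/eqP: v0; apply; rewrite [LHS](coords_vec bL) big1 // => j _.
  have [->|vj] := eqVneq (coord b j v) 0; first by rewrite scale0r.
  by case: nj; exists j.
exists (lift ord_max j) => /(_ v vF); rewrite mevalXU /point_at_infinity liftK => /eqP.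
by rewrite (negbTE vj).
Qed.

(** An earlier center through the generic point of P(F) would contain P(F) without exceeding its
    dimension, hence be equal to it. *)
Lemma eta_blowups : blowups s (eta F).
Proof.
apply: (@blowups_pass [::] s); first exact: eta_proj_point.
move=> G Gs FG; have Gws : G \in ws by rewrite (split_mem wsE) Gs.
have FleG := eta_le (ws_neq0 Gws) FG; have GF : G != F by apply: (split_neq wsE); rewrite mem_cat Gs.
have := split_dim_before wsE Gs; have := dimv_leqif_eq FleG.
rewrite eq_sym (negbTE GF) => -[le ne].
by rewrite leq_eqVlt eq_sym ne ltnNge le.
Qed.

Let eF := eta_local bL iota_inj F0.
Let sF : is_subring (eta F) := eF.1.

(** The chart over [eta F] divides by [m^-1], of valuation 1 because the affine form [m] is not
    constant along F; the prime consists of the elements of positive valuation. The localization is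
    the whole valuation ring since a fraction is [(f / m^d) / (g / m^d)] with [d] the degree of [g]
    along F. *)
Lemma val_ring_blowup : blowup (blowups s) (eta F) (val_ring F).
Proof.
have [m [Em nm]] := espan_nonmem F0.
have m0 := espan_nonmem_neq0 nm; have vm := espan_valN Em nm.
have vmV : val F m^-1 = 1 by rewrite valV vm opprK.
have eV : eta F m^-1.
  by rewrite -div1r; apply: (eta_ratio bL iota_inj fracP (espan1 b iota 0%VS) Em nm).
have IE : ideal_stalk (eta F) (eta F) = max_ideal (eta F).
  by apply/seteqP; split=> x [ex H]; [exact: H|split].
have mx x : max_ideal (eta F) x <-> eta F x /\ vge F 1 x := eta_max bL iota_inj fracP F x.
have sO := val_subring bL (projv F) iota_inj fracP.
set R := adjoin (eta F) [set x / m^-1 | x in ideal_stalk (eta F) (eta F)]%classic.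
have sR : is_subring R by exact: adjoin_subring.
have RO : (R `<=` val_ring F)%classic.
  move=> x; apply=> //; first exact: (eta_sub_val bL iota_inj).
  rewrite IE => _ [y /mx [_ vy] <-]; rewrite invrK /dir_val_ring /=.
  have vm1 : vge F (-1) m by rewrite /dir_val_ge vm lexx orbT.
  by have := vgeM bL iota_inj vy vm1; rewrite subrr.
pose P : set K := [set x | R x /\ vge F 1 x]%classic.
have Pge1 x : R x -> ~ vge F 1 x -> x != 0 /\ val F x = 0.
  move=> /RO; rewrite /dir_val_ring /= /dir_val_ge; case: (eqVneq x 0) => //= x0 v0 v1.
  by split=> //; move: v0 v1; lia.
exists (eta F), m^-1, P => /=; rewrite -/R IE.
split; [exact: eta_blowups| | | |].
- by split; [apply/mx; rewrite /dir_val_ge vmV orbT|rewrite invr_neq0].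
- split; [split| |].
  + by move=> x [].
  + by split; [exact: subring0|rewrite /dir_val_ge eqxx].
  + by move=> x y [Rx vx] [Ry vy]; split; [exact: (subringD sR)|exact: (vgeD bL iota_inj vx vy)].
  + move=> x y Rx [Ry vy]; split; first exact: (subringM sR).
    by rewrite -[1]add0r; apply: (vgeM bL iota_inj) => //; apply: RO.
  + by move=> [_]; rewrite /dir_val_ge oner_eq0 (val1 bL _ iota_inj).
  + move=> x y Rx Ry [_ vxy]; apply: contrapT => /not_orP [nx ny].
    have [x0 vx] := Pge1 x Rx (fun v => nx (conj Rx v)).
    have [y0 vy] := Pge1 y Ry (fun v => ny (conj Ry v)).
    by move: vxy; rewrite /dir_val_ge mulf_eq0 (negbTE x0) (negbTE y0) valM // vx vy.
- apply/seteqP; split=> x.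
    by move=> [[Rx vx] ex]; apply/mx.
  by move=> /mx [ex vx]; split=> //; split=> //; apply: adjoin_base.
apply/seteqP; split=> [z|_ [x [y [Rx Ry nPy ->]]]]; last first.
  have [y0 vy] := Pge1 y Ry (fun v => nPy (conj Ry v)).
  apply: (subringM sO); first exact: RO.
  by rewrite /dir_val_ring /= /dir_val_ge valV vy oppr0 lexx orbT.
have [f [g [g0 ->]]] := fracP z; have [->|f0] := eqVneq f 0.
  move=> _; rewrite rmorph0 mul0r; exists 0, 1; rewrite mul0r; split=> //.
  - exact: subring0.
  - exact: subring1.
  - by move=> [_]; rewrite /dir_val_ge oner_eq0 (val1 bL _ iota_inj).
rewrite /dir_val_ring /= /dir_val_ge mulf_eq0 invr_eq0 !(iota_eq0 iota_inj) (negbTE f0) (negbTE g0) /=.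
rewrite (val_frac bL _ iota_inj fracP) // subr_ge0 lez_nat => fg.
have DP h : (dir_deg b (projv F) h <= dir_deg b (projv F) g)%N -> R (h%:F / m ^+ dir_deg b (projv F) g).
  apply: (div_pow_mem bL) => //.
  - move=> c; apply: adjoin_base; exact: (stalk_const iota (vanishing_prime bL F0)).
  - exact: adjoin_base.
  - move=> j; apply: adjoin_gen; rewrite IE.
    have Eh : espan F (lform b (fun v => coord b j (v - projv F v)))%:F.
      exists (linfun (coord b j : L -> C^o) \o (\1 - projv F))%VF, 0; split=> [v vF|].
        by rewrite comp_lfunE add_lfunE opp_lfunE id_lfunE projv_id // subrr linear0.
      rewrite mpolyC0 addr0; congr (_%:F); apply: eq_lform => v.
      by rewrite comp_lfunE lfunE add_lfunE opp_lfunE id_lfunE.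
    eexists; first exact: (max_eta_ratio bL iota_inj fracP Em nm Eh).
    by rewrite invrK mulfVK.
  - move=> j; apply: adjoin_base; apply: (eta_ratio bL iota_inj fracP _ Em nm).
    exists (linfun (coord b j : L -> C^o) \o projv F)%VF, 0; split=> [v|].
      by rewrite memv0 => /eqP ->; rewrite linear0.
    rewrite mpolyC0 addr0; congr (_%:F); apply: eq_lform => v.
    by rewrite comp_lfunE lfunE.
set d := dir_deg _ _ g in fg DP *.
have md0 : m ^+ d != 0 by rewrite expf_neq0.
have gF0 : g%:F != 0 by rewrite (iota_eq0 iota_inj).
exists (f%:F / m ^+ d), (g%:F / m ^+ d); split; [exact: DP|exact: DP| |].
  move=> [_]; rewrite /dir_val_ge mulf_eq0 invr_eq0 (negbTE md0) (negbTE gF0) /=.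
  rewrite valM ?invr_eq0 // valV exprnP (valXz bL _ iota_inj fracP) // vm.
  by rewrite (val_poly bL _ iota_inj fracP) // mulN1r opprK addNr.
by move: (m ^+ d) (g%:F) md0 gF0 => c x c0 x0; field; rewrite ?c0 ?x0.
Qed.

Lemma val_ring_exceptional : exceptional_divisor (blowups s) (eta F) (val_ring F).
Proof.
have [m [Em nm]] := espan_nonmem F0; have vm := espan_valN Em nm.
split; [split; first exact: val_ring_blowup|].
  by exists m^-1; apply: (val_uniformizer bL iota_inj); rewrite valV vm opprK.
exists (eta F); split; [exact: eta_blowups|by []|split].
  exact: (eta_sub_val bL iota_inj).
by move=> x /(eta_max bL iota_inj fracP) [_ vx]; apply/(val_max bL _ iota_inj fracP).
Qed.

(** Lying on the strict transform of a later center G would put the valuation ring of F inside that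
    of G. *)
Lemma val_ring_blowups : blowups ws (val_ring F).
Proof.
rewrite wsE -cat_rcons; apply: blowups_pass; first by rewrite blowups_rcons; exact: val_ring_blowup.
move=> G Gt FG; have Gws : G \in ws by rewrite (split_mem wsE) Gt !orbT.
have /negP : G != F by apply: (split_neq wsE); rewrite mem_cat Gt orbT.
apply; apply/eqP/esym/val_ring_inj; first exact: ws_neq0.
by move=> x /FG; apply: (eta_sub_val bL iota_inj).
Qed.

End Existence.
End BlowupSequence.

(** * Unique factorization in polynomial rings *)

Section Factorization.

Definition divides (D : idomainType) (x y : D) : Prop := exists q, y = q * x.

Definition prime_elt (D : idomainType) (p : D) : Prop :=
  [/\ p != 0, ~ divides p 1 & forall x y, divides p (x * y) -> divides p x \/ divides p y].

Definition factorial (D : idomainType) : Prop := forall x : D, x != 0 ->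
  exists u s, [/\ divides u 1, forall p, p \in s -> prime_elt p & x = u * \prod_(p <- s) p].

Section Divides.
Variable D : idomainType.
Implicit Types x y z : D.

Lemma divides_refl x : divides x x. Proof. by exists 1; rewrite mul1r. Qed.

Lemma divides_trans y x z : divides x y -> divides y z -> divides x z.
Proof. by move=> [a ->] [c ->]; exists (c * a); rewrite mulrA. Qed.

Lemma divides_mull x y z : divides x y -> divides x (z * y).
Proof. by move=> [q ->]; exists (z * q); rewrite mulrA. Qed.

Lemma dividesD x y z : divides x y -> divides x z -> divides x (y + z).
Proof. by move=> [a ->] [c ->]; exists (a + c); rewrite mulrDl. Qed.

Lemma divides0 x : divides x 0. Proof. by exists 0; rewrite mul0r. Qed.

Lemma dividesN x y : divides x y -> divides x (- y).
Proof. by move=> [a ->]; exists (- a); rewrite mulNr. Qed.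

End Divides.

Variable D : idomainType.
Implicit Types (p q x y c : D) (f g h : {poly D}).

Lemma divides_polyC c f : @divides {poly D} c%:P f <-> forall i, divides c f`_i.
Proof.
split=> [[q ->] i|H]; first by exists q`_i; rewrite coefMC.
exists (\poly_(i < size f) projT1 (cid (H i))); apply/polyP => i.
rewrite coefMC coef_poly; case: ltnP => [_|si]; first exact: projT2 (cid (H i)).
by rewrite mul0r nth_default.
Qed.

(** Gauss: modulo [p], the product of the lowest nonzero coefficients of two polynomials is
    nonzero. *)
Lemma prime_polyC p : prime_elt p -> @prime_elt {poly D} p%:P.
Proof.
move=> [p0 np pM]; split; first by rewrite polyC_eq0.
  by move=> /divides_polyC /(_ 0%N); rewrite coef1.
move=> f g /divides_polyC pfg; apply: contrapT => /not_orP [nf ng].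
have least h : ~ @divides {poly D} p%:P h ->
    exists i, ~ divides p h`_i /\ forall j, (j < i)%N -> divides p h`_j.
  move=> nh; have ex : exists i, `[< ~ divides p h`_i >].
    apply: contrapT => nex; apply/nh/divides_polyC => i; apply: contrapT => ni.
    by apply: nex; exists i; apply/asboolP.
  exists (ex_minn ex); case: ex_minnP => i /asboolP ni min; split=> // j ji.
  by apply: contrapT => /asboolP /min; rewrite leqNgt ji.
have [i [ni Hi]] := least f nf; have [j [nj Hj]] := least g ng.
have := pfg (i + j)%N; rewrite coefM.
have ij : (i < (i + j).+1)%N by rewrite ltnS leq_addr.
rewrite (bigD1 (Ordinal ij)) //= addKn => pij.
have : divides p (f`_i * g`_j).
  rewrite -[_ * _](addrK (\sum_(k < (i + j).+1 | k != Ordinal ij) f`_k * g`_(i + j - k))).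
  apply: dividesD => //; apply: dividesN; apply: big_ind => [||k ki]; [exact: divides0|exact: dividesD|].
  case: (ltngtP k i) => [lt|gt|E].
  - by rewrite mulrC; apply: divides_mull; apply: Hi.
  - by apply: divides_mull; apply: Hj; move: gt (ltn_ord k); lia.
  - by move/eqP: ki; case; apply/val_inj.
by move=> /pM [].
Qed.

Hypothesis fD : factorial D.

(** Each prime factor of [c] stays prime among polynomials, so it divides [f] or [g] and cancels
    there. This clears the constants introduced by pseudo-division. *)
Lemma cancel_const c h f g : c != 0 -> c%:P * h = f * g ->
  exists c1 c2 f' g', [/\ f = c1%:P * f', g = c2%:P * g' & h = f' * g'].
Proof.
move=> /fD [u [s [[v vu] ps ->]]] {c}; elim: s f g ps => [|p s IH] f g ps.
  rewrite big_nil mulr1 => E; exists u, 1, (v%:P * f), g; split.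
  - by rewrite mulrA -polyCM mulrC [u * v]mulrC -vu mulrC mul1r.
  - by rewrite mul1r.
  - by rewrite -mulrA -E mulrA -polyCM -vu mul1r.
rewrite big_cons [p * _]mulrC mulrA polyCM mulrAC => E.
have pp := ps p (mem_head _ _); have [p0 _ _] := pp; have [_ _ pM] := prime_polyC pp.
have ps' q : q \in s -> prime_elt q by move=> qs; apply: ps; rewrite inE qs orbT.
have pP0 : p%:P != 0 :> {poly D} by rewrite polyC_eq0.
have [[f1 fE]|[g1 gE]] : @divides {poly D} p%:P f \/ @divides {poly D} p%:P g.
  by apply: pM; exists ((u * \prod_(j <- s) j)%:P * h).
  have E1 : (u * \prod_(j <- s) j)%:P * h = f1 * g.
    by apply: (mulIf pP0); rewrite E fE; ring.
  have [c1 [c2 [f' [g' [fE1 -> ->]]]]] := IH _ _ ps' E1.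
  by exists (c1 * p), c2, f', g'; split=> //; rewrite fE fE1 polyCM; ring.
have E1 : (u * \prod_(j <- s) j)%:P * h = f * g1.
  by apply: (mulIf pP0); rewrite E gE; ring.
have [c1 [c2 [f' [g' [-> gE1 ->]]]]] := IH _ _ ps' E1.
by exists c1, (c2 * p), f', g'; split=> //; rewrite gE gE1 polyCM; ring.
Qed.

Definition primitive g := forall p, prime_elt p -> ~ @divides {poly D} p%:P g.

Lemma primitive_unit c g g' : primitive g -> g != 0 -> g = c%:P * g' -> divides c 1.
Proof.
move=> pg g0 gE; have c0 : c != 0.
  by apply: contraNneq g0 => c0; rewrite gE c0 polyC0 mul0r.
have [u [s [u1 ps cE]]] := fD c0; case: s ps cE => [|p s] ps cE.
  by rewrite cE big_nil mulr1.
case: (pg p (ps p (mem_head _ _))); rewrite gE cE big_cons.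
by exists (u%:P * (\prod_(j <- s) j)%:P * g'); rewrite !polyCM; ring.
Qed.

Lemma primitive_cancel c g h : primitive g -> g != 0 -> c != 0 ->
  @divides {poly D} g (c%:P * h) -> @divides {poly D} g h.
Proof.
move=> pg g0 c0 [k E]; have [c1 [c2 [k' [g' [_ gE ->]]]]] := cancel_const c0 E.
have [v E1] := primitive_unit pg g0 gE.
exists (k' * v%:P); rewrite gE -mulrA; congr (_ * _).
by rewrite mulrA -polyCM -E1 mul1r.
Qed.

(* Over the fraction field of D the factor g is irreducible by minimality of its
   degree; pseudo-division replaces the Euclidean division there. *)
Lemma minimal_factor_prime f g : primitive f -> f != 0 -> (1 < size g)%N ->
  @divides {poly D} g f ->
  (forall h, (1 < size h)%N -> @divides {poly D} h f -> (size g <= size h)%N) ->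
  @prime_elt {poly D} g.
Proof.
move=> pf f0 sg gf min.
have g0 : g != 0 by rewrite -size_poly_gt0; apply: leq_trans sg.
have pg : primitive g by move=> p pp pdg; apply: (pf p pp); apply: divides_trans pdg gf.
split=> // [[q /(congr1 (size \o polyseq))]|a c [k gac]].
  rewrite /= size_poly1; have [->|q0] := eqVneq q 0; first by rewrite mul0r size_poly0.
  by rewrite size_mul //; move: sg q0; rewrite -size_poly_gt0; lia.
have [|na] := pselect (@divides {poly D} g a); [by left|right].
(* Over the fraction field the ideal generated by [g] and [a] is principal; a nonzero [h] of least
   size generates it up to constants. *)
pose inJ h := exists s t : {poly D}, h = s * g + t * a.
have Jg : inJ g by exists 1, 0; rewrite mul1r mul0r addr0.
have Ja : inJ a by exists 0, 1; rewrite mul1r mul0r add0r.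
have ex : exists m, `[< exists2 h, inJ h & h != 0 /\ size h = m >].
  by exists (size g); apply/asboolP; exists g.
case: (ex_minnP ex) => m /asboolP [h Jh [h0 sh]] hmin.
have divh w : inJ w -> exists (e : D) (q : {poly D}), e != 0 /\ e%:P * w = q * h.
  move=> [s [t wE]]; exists (lead_coef h ^+ scalp w h), (w %/ h).
  split; first by rewrite expf_neq0 // lead_coef_eq0.
  have := Pdiv.WeakIdomain.divp_eq w h; rewrite -mul_polyC => E.
  have [r0|r0] := eqVneq (w %% h) 0; first by rewrite E r0 addr0.
  have /hmin : `[< exists2 h', inJ h' & h' != 0 /\ size h' = size (w %% h) >].
    apply/asboolP; exists (w %% h) => //; have [s' [t' hE]] := Jh.
    set e := (_ ^+ _)%:P in E; exists (e * s - w %/ h * s'), (e * t - w %/ h * t').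
    have -> : w %% h = e * w - w %/ h * h by rewrite E addrC addKr.
    clearbody e; move: (w %/ h) => q; rewrite [in LHS]wE [in LHS]hE.
    by move: h s' t' s t {E hE wE h0 sh hmin Jh r0} => *; ring.
  by rewrite -sh leqNgt Pdiv.CommonIdomain.ltn_modp h0.
(* If [h] is constant, [h * c] is a combination of [g * c] and [a * c], both multiples of [g], so
   [g] divides [c]. *)
have [hc|sh1] := leqP (size h) 1%N.
  have [s [t hE]] := Jh; have c0 : h`_0 != 0.
    by rewrite -polyC_eq0 -size1_polyC.
  apply: (primitive_cancel pg g0 c0); rewrite -size1_polyC // hE.
  exists (s * c + t * k); rewrite mulrDl -mulrA [a * c]mulrC in gac *.
  by rewrite mulrDl -[t * k * g]mulrA -gac; ring.
(* If [h] is not constant, minimality of [g] makes [g] agree up to a unit with [h'], which is [h] up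
   to a constant; so [g] divides [a]. *)
case: na; have [e [q [e0 E]]] := divh g Jg.
have [c1 [c2 [q' [h' [qE hE gE]]]]] := cancel_const e0 E.
have c20 : c2 != 0 by apply: contraNneq h0 => c20; rewrite hE c20 polyC0 mul0r.
have sh' : size h' = size h by rewrite hE mul_polyC size_scale.
have h'g : (size g <= size h')%N.
  by apply: min; [rewrite sh'|apply: divides_trans gf; exists q'].
have q'0 : q' != 0 by apply: contraNneq g0 => q'0; rewrite gE q'0 mul0r.
have h'0 : h' != 0 by apply: contraNneq g0 => h'0; rewrite gE h'0 mulr0.
have sq' : (size q' <= 1)%N.
  by move: h'g h'0; rewrite gE size_mul // -size_poly_gt0; lia.
rewrite (size1_polyC sq') in gE; have [v E1] := primitive_unit pg g0 gE.
have h'E : h' = v%:P * g by rewrite gE mulrA -polyCM -E1 mul1r.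
have [e' [q2 [e'0 E2]]] := divh a Ja.
apply: (primitive_cancel pg g0 e'0); rewrite E2 hE h'E.
by exists (q2 * c2%:P * v%:P); ring.
Qed.

Lemma poly_prime_factor f : f != 0 -> ~ @divides {poly D} f 1 ->
  exists2 g, @prime_elt {poly D} g & @divides {poly D} g f.
Proof.
move=> f0 nf; have [pf|] := pselect (primitive f); last first.
  move=> /existsNP [p /not_implyP [pp /contrapT pdf]].
  by exists p%:P => //; apply: prime_polyC.
have [sf|sf] := leqP (size f) 1%N.
  have fE : f = (f`_0)%:P * 1 by rewrite mulr1 -size1_polyC.
  have [v E] := primitive_unit pf f0 fE; case: nf; exists v%:P.
  by rewrite (size1_polyC sf) -polyCM -E.
have ex : exists m, `[< exists g, [/\ (1 < size g)%N, @divides {poly D} g f & size g = m] >].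
  by exists (size f); apply/asboolP; exists f; split=> //; exact: divides_refl.
case: (ex_minnP ex) => m /asboolP [g [sg gf <-]] min.
exists g => //; apply: (minimal_factor_prime pf f0 sg gf) => h sh hf.
by apply: min; apply/asboolP; exists h.
Qed.

End Factorization.

(** * Factorization by induction on the number of variables *)

Section MpolyFactorization.
Variable C : numFieldType.

Lemma mpoly_nonunit_size r (p : {mpoly C[r]}) : p != 0 -> ~ divides p 1 -> (1 < msize p)%N.
Proof.
move=> p0 np; rewrite ltnNge; apply/negP => /msize1_polyC pE; apply: np.
exists ((p@_0)^-1)%:MP; rewrite {2}pE -mpolyCM mulVf ?mpolyC1 //.
by apply: contraNneq p0 => p00; rewrite pE p00 mpolyC0.
Qed.

Lemma factorial_of_prime_factor r :
  (forall f : {mpoly C[r]}, f != 0 -> ~ divides f 1 -> exists2 g, prime_elt g & divides g f) ->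
  @factorial {mpoly C[r]}.
Proof.
move=> H f; have [m] := ubnP (msize f); elim: m f => // m IH f sf f0.
have [[v vf]|nf] := pselect (divides f 1).
  by exists f, [::]; rewrite big_nil mulr1; split=> //; exists v.
have [g pg [q fE]] := H f f0 nf; have [g0 ng _] := pg.
have q0 : q != 0 by apply: contraNneq f0 => q0; rewrite fE q0 mul0r.
have sg := mpoly_nonunit_size g0 ng.
have [|u [s [u1 ps qE]]] := IH q _ q0.
  move: sf sg; rewrite fE msizeM //; move: (msize q) (msize g) => i j; lia.
exists u, (g :: s); split=> //; last by rewrite big_cons fE qE; ring.
by move=> p; rewrite inE => /orP [/eqP ->|/ps].
Qed.

Lemma mpoly_prime_factor r (f : {mpoly C[r]}) : f != 0 -> ~ divides f 1 ->
  exists2 g, prime_elt g & divides g f.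
Proof.
elim: r f => [|r IH] f f0 nf.
  have := mpoly_nonunit_size f0 nf; rewrite [f]nvar0_mpolyC msizeC; by case: (_ == 0).
have uf0 : uni f != 0 by rewrite -(inj_eq (can_inj (@uniK C r))) uni0 in f0 *; exact: f0.
have [|g [g0 ng pg] [q fE]] := poly_prime_factor (factorial_of_prime_factor IH) uf0.
  by move=> [v E]; apply: nf; exists (multi v); rewrite -[f]uniK -multiM -E -[1]uniK rmorph1.
have md x y : @divides {poly {mpoly C[r]}} x y <-> divides (multi x) (multi y).
  split=> [[k ->]|[k E]]; first by exists (multi k); rewrite multiM.
  by exists (uni k); rewrite -[y]multiK E uniM multiK.
exists (multi g); last by rewrite -[f]uniK; apply/md; exists q.
split.
- by rewrite -(inj_eq (can_inj (@multiK C r))) in g0; rewrite multi0 in g0.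
- by move=> H; apply/ng/md; rewrite rmorph1.
by move=> x y; rewrite -[x]uniK -[y]uniK -multiM => /md /pg [] /md; [left|right].
Qed.

Lemma mpoly_factorial r : @factorial {mpoly C[r]}.
Proof. exact: factorial_of_prime_factor (@mpoly_prime_factor r). Qed.

End MpolyFactorization.

(** * Prime divisors of affine space *)

Section AffineDivisors.
Variables (C : numFieldType) (L : vectType C) (r : nat) (b : r.-tuple L).
Hypothesis bL : basis_of fullv b.
Variables (K : fieldType) (iota : {rmorphism {mpoly C[r]} -> K}).
Hypothesis iota_inj : injective iota.
Hypothesis fracP : forall x, exists p q : {mpoly C[r]}, q != 0 /\ x = iota p / iota q.
Local Notation "p %:F" := (iota p) (at level 1).
Local Notation hmg d p := (p \is d.-homog for mdeg).

(* The homogeneous component of degree d becomes its dehomogenization times 'X^d. *)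
Definition homogen : {mpoly C[r.+1]} -> {poly {mpoly C[r]}} :=
  subst (fun=> 0) (fun i => if unlift ord_max i is Some j then 'X_j else 1).
HB.instance Definition _ := GRing.RMorphism.on homogen.

Lemma homogenM p q : homogen (p * q) = homogen p * homogen q. Proof. exact: substM. Qed.
Lemma homogenD p q : homogen (p + q) = homogen p + homogen q. Proof. exact: substD. Qed.

Lemma homogen_homog d p : hmg d p -> homogen p = (dehom p)%:P * 'X^d.
Proof.
move=> /dhomogP hp; rewrite {1 2}[p]mpolyE.
have DS : dehom (\sum_(m <- msupp p) p@_m *: 'X_[m]) = \sum_(m <- msupp p) dehom (p@_m *: 'X_[m]) :> {mpoly C[r]}.
  exact: rmorph_sum.
rewrite DS !rmorph_sum /= mulr_suml big_seq [RHS]big_seq.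
apply: eq_bigr => m mp; rewrite -!mul_mpolyC homogenM dehomM dehomC polyCM -mulrA /homogen substC.
congr (_ * _); have -> : d = mdeg m by rewrite -(hp m mp).
rewrite mpolyXE_id.
have -> : dehom (\prod_(i < r.+1) 'X_i ^+ m i) = \prod_(i < r.+1) dehom ('X_i ^+ m i) :> {mpoly C[r]}.
  exact: rmorph_prod.
rewrite !rmorph_prod /= mdegE -prodrXr -big_split /=.
apply: eq_bigr => i _; rewrite rmorphXn /= substX add0r exprMn -dehomX -polyC_exp.
by congr (_%:P * _); rewrite /dehom rmorphXn.
Qed.

Lemma coef_homogen p d : (homogen p)`_d = dehom (pihomog mdeg d p).
Proof.
pose N := maxn (msize p) d.+1.
have pE : p = \sum_(k < N) pihomog mdeg k p by apply: pihomog_partitionE; exact: leq_maxl.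
rewrite {1}pE rmorph_sum coef_sum /= (bigD1 (Ordinal (leq_maxr (msize p) d.+1))) //=.
rewrite (homogen_homog (pihomogP _ _ _)) coefMXn ltnn subnn coefC eqxx big1 ?addr0 // => k kd.
rewrite (homogen_homog (pihomogP _ _ _)) coefMXn coefC; case: ltnP => // dk.
case: eqP => // /eqP; rewrite subn_eq0 => kd'; move/eqP: kd; case; apply/val_inj => /=.
by apply/eqP; rewrite eqn_leq dk kd'.
Qed.

Section Prime.
Variable (pi : {mpoly C[r]}).
Hypothesis ppi : prime_elt pi.

(** The homogeneous ideal of the closure of the hypersurface [pi = 0]. As [homogen] is a ring
    morphism, primality is inherited from the constant polynomial [pi]. *)
Definition affine_prime : set {mpoly C[r.+1]} :=
  [set p | @divides {poly {mpoly C[r]}} pi%:P (homogen p)]%classic.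

Lemma affine_prime_homog d p : hmg d p -> affine_prime p <-> divides pi (dehom p).
Proof.
move=> hp; rewrite /affine_prime /= (homogen_homog hp) divides_polyC; split=> [/(_ d)|H i].
  by rewrite coefMXn ltnn subnn coefC eqxx.
rewrite coefMXn; case: ltnP => _; first exact: divides0.
by rewrite coefC; case: eqP => _ //; exact: divides0.
Qed.

Lemma affine_prime_prime : is_prime_ideal [set: {mpoly C[r.+1]}]%classic affine_prime.
Proof.
have [p0 np pM] := prime_polyC ppi; split.
- split=> //; first by rewrite /affine_prime /= rmorph0; exact: divides0.
    by move=> x y Px Py; rewrite /affine_prime /= homogenD; apply: dividesD.
  by move=> a x _ Px; rewrite /affine_prime /= homogenM; apply: divides_mull.
- by rewrite /affine_prime /= rmorph1.
by move=> x y _ _; rewrite /affine_prime /= homogenM; apply: pM.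
Qed.

Lemma affine_prime_homogeneous : homogeneous_ideal affine_prime.
Proof.
move=> p d /divides_polyC Pp; apply/(affine_prime_homog (pihomogP _ _ _)).
by rewrite -coef_homogen.
Qed.

Lemma affine_prime_infty : ~ affine_prime 'X_ord_max.
Proof.
move=> /(affine_prime_homog (homogX _ _)); rewrite dehomX unlift_none.
by case: ppi.
Qed.

Definition affine_ring : set K := stalk iota affine_prime.

Lemma affine_point : proj_points iota affine_ring.
Proof.
exists affine_prime; split=> //; [exact: affine_prime_prime|exact: affine_prime_homogeneous|].
by exists ord_max; exact: affine_prime_infty.
Qed.

Lemma affine_poly f : affine_ring f%:F.
Proof. exact: affine_sub affine_prime_prime affine_prime_infty f. Qed.

Lemma affine_inv f : ~ divides pi f -> affine_ring (f%:F)^-1.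
Proof.
move=> nf; have [q [hq qf]] := homogenize bL (leqnn (dir_deg b \1%VF f)).
set d := dir_deg b \1%VF f in hq.
exists d, ('X_ord_max ^+ d), q; split=> //; [exact: homogXn|by move=> /(affine_prime_homog hq); rewrite qf|].
rewrite qf; have -> : dehom ('X_ord_max ^+ d) = 1 :> {mpoly C[r]}.
  rewrite /dehom rmorphXn /=; have := @dehomX C r ord_max; rewrite /dehom unlift_none => ->.
  by rewrite expr1n.
by rewrite rmorph1 div1r.
Qed.

Lemma affine_ring_unit f g z : ~ divides pi f -> ~ divides pi g ->
  z = f%:F / g%:F -> [/\ affine_ring z, affine_ring z^-1 & z != 0].
Proof.
move=> nf ng ->; have sA := stalk_subring iota_inj affine_prime_prime.
have nz h : ~ divides pi h -> h%:F != 0.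
  move=> nh; rewrite -(rmorph0 iota) (inj_eq iota_inj).
  by apply/eqP => h0; apply: nh; rewrite h0; exact: divides0.
split; last by rewrite mulf_neq0 ?invr_neq0 ?nz.
  by apply: subringM => //; [exact: affine_poly|exact: affine_inv].
by rewrite invf_div; apply: subringM => //; [exact: affine_poly|exact: affine_inv].
Qed.

Lemma prime_multiplicity f : f != 0 -> exists k f', f = f' * pi ^+ k /\ ~ divides pi f'.
Proof.
have [m] := ubnP (msize f); elim: m f => // m IH f sf f0.
have [[q fE]|nf] := pselect (divides pi f); last by exists 0%N, f; rewrite expr0 mulr1.
have [pi0 npi _] := ppi.
have q0 : q != 0 by apply: contraNneq f0 => q0; rewrite fE q0 mul0r.
have [|k [f' [qE nf']]] := IH q _ q0.
  have := mpoly_nonunit_size pi0 npi.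
  by move: sf; rewrite fE msizeM //; move: (msize q) (msize pi) => i j; lia.
by exists k.+1, f'; rewrite fE qE exprSr mulrA.
Qed.

Let piF0 : pi%:F != 0.
Proof. by rewrite -(rmorph0 iota) (inj_eq iota_inj); case: ppi. Qed.

Lemma affine_uniformizer : uniformizer affine_ring pi%:F.
Proof.
have [pi0 npi pM] := ppi; split=> //; first exact: affine_poly.
  move=> [d [p [q [hp hq nq E]]]].
  have q0 := homog_dehom_neq0 iota_inj affine_prime_prime hq nq.
  apply: nq; apply/(affine_prime_homog hq); exists (dehom p); apply: iota_inj.
  by rewrite rmorphM -[LHS]mul1r -(mulVf piF0) E mulrAC mulfVK.
move=> x x0; have [f [g [g0 xE]]] := fracP x.
have f0 : f != 0 by apply: contraNneq x0 => f0; rewrite xE f0 rmorph0 mul0r.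
have [k [f' [fE nf]]] := prime_multiplicity f0; have [m [g' [gE ng]]] := prime_multiplicity g0.
have [Au AVu u0] := affine_ring_unit nf ng erefl.
exists (f'%:F / g'%:F), (k%:Z - m%:Z); split=> //.
rewrite expfzDr // -exprnN -exprnP xE fE gE !rmorphM !rmorphXn.
by rewrite -mulf_div.
Qed.

Lemma affine_ord f g k m : ~ divides pi f -> ~ divides pi g ->
  is_ord affine_ring ((f * pi ^+ k)%:F / (g * pi ^+ m)%:F) (k%:Z - m%:Z).
Proof.
move=> nf ng; have [Au AVu u0] := affine_ring_unit nf ng erefl.
exists pi%:F, (f%:F / g%:F); split=> //; first exact: affine_uniformizer.
by rewrite expfzDr // -exprnN -exprnP !rmorphM !rmorphXn -mulf_div.
Qed.

End Prime.

(** Prime factors of the denominator are removed one at a time: nonnegative order along [p] means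
    that [p] divides the numerator too. *)
Lemma poly_of_ord x : x != 0 ->
  (forall pi, prime_elt pi -> forall z : int, is_ord (affine_ring pi) x z -> 0 <= z) ->
  exists f, x = f%:F.
Proof.
have [f [g [g0 ->]]] := fracP x; have [u [s [[v uv] ps gE]]] := mpoly_factorial g0.
rewrite gE {gE g0}; elim: s f ps => [|p s IH] f ps.
  move=> _ _; exists (f * v); rewrite big_nil mulr1 rmorphM; congr (_ * _).
  have uF : v%:F * u%:F = 1 by rewrite -rmorphM -uv rmorph1.
  apply: (mulIf (_ : u%:F != 0)).
    by apply/eqP => u0; move/eqP: uF; rewrite u0 mulr0 eq_sym oner_eq0.
  rewrite uF mulVf //.
  by apply/eqP => u0; move/eqP: uF; rewrite u0 mulr0 eq_sym oner_eq0.
rewrite big_cons mulrCA => x0 H.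
have pp := ps p (mem_head _ _); have [p0 _ _] := pp.
set h := u * _ in x0 H *.
have h0 : h != 0.
  by apply: contraNneq x0 => ->; rewrite mulr0 rmorph0 invr0 mulr0.
have f0 : f != 0 by apply: contraNneq x0 => ->; rewrite rmorph0 mul0r.
have [k [f' [fE nf]]] := prime_multiplicity pp f0.
have [m [h' [hE nh]]] := prime_multiplicity pp h0.
(* The exponent [m.+1] counts the displayed factor [p] together with its multiplicity in the rest of
   the denominator. *)
have k0 : (0 < k)%N.
  have := H p pp (k%:Z - m.+1%:Z); rewrite {1}fE hE mulrCA -exprS => /(_ (affine_ord pp k m.+1 nf nh)).
  by lia.
have pF0 : p%:F != 0 by rewrite -(rmorph0 iota) (inj_eq iota_inj).
have fE2 : f = (f' * p ^+ k.-1) * p by rewrite fE -mulrA -exprSr prednK.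
have E : f%:F / (p * h)%:F = (f' * p ^+ k.-1)%:F / h%:F.
  by rewrite fE2 (rmorphM iota _ p) [p * h]mulrC (rmorphM iota h) -mulf_div divff // mulr1.
rewrite E in x0 H *; apply: IH => // q qs; apply: ps; by rewrite inE qs orbT.
Qed.

End AffineDivisors.

(** * The inverse system *)

Section Apolarity.
Variables (C : numFieldType) (r : nat).
Implicit Types (f g : {mpoly C[r]}).

Lemma apolarE d f g : (msize f <= d)%N ->
  apolar f g = \sum_(m : 'X_{1..r < d}) f@_m *: g^`M[m].
Proof.
move=> le_fd; pose T : subFinType _ := 'X_{1..r < d}.
rewrite /apolar (big_mksub T) ?msupp_uniq //=; first last.
  by move=> x /msize_mdeg_lt /leq_trans; apply.
by rewrite big_rmcond //= => j /memN_msupp_eq0 ->; rewrite scale0r.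
Qed.

Lemma apolarD f1 f2 g : apolar (f1 + f2) g = apolar f1 g + apolar f2 g.
Proof.
pose d := maxn (msize (f1 + f2)) (maxn (msize f1) (msize f2)).
rewrite !(@apolarE d) ?leq_max ?leqnn ?orbT // -big_split /=.
by apply: eq_bigr => m _; rewrite mcoeffD scalerDl.
Qed.

Lemma apolarZ c f g : apolar (c *: f) g = c *: apolar f g.
Proof.
pose d := maxn (msize (c *: f)) (msize f).
rewrite !(@apolarE d) ?leq_max ?leqnn ?orbT // scaler_sumr /=.
by apply: eq_bigr => m _; rewrite mcoeffZ scalerA.
Qed.

Lemma apolar0 g : apolar 0 g = 0.
Proof. by rewrite /apolar msupp0 big_nil. Qed.

Lemma apolarX m g : apolar 'X_[m] g = g^`M[m].
Proof. by rewrite /apolar msuppX big_seq1 mcoeffX eqxx scale1r. Qed.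

Lemma apolar1 g : apolar 1 g = g.
Proof. by rewrite -mpolyX0 apolarX mderivm0m. Qed.

Lemma apolarZr c f g : apolar f (c *: g) = c *: apolar f g.
Proof.
rewrite /apolar scaler_sumr; apply: eq_bigr => m _.
by rewrite mderivmZ !scalerA mulrC.
Qed.

Lemma apolar0r f : apolar f 0 = 0.
Proof. by have := apolarZr 0 f 0; rewrite !scale0r. Qed.

Lemma apolarM f1 f2 g : apolar (f1 * f2) g = apolar f1 (apolar f2 g).
Proof.
elim/mpolyind: f1 => [|c m f1 _ _ IH]; first by rewrite mul0r !apolar0.
rewrite mulrDl !apolarD IH; congr (_ + _); rewrite -scalerAl !apolarZ; congr (_ *: _).
rewrite apolarX; elim/mpolyind: f2 {IH} => [|d m2 f2 _ _ IH].
  by rewrite mulr0 apolar0 -apolarX apolar0r.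
rewrite mulrDr !apolarD IH -scalerAr !apolarZ mderivmD mderivmZ; congr (_ *: _ + _).
by rewrite -mpolyXD !apolarX addmC mderivmDm.
Qed.

(** As [apolar] is a ring action, orthogonality to an ideal can be tested on generators. *)
Lemma annihilator_ideal g :
  is_ideal [set: {mpoly C[r]}]%classic [set f | apolar f g = 0]%classic.
Proof.
split=> //=; first exact: apolar0.
  by move=> x y xg yg; rewrite apolarD xg yg addr0.
by move=> a x _ xg; rewrite apolarM xg apolar0r.
Qed.

Lemma size_deriv_mpoly (p : {poly {mpoly C[r]}}) : size p^`() = (size p).-1.
Proof.
have [->|p0] := eqVneq p 0; first by rewrite raddf0 size_poly0.
case sp: (size p) => [|d]; first by move/eqP: sp; rewrite size_poly_eq0 (negbTE p0).
apply/eqP; rewrite eqn_leq -ltnS; have := lt_size_deriv p0; rewrite sp => -> /=.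
case: d sp => // d sp; rewrite ltnNge; apply/negP => /leq_sizeP /(_ d (leqnn d)).
rewrite coef_deriv => /eqP; rewrite -scaler_nat mscalerI pnatr_eq0 /=.
have : lead_coef p != 0 by rewrite lead_coef_eq0.
by rewrite lead_coefE sp /= => /negbTE ->.
Qed.

End Apolarity.

(** * Taylor expansion, and the inverse system as a set of degree bounds *)

Section InverseSystem.
Variables (C : numFieldType) (L : vectType C) (r n : nat) (b : r.-tuple L).
Hypothesis bL : basis_of fullv b.
Variable l : 'I_n -> 'Hom(L, C^o).
Local Notation coords v := (fun j => coord b j v).
Local Notation dg W := (dir_deg b (projv W)).
Implicit Types (v w : L) (f g : {mpoly C[r]}).

Definition shift v : {mpoly C[r]} -> {poly {mpoly C[r]}} :=
  subst (fun j => 'X_j) (fun j => (coord b j v)%:MP).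

Lemma shiftD v f g : shift v (f + g) = shift v f + shift v g. Proof. exact: substD. Qed.
Lemma shiftM v f g : shift v (f * g) = shift v f * shift v g. Proof. exact: substM. Qed.
Lemma shiftC v c : shift v c%:MP = c%:MP%:P. Proof. exact: substC. Qed.
Lemma shiftX v j : shift v 'X_j = ('X_j)%:P + (coord b j v)%:MP%:P * 'X.
Proof. exact: substX. Qed.

Lemma shift_horner0 v f : (shift v f).[0] = f.
Proof.
elim/mpoly_ring_ind: f => [c|j|p q Hp Hq|p q Hp Hq].
- by rewrite shiftC hornerC.
- by rewrite shiftX hornerD hornerC hornerMX mulr0 addr0.
- by rewrite shiftD hornerD Hp Hq.
- by rewrite shiftM hornerM Hp Hq.
Qed.

Lemma apolar_sym v g : apolar (sym_vec b v) g = \sum_(i < r) coord b i v *: g^`M(i).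
Proof.
rewrite /sym_vec; apply: (big_ind2 (fun f h => apolar f g = h)); first exact: apolar0.
  by move=> f1 h1 f2 h2 <- <-; exact: apolarD.
by move=> i _; rewrite apolarZ apolarX mderivmU1m.
Qed.

Lemma deriv_shift v g : (shift v g)^`() = shift v (apolar (sym_vec b v) g).
Proof.
rewrite apolar_sym.
pose D f := \sum_(i < r) coord b i v *: f^`M(i).
rewrite -/(D g); elim/mpoly_ring_ind: g => [c|j|p q Hp Hq|p q Hp Hq].
- rewrite shiftC derivC /D big1 ?[RHS]rmorph0 // => i _.
  by rewrite mderivC scaler0.
- rewrite shiftX derivD !derivC derivM derivC derivX mul0r mulr1 !add0r.
  have jj : (U_(j) - U_(j))%MM = 0%MM by rewrite -{1}[U_(j)%MM]add0m addmK.
  rewrite /D (bigD1 j) //= mderivX mnm1E eqxx scale1r jj mpolyX0 big1 ?addr0 => [|i ij].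
    by rewrite -mul_mpolyC mulr1 shiftC.
  by rewrite mderivX mnm1E eq_sym (negbTE ij) scale0r scaler0.
- have -> : D (p + q) = D p + D q.
    by rewrite /D -big_split; apply: eq_bigr => i _; rewrite mderivD scalerDr.
  by rewrite !shiftD derivD Hp Hq.
- have -> : D (p * q) = D p * q + p * D q.
    rewrite /D mulr_suml mulr_sumr -big_split; apply: eq_bigr => i _ /=.
    by rewrite mderivM scalerDr scalerAl scalerAr.
  by rewrite shiftD !shiftM derivM Hp Hq.
Qed.

(** In characteristic zero each derivative in [s] lowers the size by exactly one. Using the size,
    rather than the degree, also covers [g = 0] and [e = 0]. *)
Lemma size_shift v g e : (size (shift v g) <= e)%N <-> apolar (sym_vec b v ^+ e) g = 0.
Proof.
elim: e g => [|e IH] g.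
  rewrite expr0 apolar1 leqn0 size_poly_eq0; split=> [/eqP E|->]; last by rewrite /shift rmorph0.
  by rewrite -[g](shift_horner0 v) E horner0.
rewrite exprSr apolarM -IH -deriv_shift size_deriv_mpoly.
by case: (size (shift v g)).
Qed.

Lemma map_shift v w g : map_poly (meval (coords w)) (shift v g) = line (coords w) (coords v) g.
Proof.
elim/mpoly_ring_ind: g => [c|j|p q Hp Hq|p q Hp Hq].
- by rewrite shiftC map_polyC /= lineC mevalC.
- rewrite shiftX lineX rmorphD rmorphM /= map_polyX !map_polyC /=.
  by rewrite mevalXU mevalC.
- by rewrite shiftD rmorphD /= lineD Hp Hq.
- by rewrite shiftM rmorphM /= lineM Hp Hq.
Qed.

Lemma shift_lform v (phi : 'Hom(L, C^o)) :
  shift v (lform b phi) = (lform b phi)%:P + (phi v)%:MP%:P * 'X.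
Proof.
rewrite {1}/lform /shift rmorph_sum /=.
under eq_bigr => j _ do rewrite substZ substX mulrDr -polyCM mul_mpolyC mulrA -polyCM -mpolyCM.
rewrite big_split /= -rmorph_sum -mulr_suml -!rmorph_sum /=; congr (_ + _%:MP%:P * _).
rewrite [in RHS](coords_vec bL v) linear_sum; apply: eq_bigr => j _.
by rewrite linearZ /= mulrC.
Qed.

(** Moving along [v] in W fixes the coordinates composed with [1 - projv W] and is affine in [s] on
    those composed with [projv W], so the component of degree [k] along W has degree at most [k] in
    [s]. *)
Lemma shift_coef_bound (W : {vspace L}) v g : v \in W -> (size (shift v g) <= (dg W g).+1)%N.
Proof.
move=> vW; set d := dg W g.
have bound f k : (size (shift v ((dilate b (projv W) f)`_k)) <= k.+1)%N.
  apply: (@subst_coef _ _ _ _ _ (fun k h => (size (shift v h) <= k.+1)%N)) => [c|i|i p q Dp Dq|i j p q Dp Dq|j|j].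
  - by rewrite shiftC size_polyC_leq1.
  - by rewrite /shift rmorph0 size_poly0.
  - by rewrite shiftD; apply: leq_trans (size_polyD _ _) _; rewrite geq_max Dp.
  - rewrite shiftM; apply: leq_trans (size_polyMleq _ _) _.
    by move: Dp Dq; move: (size _) (size _) => x y; lia.
  - have E : lform b (fun v => coord b j (v - projv W v)) =
        lform b (linfun (coord b j : L -> C^o) \o (\1 - projv W))%VF.
      by apply: eq_lform => w; rewrite comp_lfunE lfunE add_lfunE opp_lfunE id_lfunE.
    rewrite E shift_lform comp_lfunE add_lfunE opp_lfunE id_lfunE projv_id // subrr linear0.
    by rewrite mpolyC0 polyC0 mul0r addr0 size_polyC_leq1.
  - have -> : lform b (fun v => coord b j (projv W v)) =
        lform b (linfun (coord b j : L -> C^o) \o projv W)%VF.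
      by apply: eq_lform => w; rewrite comp_lfunE lfunE.
    rewrite shift_lform; apply: leq_trans (size_polyD _ _) _.
    rewrite geq_max (leq_trans (size_polyC_leq1 _)) //=.
    apply: leq_trans (size_polyMleq _ _) _; rewrite size_polyX addn2 /=.
    by rewrite ltnS size_polyC_leq1.
have sg : (size (dilate b (projv W) g) <= d.+1)%N by rewrite size_theta.
rewrite [g](theta_sum bL sg) /shift rmorph_sum /= -/(shift v).
apply: leq_trans (size_sum _ _ _) _; apply/bigmax_leqP => k _.
by apply: leq_trans (bound g k) _.
Qed.

(* The degree of g along W is attained on a generic vector of W. *)
Lemma generic_shift (W : {vspace L}) g (phis : seq 'Hom(L, C^o)) : g != 0 ->
  (forall phi, phi \in phis -> exists2 w, w \in W & phi w != 0) ->
  exists v, [/\ v \in W, forall phi, phi \in phis -> phi v != 0 & (dg W g < size (shift v g))%N].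
Proof.
move=> g0 Hphi; set d := dg W g.
pose p (phi : 'Hom(L, C^o)) := lform b (phi \o projv W)%VF.
have ev phi x : (p phi).@[coords x] = phi (projv W x).
  by rewrite /p (lform_eval bL) comp_lfunE.
have pp : \prod_(phi <- phis) p phi != 0.
  rewrite prodf_seq_neq0; apply/allP => phi /Hphi [w wW nw] /=.
  by apply: contraNneq nw => p0; rewrite -(projv_id wW) -ev p0 meval0.
have : lead_coef (dilate b (projv W) g) != 0 by rewrite lead_coef_eq0 theta_eq0.
rewrite lead_coefE -/(dg W g) -/d => c0.
have [x] := nonroot_vec bL (mulf_neq0 pp c0).
rewrite mevalM mulf_eq0 => /norP [px cx]; exists (projv W x); split; first exact: memv_proj.
  move=> phi phis_phi; apply: contraNneq px => phi0.
  rewrite (big_rem phi) //= mevalM ev phi0 mul0r //.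
rewrite ltnNge; apply/negP => sz; move/eqP: cx; apply.
rewrite -coef_map /= (theta_eval bL) -map_shift nth_default //.
exact: leq_trans (size_poly _ _) sz.
Qed.

Variables (J : {set {set 'I_n}}) (k : int).
Hypotheses (l0 : (\bigcap_(i < n) lker (l i))%VS = 0%VS) (fJ : order_filter l J).
Local Notation stratum := (stratum l).

Lemma mem_stratum F v : v \in stratum F <-> forall i, i \in F -> l i v = 0.
Proof.
rewrite /Defs.stratum memvE; split=> [/subv_bigcapP H i iF|H].
  by apply/eqP; rewrite -memv_ker memvE; apply: H.
by apply/subv_bigcapP => i iF; rewrite -memvE memv_ker H.
Qed.

Lemma zeros_proper v : v != 0 -> proper_flat l [set i | v \in lker (l i)].
Proof.
move=> v0; apply/andP; split.
  apply/forallP => j; apply/implyP => /subvP H; rewrite inE; apply: H.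
  by apply/mem_stratum => i; rewrite inE memv_ker => /eqP.
apply: contraNneq v0 => E; rewrite -memv0 -l0 memvE; apply/subv_bigcapP => i _.
by rewrite -memvE; have : i \in [set: 'I_n] by []; rewrite -E inE.
Qed.

(** The forms vanishing at [v] make up the largest flat whose stratum contains [v], so by the filter
    condition it alone decides. *)
Lemma chi_zeros v : chi l J v = ([set i | v \in lker (l i)] \in J).
Proof.
apply/existsP/idP => [[G /andP [GJ /mem_stratum H]]|FJ].
  apply: (fJ.2 G) => //; last by apply/fintype.subsetP => i iG; rewrite inE memv_ker H.
  apply/forallP => j; apply/implyP => /subvP K; rewrite inE; apply: K.
  by apply/mem_stratum => i; rewrite inE memv_ker => /eqP.
exists [set i | v \in lker (l i)]; rewrite FJ; apply/mem_stratum => i.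
by rewrite inE memv_ker => /eqP.
Qed.

Lemma rho_zeros v : (rho l v)%:Z = n%:Z - #|[set i | v \in lker (l i)]|%:Z.
Proof.
have := cardsC [set i | v \in lker (l i)]; rewrite card_ord.
have -> : #|~: [set i | v \in lker (l i)]| = rho l v.
  by apply: eq_card => i; rewrite !inE.
by move=> E; apply/eqP; rewrite eq_sym subr_eq -PoszD eqz_nat -{1}E addnC.
Qed.

Lemma inverse_systemP g : inverse_system b l J k g <->
  forall v, v != 0 -> apolar (zonotopal_gen b l J k v) g = 0.
Proof.
split=> [H v v0|H f]; first by apply: H => I iI; apply; exists v.
move=> /(_ _ (annihilator_ideal g)); apply.
by move=> _ [v v0 <-]; apply: H.
Qed.

(** The exponent at [v] is [c + 1], with [c] the coefficient of the flat of forms vanishing at [v].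
    A generic vector of the stratum of F has exactly this flat and attains the degree of [g], so no
    bound is lost. *)
Lemma inverse_system_dg g : g != 0 -> inverse_system b l J k g <->
  forall F, proper_flat l F -> (dg (stratum F) g)%:Z <= zonotopal_divisor J k F.
Proof.
move=> g0; rewrite inverse_systemP; split=> [H F pF|H v v0].
  have /andP [/forallP fF nF] := pF.
  have [|v [vF nv sv]] := @generic_shift (stratum F) g [seq l i | i <- enum (~: F)] g0.
    move=> phi phiF; have /seq.mapP [i iF ->] := phiF; move: iF; rewrite mem_enum inE => niF.
    have : ~~ (stratum F <= lker (l i))%VS by apply: contraNN niF; exact/implyP.
    by move=> /subvPn [w wF nw]; exists w; rewrite // -memv_ker.
  have zF : [set i | v \in lker (l i)] = F.
    apply/setP => i; rewrite inE memv_ker; apply/eqP/idP => [li|iF]; last exact: (proj1 (mem_stratum F v) vF).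
    apply: contraT => niF; have := nv (l i); rewrite li eqxx; apply.
    by apply/seq.mapP; exists i; rewrite // mem_enum inE.
  have v0 : v != 0.
    apply: contraNneq nF => v0; rewrite -zF; apply/eqP/setP => i.
    by rewrite !inE memv_ker v0 linear0 eqxx.
  have := H v v0; rewrite /zonotopal_gen rho_zeros chi_zeros zF /zonotopal_divisor.
  set c := n%:Z - _ + k + _.
  (* A nonpositive exponent gives the generator 1, which kills only 0. *)
  case: ifP => [_|/negbT]; first by rewrite apolar1 => /eqP; rewrite (negbTE g0).
  rewrite -ltNge => e0 /size_shift; rewrite leqNgt => sz.
  rewrite leNgt; apply: contraNN sz => lt; apply: leq_trans sv.
  by move: (dg _ _) e0 lt => d; lia.
set F := [set i | v \in lker (l i)]; have pF := zeros_proper v0.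
have := H F pF; rewrite /zonotopal_divisor /zonotopal_gen rho_zeros chi_zeros -/F.
set c := n%:Z - _ + k + _; move=> cF.
(* The degree of [g] is at least 0, so its bound is too, and the exponent is positive. *)
case: ifP => [c0|/negbT]; first by exfalso; move: (dg _ _) cF c0 => d; lia.
rewrite -ltNge => e0; apply/size_shift; apply: leq_trans (shift_coef_bound g (_ : v \in stratum F)) _.
  by apply/mem_stratum => i; rewrite inE memv_ker => /eqP.
by move: (dg _ _) cF e0 => d; lia.
Qed.

End InverseSystem.

(** * Comparison *)

Lemma is_ord_ge0 (K : fieldType) (B : set K) x (z : int) :
  is_subring B -> B x -> is_ord B x z -> 0 <= z.
Proof.
move=> sB Bx [p [u [[Bp p0 nVp _] Bu BVu u0 xE]]].
rewrite leNgt; apply/negP; case: z xE => [//|m] xE _; apply: nVp.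
have -> : p^-1 = p ^+ m * (x * u^-1).
  rewrite xE NegzE -exprnN exprSr; have pm0 : p ^+ m != 0 by rewrite expf_neq0.
  by move: (p ^+ m) pm0 => c c0; field; rewrite ?u0 ?c0 ?p0.
by apply: (subringM sB); [exact: subringX|exact: subringM].
Qed.

Lemma uniq_split_eq (T : eqType) (ws s s' t t' : seq T) x :
  uniq ws -> ws = s ++ x :: t -> ws = s' ++ x :: t' -> s = s'.
Proof.
have H u v : uniq ws -> ws = u ++ x :: v -> u = take (index x ws) ws.
  move=> uws E; have xu : x \notin u.
    by move: uws; rewrite E cat_uniq => /and3P [_ /norP []].
  by rewrite E index_cat (negbTE xu) /= eqxx addn0 take_size_cat.
by move=> uws /(H _ _ uws) -> /(H _ _ uws) ->.
Qed.

(** * Strata as centers, and equality of the two sides *)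

Section Arrangement.
Variables (C : numFieldType) (L : vectType C) (r n : nat) (b : r.-tuple L).
Variable l : 'I_n -> 'Hom(L, C^o).
Hypothesis bL : basis_of fullv b.
Hypothesis l0 : (\bigcap_(i < n) lker (l i))%VS = 0%VS.
Local Notation stratum := (stratum l).
Local Notation cs := (centers l).
Local Notation ws := (map stratum cs).

Lemma mem_centers F : (F \in cs) = proper_flat l F.
Proof. by rewrite mem_sort mem_enum inE. Qed.

Lemma centers_uniq : uniq cs.
Proof. by rewrite sort_uniq enum_uniq. Qed.

Lemma flat_mem F j : flat l F -> (j \in F) = (stratum F <= lker (l j))%VS.
Proof.
move=> /forallP /(_ j) /implyP H; apply/idP/idP => [jF|/H //].
exact: bigcapv_inf jF _.
Qed.

Lemma stratum_inj F G : flat l F -> flat l G -> stratum F = stratum G -> F = G.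
Proof. by move=> fF fG E; apply/setP => j; rewrite !flat_mem // E. Qed.

Lemma stratum_setT : stratum [set: 'I_n] = 0%VS.
Proof. by rewrite -l0 /Defs.stratum; apply: eq_bigl => i; rewrite inE. Qed.

Lemma strata_neq0 W : W \in ws -> W != 0%VS.
Proof.
move=> /seq.mapP [F]; rewrite mem_centers => /andP [fF nF] ->.
apply: contraNneq nF => F0; apply/eqP/setP => j.
by rewrite (flat_mem j fF) F0 sub0v inE.
Qed.

Lemma strata_uniq : uniq ws.
Proof.
rewrite map_inj_in_uniq ?centers_uniq // => F G.
by rewrite !mem_centers => /andP [fF _] /andP [fG _]; apply: stratum_inj.
Qed.

Lemma strata_sorted : sorted (fun U V : {vspace L} => (\dim U <= \dim V)%N) ws.
Proof. by rewrite sorted_map; apply: sort_sorted => F G; exact: leq_total. Qed.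

(** The stratum of this flat may be larger than W; equality characterizes the strata. *)
Definition flat_of (W : {vspace L}) : {set 'I_n} := [set i | (W <= lker (l i))%VS].

Lemma flat_of_center W : stratum (flat_of W) = W -> W != 0%VS -> W \in ws.
Proof.
move=> SW W0; apply/seq.mapP; exists (flat_of W) => //; rewrite mem_centers; apply/andP; split.
  by apply/forallP => j; rewrite SW inE; apply/implyP.
by apply: contraNneq W0 => E; rewrite -SW E stratum_setT.
Qed.

Lemma flat_of_sub W : (W <= stratum (flat_of W))%VS.
Proof. by apply/subv_bigcapP => i; rewrite inE. Qed.

Lemma stratumS (F G : {set 'I_n}) : F \subset G -> (stratum G <= stratum F)%VS.
Proof.
move=> /fintype.subsetP FG; apply/subv_bigcapP => i iF.
exact: bigcapv_inf (FG i iF) _.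
Qed.

Lemma strata_cap U V : U \in ws -> V \in ws -> (U :&: V)%VS != 0%VS -> (U :&: V)%VS \in ws.
Proof.
move=> /seq.mapP [F _ ->] /seq.mapP [G _ ->]; apply: flat_of_center.
apply/eqP; rewrite eqEsubv flat_of_sub andbT subv_cap.
apply/andP; split; apply: stratumS; apply/fintype.subsetP => i iF; rewrite inE.
  by apply: subv_trans (capvSl _ _) _; exact: bigcapv_inf iF _.
by apply: subv_trans (capvSr _ _) _; exact: bigcapv_inf iF _.
Qed.

(** This is the stratum of the smallest flat, made up of the zero forms. *)
Lemma strata_full : (0 < r)%N -> fullv \in ws.
Proof.
move=> r0; apply: flat_of_center.
  by apply/eqP; rewrite eqEsubv flat_of_sub subvf.
have dr : \dim {:L} = r by exact: vector.size_basis bL.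
by rewrite -dimv_eq0 dr -lt0n.
Qed.

Lemma strata_split F : proper_flat l F ->
  ws = map stratum (take (index F cs) cs) ++ stratum F :: map stratum (drop (index F cs).+1 cs).
Proof.
rewrite -mem_centers => Fcs.
rewrite -[stratum F](congr1 stratum (nth_index F Fcs)) -map_cons -drop_nth ?index_mem //.
by rewrite -map_cat cat_take_drop.
Qed.

Variables (K : fieldType) (iota : {rmorphism {mpoly C[r]} -> K}).
Hypothesis iota_inj : injective iota.
Hypothesis fracP : forall x, exists p q : {mpoly C[r]}, q != 0 /\ x = iota p / iota q.
Local Notation val W := (dir_val b (projv W) fracP).
Local Notation val_ring W := (dir_val_ring b (projv W) fracP).
Local Notation eta W := (eta b iota W).
Local Notation blowups := (blowups b iota).

Definition boundary F B := exceptional_divisor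
  (blowups (map stratum (take (index F cs) cs))) (eta (stratum F)) B.

Definition boundary_mult (c : {set 'I_n} -> int) B : int :=
  \sum_(F | proper_flat l F) c F * `[< boundary F B >]%:Z.

Lemma boundary_mult_eq c F B : proper_flat l F -> boundary F B -> boundary_mult c B = c F.
Proof.
move=> pF bF; rewrite /boundary_mult (bigD1 F) //=.
have -> : `[< boundary F B >] = true by apply/asboolP.
rewrite mulr1 big1 ?addr0 // => G /andP [pG GF].
have [/asboolP bG|_] := boolP `[< boundary G B >]; last by rewrite mulr0.
move/eqP: GF; case; have /andP [fF _] := pF; have /andP [fG _] := pG.
apply: stratum_inj => //.
exact: (exceptional_inj bL iota_inj fracP strata_uniq strata_neq0 strata_sorted strata_cap
  (strata_split pG) (strata_split pF) bG bF).
Qed.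

Lemma boundary_mult_affine c B : (forall f, B (iota f)) -> boundary_mult c B = 0.
Proof.
move=> Bf; rewrite /boundary_mult big1 // => F pF.
have [/asboolP bF|_] := boolP `[< boundary F B >]; last by rewrite mulr0.
by case: (exceptional_not_affine bL iota_inj fracP strata_uniq strata_neq0 strata_sorted strata_cap
  (strata_split pF) bF Bf).
Qed.

Variables (J : {set {set 'I_n}}) (k : int).
Hypothesis fJ : order_filter l J.
Local Notation c := (zonotopal_divisor J k).

Lemma inverse_system_sections (x : K) :
  (exists2 g, inverse_system b l J k g & iota g = x) <->
  (x = 0 \/ forall B z, prime_divisor (blowups ws) B -> is_ord B x z -> 0 <= z + boundary_mult c B).
Proof.
split=> [[g gI <-]|].
  have [g0|g0] := eqVneq g 0; first by left; rewrite g0 rmorph0.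
  have /(inverse_system_dg bL k l0 fJ g0) dgF := gI.
  right=> B z [bB uB] oB; have lB : is_local B by apply: blowups_local bB.
  have [Bf|[s [W [t [wsE bW [A [sA AW dB]]]]]]] :=
    blowups_affine bL iota_inj strata_full bB.
    by rewrite boundary_mult_affine // addr0; apply: is_ord_ge0 (lB.1) (Bf g) oB.
  have : W \in ws by rewrite wsE mem_cat mem_head orbT.
  move=> /seq.mapP [F]; rewrite mem_centers => pF WE; rewrite {W}WE in wsE bW AW.
  have sE := uniq_split_eq strata_uniq wsE (strata_split pF).
  have bF : boundary F B.
    by rewrite /boundary -sE; split; [split|exists A].
  rewrite (boundary_mult_eq c pF bF).
  have -> := exceptional_ord bL iota_inj fracP strata_uniq strata_neq0 strata_sorted strata_cap
    (strata_split pF) bF oB.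
  by rewrite (val_poly bL _ iota_inj fracP) // addrC subr_ge0; apply: dgF.
move=> [->|H].
  exists 0; rewrite ?rmorph0 //; apply/inverse_systemP => v v0; exact: apolar0r.
have [x0|x0] := eqVneq x 0.
  exists 0; rewrite ?rmorph0 //; apply/inverse_systemP => v v0; exact: apolar0r.
have [|g xE] := poly_of_ord bL iota_inj fracP x0.
  (* The local ring along a hypersurface of L lies on no center, so it remains a prime divisor, with
     multiplicity 0. *)
  move=> pi ppi z oz; have Af := affine_poly iota_inj ppi.
  have := H _ z _ oz; rewrite (boundary_mult_affine c Af) addr0; apply.
  split; last by exists (iota pi); exact: (affine_uniformizer bL iota_inj fracP).
  apply: (blowups_pass iota_inj (s := [::]) (t := ws)); first exact: affine_point.
  by move=> W Ww; apply: (affine_not_eta bL iota_inj fracP) => //; exact: strata_neq0.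
have g0 : g != 0 by apply: contraNneq x0 => g0; rewrite xE g0 rmorph0.
exists g => //; apply/(inverse_system_dg bL k l0 fJ g0) => F pF.
(* The bound along the stratum is read off at its valuation ring, which is a prime divisor of the
   final blow-up. *)
have eF := val_ring_exceptional bL iota_inj fracP strata_uniq strata_neq0 strata_sorted strata_full (strata_split pF).
have [[_ [pi upi]] _] := eF; have [_ _ _ /(_ x x0) [u [z [Bu BVu u0 E]]]] := upi.
have oz : is_ord (val_ring (stratum F)) x z by exists pi, u.
have := H (val_ring (stratum F)) z _ oz.
rewrite (boundary_mult_eq c pF eF).
have -> := exceptional_ord bL iota_inj fracP strata_uniq strata_neq0 strata_sorted strata_cap
    (strata_split pF) eF oz.
rewrite xE (val_poly bL _ iota_inj fracP) // addrC subr_ge0; apply.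
split; last by exists pi.
exact: (val_ring_blowups bL iota_inj fracP strata_uniq strata_neq0 strata_sorted strata_full (strata_split pF)).
Qed.

End Arrangement.

(** * Specialization to the field of fractions in the definitions *)

Section FunctionField.
Variables (C : numFieldType) (L : vectType C) (r n : nat) (b : r.-tuple L).
Variable l : 'I_n -> 'Hom(L, C^o).
Local Notation K := {fraction {mpoly C[r]}}.
Local Notation iota := (@tofrac {mpoly C[r]}).

Lemma iterated_blowupE s : iterated_blowup b l s = blowups b iota (map (stratum l) s).
Proof.
rewrite /iterated_blowup /blowups; have : @proj_space C r = proj_points iota by [].
by move: (@proj_space _ _) (proj_points _) => X Y ->; elim: s Y => //= F s IH Y; exact: IH.
Qed.

Lemma boundary_divisorE F B : boundary_divisor b l F B = boundary b l iota F B.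
Proof. by rewrite /boundary_divisor iterated_blowupE. Qed.

Lemma multE c B : mult b l c B = boundary_mult b l iota c B.
Proof. by apply: eq_bigr => F _; rewrite boundary_divisorE. Qed.

Lemma wonderfulE : wonderful b l = blowups b iota (map (stratum l) (centers l)).
Proof. exact: iterated_blowupE. Qed.

Lemma inverse_system_global_sections (J : {set {set 'I_n}}) (k : int) :
  basis_of fullv b ->
  (\bigcap_(i < n) lker (l i))%VS = 0%VS ->
  order_filter l J ->
  [set iota g | g in inverse_system b l J k]%classic =
  global_sections b l (zonotopal_divisor J k).
Proof.
move=> bL l0 fJ.
have iota_inj : injective iota by move=> p q /eqP; rewrite tofrac_eq => /eqP.
have fracP (x : K) : exists p q : {mpoly C[r]}, q != 0 /\ x = iota p / iota q.
  exists (frac (repr x)).1, (frac (repr x)).2; split; last exact: frac_numden.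
  exact: denom_ratioP.
have H := inverse_system_sections bL l0 iota_inj fracP k fJ.
apply/seteqP; split=> x.
  move=> /H [x0|Hx]; first by left.
  by right=> B z; rewrite wonderfulE multE; exact: Hx.
move=> Hx; apply/H; case: Hx => [x0|Hx]; first by left.
by right=> B z pB oB; rewrite -multE; apply: Hx oB; rewrite wonderfulE.
Qed.

End FunctionField.

Theorem proposition3p15 (R : realType) (L : vectType R[i]) (r n : nat)
  (b : r.-tuple L) (l : 'I_n -> 'Hom(L, R[i]^o))
  (J : {set {set 'I_n}}) (k : int) :
  basis_of fullv b ->
  (\bigcap_(i < n) lker (l i))%VS = 0%VS ->
  order_filter l J ->
  [set tofrac g | g in inverse_system b l J k]%classic =
  global_sections b l (zonotopal_divisor J k).
Proof. exact: inverse_system_global_sections. Qed.
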